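(* Let the general setting given in the context hold. Assume that the activation function satisfies $\sigma\in\mathcal{C}_{\mathrm{locLip}}(\mathbb{R},\mathbb{R})$ (locally Lipschitz), and that one of the following two conditions holds. (A) $F(t,\cdot):X\times H\to W$ is weakly continuous for a.e. $t\in(0,T)$ (in this case it is understood that $F(t,\cdot,\cdot)$ is well defined on $X\times H$ and that the requirements on $F$ in the setting hold for its restriction to $X\times V$). (B) $V\hookrightarrow\hookrightarrow H$, $H\hookrightarrow W^*$, and $-F$ is pseudomonotone in the following sense: for almost all $t\in(0,T)$, whenever $(w_k)_k\subset V$, $w\in V$, $(\lambda_k)_k\subset X$, $\lambda\in X$ satisfy $(w_k,\lambda_k)\rightharpoonup(w,\lambda)$ in $H\times X$ and $\liminf_{k\to\infty}\langle F(t,\lambda_k,w_k),w_k-w\rangle_{W,W^*}\ge 0$, then $$\langle F(t,\lambda,w),w-v\rangle_{W,W^*}\ \ge\ \limsup_{k\to\infty}\langle F(t,\lambda_k,w_k),w_k-v\rangle_{W,W^*}\qquad\text{for all } v\in W^*.$$ Assume further that $\mathcal{R}_1:X\times\mathbb{R}^m\times U_0\times\mathcal{V}\to[0,\infty]$ and $\mathcal{R}_2:\Theta\to[0,\infty]$ are nonnegative, weakly lower semi-continuous and such that the sublevel sets of $(\lambda,\alpha,u_0,u,\theta)\mapsto\mathcal{R}_1(\lambda,\alpha,u_0,u)+\mathcal{R}_2(\theta)$ are weakly precompact. Then, for any data $y^1,\dots,y^K\in\mathcal{Y}$, the learning problem $$\min_{\substack{(\lambda^k,\alpha^k,u_0^k,u^k)_{k=1}^K\subset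 X\times\mathbb{R}^m\times U_0\times\mathcal{V}\\ \theta\in\Theta}}\ \sum_{k=1}^K\Big(\|\mathcal{G}(\lambda^k,\alpha^k,u_0^k,u^k,\theta)-(0,0,y^k)\|^2_{\mathcal{W}\times H\times\mathcal{Y}}+\mathcal{R}_1(\lambda^k,\alpha^k,u_0^k,u^k)\Big)+\mathcal{R}_2(\theta)$$ admits a solution, and, for any fixed $\hat\theta\in\Theta$ and $y\in\mathcal{Y}$, the parameter identification problem $$\min_{(\lambda,\alpha,u_0,u)\in X\times\mathbb{R}^m\times U_0\times\mathcal{V}}\ \|\mathcal{G}(\lambda,\alpha,u_0,u,\hat\theta)-(0,0,y)\|^2_{\mathcal{W}\times H\times\mathcal{Y}}+\mathcal{R}_1(\lambda,\alpha,u_0,u)$$ admits a solution.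
   Context: General setting. $\Omega\subset\mathbb{R}^d$ is a bounded Lipschitz domain, $T>0$, $m,K\in\mathbb{N}$. $\hookrightarrow$ denotes a continuous embedding, $\hookrightarrow\hookrightarrow$ a compact embedding. $X$ and $U_0$ are reflexive Banach spaces; $V,W,Y,\tilde V,H$ are separable reflexive Banach spaces, with $$U_0\hookrightarrow H\hookrightarrow W,\quad V\hookrightarrow H\hookrightarrow\tilde V,\quad V\hookrightarrow Y,\quad V\hookrightarrow\hookrightarrow L^{\hat p}(\Omega)\hookrightarrow W\ \text{ for some }\hat p\in[1,\infty),$$ and either $L^{\hat p}(\Omega)\hookrightarrow\tilde V$ or $\tilde V\hookrightarrow L^{\hat p}(\Omega)$. The function $F:(0,T)\times X\times V\to W$ is such that for each fixed $\lambda\in X$, $F(\cdot,\lambda,v)$ is measurable for all $v\in V$ and $F(t,\lambda,\cdot)$ is continuous for a.e. $t\in(0,T)$; moreover, for a.e. $t$ and all $\lambda\in X$, $v\in V$, $\|F(t,\lambda,v)\|_W\le\mathcal{B}(\|\lambda\|_X,\|v\|_H)(\gamma(t)+\|v\|_V)$ for some $\gamma\in L^2(0,T)$ and some $\mathcal{B}:\mathbb{R}^2\to\mathbb{R}$ such that $b\mapsto\mathcal{B}(a,b)$ is increasing for each $a\in\mathbb{R}$. Set $\mathcal{V}=L^2(0,T;V)\cap H^1(0,T;\tilde V)$ with $\|u\|_{\mathcal V}^2=\int_0^T\|u(t)\|_V^2+\|\dot u(t)\|_{\tilde V}^2\,dt$, $\mathcal{W}=L^2(0,T;W)$, $\mathcal{Y}=L^2(0,T;Y)$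 with their usual norms. $M\in\mathcal{L}(\mathcal{V},\mathcal{Y})$ is a bounded linear (measurement) operator. It is assumed that $\mathcal{V}\hookrightarrow L^\infty((0,T)\times\Omega)$ and $\mathcal{V}\hookrightarrow C(0,T;H)$. The time derivative $\frac{d}{dt}$ is understood to map $\mathcal{V}$ continuously into $\mathcal{W}$. $F$ also denotes the induced Nemytskii operator $F:X\times\mathcal{V}\to\mathcal{W}$, $[F(\lambda,u)](t)=F(t,\lambda,u(t))$. Neural networks. A neural network of depth $L$ with fixed architecture $(n_i)_{i=0}^L$, here $n_0=m+1$, $n_L=1$, is $\mathcal{N}_\theta=L_{\theta_L}\circ\dots\circ L_{\theta_1}$, where $L_{\theta_l}(z)=\sigma(\omega^lz+\beta^l)$ for $l<L$ and $L_{\theta_L}(z)=\omega^Lz+\beta^L$, with $\omega^l\in\mathcal{L}(\mathbb{R}^{n_{l-1}},\mathbb{R}^{n_l})$, $\beta^l\in\mathbb{R}^{n_l}$, $\theta_l=(\omega^l,\beta^l)$, and $\sigma:\mathbb{R}\to\mathbb{R}$ applied componentwise. $\Theta$ is the finite dimensional space of all parameters $\theta=(\theta_1,\dots,\theta_L)$. For $\alpha\in\mathbb{R}^m$, $u\in\mathcal{V}$, $[\mathcal{N}_\theta(\alpha,u)](t,x)=\mathcal{N}_\theta(\alpha,u(t,x))$ defines a Nemytskii operator with values in $\mathcal{W}$. Forward operator. $\mathcal{G}:X\times\mathbb{R}^m\times U_0\times\mathcal{V}\times\Theta\to\mathcal{W}\times H\times\mathcal{Y}$, $$\mathcal{G}(\lambda,\alpha,u_0,u,\theta)=(\dot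 u-F(\lambda,u)-\mathcal{N}_\theta(\alpha,u),\ u(0)-u_0,\ Mu).$$ Weak continuity means continuity with respect to weak convergence (of sequences) in both domain and image space.
   Formalization: For the parameter identification problem it is additionally assumed that R_2 is finite at some θ: if R_2 is identically ∞, all sublevel sets of R_1+R_2 are empty, and with R_1=0 a minimizer need not exist. *)

(* Defs.v *)
From HB Require Import structures.
From mathcomp Require Import all_boot all_order all_algebra.
From mathcomp Require Import all_classical all_reals all_analysis.
From mathcomp Require Import measurable_realfun ess_sup_inf ring lra.
Set Implicit Arguments.
Unset Strict Implicit.
Unset Printing Implicit Defensive.
Import Order.TTheory GRing.Theory Num.Theory numFieldNormedType.Exports.
Local Open Scope classical_set_scope.
Local Open Scope ring_scope.

Record bounded_op (R : realType) (E F : normedModType R) := BoundedOp {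
  op_fun :> {linear E -> F} ;
  op_continuous : continuous op_fun }.

Lemma op_comp_continuous (R : realType) (E F G : normedModType R)
  (g : bounded_op F G) (f : bounded_op E F) : continuous (g \o f).
Proof. by move=> x; apply: continuous_comp; exact: op_continuous. Qed.

Definition op_comp (R : realType) (E F G : normedModType R)
    (g : bounded_op F G) (f : bounded_op E F) : bounded_op E G :=
  @BoundedOp R E G (g \o f) (@op_comp_continuous R E F G g f).

Definition compact_op (R : realType) (E F : normedModType R)
    (f : bounded_op E F) : Prop :=
  forall A : set E, bounded_set A -> precompact (f @` A).

Definition separable (R : realType) (E : normedModType R) : Prop :=
  exists S : set E, countable S /\ dense S.

Section dual.
Context (R : realType) (E : normedModType R).

Definition dual_pred : {pred E -> R^o} :=
  fun f => `[< linear f /\ continuous f >].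

Record dual := Dual { dual_fun :> E -> R^o ; dualP : dual_fun \in dual_pred }.

HB.instance Definition _ := [isSub for dual_fun].
HB.instance Definition _ := [Choice of dual by <:].

Lemma dual_submod_closed : submod_closed dual_pred.
Proof.
split=> [|a f g /asboolP[lf cf] /asboolP[lg cg]]; apply/asboolP; split.
- by move=> a x y; rewrite scaler0 addr0.
- by move=> x; exact: cvg_cst.
- by move=> b x y; rewrite -[LHS]/(a *: f _ + g _) lf lg
    -[RHS]/(b *: (a *: f x + g x) + (a *: f y + g y))
    !scalerDr !scalerA (mulrC b) addrACA.
- by move=> x; apply: cvgD; [apply: cvgZr; exact: cf | exact: cg].
Qed.
HB.instance Definition _ :=
  GRing.isSubmodClosed.Build _ _ dual_pred dual_submod_closed.
HB.instance Definition _ := [SubChoice_isSubLmodule of dual by <:].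

Lemma dual_linear (f : dual) : linear f.
Proof. by case: f => f /= /asboolP[]. Qed.
HB.instance Definition _ (f : dual) :=
  GRing.isLinear.Build R E R^o _ f (dual_linear f).

Lemma dual_continuous (f : dual) : continuous f.
Proof. by case: f => f /= /asboolP[]. Qed.

Definition dual_norm (f : dual) : R :=
  sup [set `|f x| | x in [set x : E | `|x| <= 1]].

Lemma dual_has_sup (f : dual) :
  has_sup [set `|f x| | x in [set x : E | `|x| <= 1]].
Proof.
split; first by exists `|f 0|, 0 => //=; rewrite normr0.
have /linear_boundedP/pinfty_ex_gt0[M M0 h] :=
  continuous_linear_bounded 0 (@dual_continuous f 0).
exists M => _ [x /= x1 <-].
by rewrite (le_trans (h x))// ler_piMr// ltW.
Qed.

Lemma dual_norm_ge (f : dual) (x : E) : `|x| <= 1 -> `|f x| <= dual_norm f.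
Proof. by move=> x1; apply: sup_ubound; [case: (dual_has_sup f) | exists x]. Qed.

Lemma dual_norm_le (f : dual) (M : R) :
  (forall x : E, `|x| <= 1 -> `|f x| <= M) -> dual_norm f <= M.
Proof.
move=> h; apply: ge_sup; first by case: (dual_has_sup f).
by move=> _ [x x1 <-]; exact: h.
Qed.

Lemma dual_norm_ge0 (f : dual) : 0 <= dual_norm f.
Proof. by apply: le_trans (dual_norm_ge f (x := 0) _); rewrite ?normr0. Qed.

Lemma dual_normD (f g : dual) : dual_norm (f + g) <= dual_norm f + dual_norm g.
Proof.
apply: dual_norm_le => x x1; rewrite (le_trans (ler_normD _ _))//.
by rewrite lerD// dual_norm_ge.
Qed.

Lemma dual_normZ_le (a : R) (f : dual) :
  dual_norm (a *: f) <= `|a| * dual_norm f.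
Proof.
apply: dual_norm_le => x x1; rewrite (_ : (a *: f) x = a * f x)// normrM.
by rewrite ler_wpM2l// dual_norm_ge.
Qed.

Lemma dual_normZ (a : R) (f : dual) : dual_norm (a *: f) = `|a| * dual_norm f.
Proof.
apply/eqP; rewrite eq_le dual_normZ_le/=.
have [->|a0] := eqVneq a 0; first by rewrite normr0 mul0r dual_norm_ge0.
rewrite -ler_pdivlMl ?normr_gt0// -normfV.
by rewrite -{1}(scalerK a0 f) dual_normZ_le.
Qed.

Lemma dual_norm0_eq0 (f : dual) : dual_norm f = 0 -> f = 0.
Proof.
move=> f0; apply/val_inj/funext => x /=.
have [->|x0] := eqVneq x 0; first by rewrite linear0.
have nx0 : `|x| != 0 by rewrite normr_eq0.
have /(dual_norm_ge f) : `| `|x|^-1 *: x| <= 1.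
  by rewrite normrZ normfV normr_id mulVf.
rewrite f0 linearZ/= normrM normfV normr_id pmulr_rle0 ?invr_gt0 ?normr_gt0//.
by rewrite normr_le0 => /eqP.
Qed.

HB.instance Definition _ :=
  Lmodule_isNormed.Build R dual dual_normD dual_normZ dual_norm0_eq0.

End dual.

Section weak_topology.
Context (R : realType).

Definition reflexive_space (E : normedModType R) : Prop :=
  forall Phi : dual (dual E), exists x : E, forall f : dual E, Phi f = f x.

Definition weak_cvg (E : normedModType R) (x : nat -> E) (l : E) : Prop :=
  forall f : dual E, f (x n) @[n --> \oo] --> f l.

Definition weakly_continuous (E F : normedModType R) (f : E -> F) : Prop :=
  forall x l, weak_cvg x l -> weak_cvg (f \o x) (f l).

Definition weakly_lsc (E : normedModType R) (f : E -> \bar R) : Prop :=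
  forall x l, weak_cvg x l -> (f l <= limn_einf (f \o x))%E.

(* Sequential; the weak limit is not required to lie in A *)
Definition weakly_precompact (E : normedModType R) (A : set E) : Prop :=
  forall x : nat -> E, (forall n, A (x n)) ->
  exists s : nat -> nat, {homo s : m n / (m < n)%N} /\
    exists l, weak_cvg (x \o s) l.

End weak_topology.

Section strongly_measurable.
Context d (T : measurableType d) (R : realType) (E : normedModType R).

Definition simple_function (s : T -> E) : Prop :=
  finite_set (range s) /\ forall e : E, measurable (s @^-1` [set e]).

(* Bochner measurability *)
Definition strongly_measurable (f : T -> E) : Prop :=
  exists s : nat -> T -> E, (forall n, simple_function (s n)) /\
    forall x, s n x @[n --> \oo] --> f x.

Lemma simple_function_preimage (s : T -> E) (A : set E) :
  simple_function s -> measurable (s @^-1` A).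
Proof.
move=> [fs ms]; rewrite (_ : _ @^-1` _ =
    \bigcup_(e in range s `&` A) (s @^-1` [set e])); last first.
  apply/seteqP; split => [x Ax|x [e [_ Ae] /= ->//]].
  by exists (s x) => //; split => //; exists x.
by apply: fin_bigcup_measurable => [|e _]; [exact: finite_setIl | exact: ms].
Qed.

Lemma simple_function_cst (e : E) : simple_function (cst e).
Proof.
split; first by apply: sub_finite_set (finite_set1 e) => _ [x _ <-].
move=> e'; rewrite preimage_cst; case: ifP => _; exact: measurableT || exact: measurable0.
Qed.

Lemma simple_function_comp2 (g : E -> E -> E) (s t : T -> E) :
  simple_function s -> simple_function t ->
  simple_function (fun x => g (s x) (t x)).
Proof.
move=> ss st; split.
  apply: (@sub_finite_set _ _ [set g a b | a in range s & b in range t]).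
    by move=> _ [x _ <-]; exists (s x); [exists x|exists (t x); [exists x|]].
  by apply: finite_image2; [case: ss | case: st].
move=> e; rewrite (_ : _ @^-1` _ = \bigcup_(a in range s)
    (s @^-1` [set a] `&` t @^-1` [set b | g a b = e])); last first.
  apply/seteqP; split => [x /= <-|x [a _ [/= -> ->]]//].
  by exists (s x) => //; exists x.
apply: fin_bigcup_measurable => [|a _]; first by case: ss.
by apply: measurableI; exact: simple_function_preimage.
Qed.

Lemma strongly_measurable_lin (a : R) (f g : T -> E) :
  strongly_measurable f -> strongly_measurable g ->
  strongly_measurable (a *: f + g).
Proof.
move=> [s [ss sf]] [t [st tg]].
exists (fun n x => a *: s n x + t n x); split => [n|x].
  exact: (@simple_function_comp2 (fun u v => a *: u + v)).
by apply: cvgD => //; apply: cvgZl_tmp.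
Qed.

Lemma strongly_measurable0 : strongly_measurable 0.
Proof.
by exists (fun _ => cst 0); split => [n|x]; [exact: simple_function_cst | exact: cvg_cst].
Qed.

Lemma strongly_measurable_norm (f : T -> E) :
  strongly_measurable f -> measurable_fun setT (fun x => `|f x|).
Proof.
move=> [s [ss sf]].
apply: (@measurable_fun_cvg _ _ _ _ (fun n x => `|s n x|)).
  move=> n mT Y mY; rewrite setTI.
  by have := @simple_function_preimage (s n) [set e | Y `|e|] (ss n).
by move=> x _; apply: cvg_norm.
Qed.

End strongly_measurable.

Definition ae_strongly_measurable d (T : measurableType d) (R : realType)
    (mu : {measure set T -> \bar R}) (E : normedModType R) (f : T -> E) : Prop :=
  exists2 g, strongly_measurable g & {ae mu, forall x, f x = g x}.



Section Lnorm_extra.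
Context d (T : measurableType d) (R : realType) (mu : {measure set T -> \bar R}).
Context (p : \bar R) (p1 : (1 <= p)%E).
Implicit Types f g : T -> R.

Lemma measurable_norm_poweR (r : R) f : measurable_fun setT f ->
  measurable_fun setT (fun x => (`|f x| `^ r)%:E).
Proof.
move=> mf; rewrite (_ : (fun _ => _) = EFin \o (fun x => `|f x| `^ r))//.
apply/measurable_EFinP.
apply: (@measurableT_comp _ _ _ _ _ _ (@powR R ^~ r)) => //.
exact: measurableT_comp.
Qed.

Lemma le_Lnorm f g : (forall x, 0 <= f x <= g x) ->
  measurable_fun setT f -> measurable_fun setT g ->
  ('N[mu]_p[EFin \o f] <= 'N[mu]_p[EFin \o g])%E.
Proof.
move=> fg mf mg; have fgE x : (`|(f x)%:E| <= `|(g x)%:E|)%E.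
  have /andP[f0 fgx] := fg x.
  by rewrite lee_fin !ger0_norm// (le_trans f0).
rewrite unlock /Lnorm; case: p p1 => [r r1|_|//]; last first.
  by case: ifPn => // _; apply: le_ess_sup; apply/nearW => x /=; exact: fgE.
have r0 : 0 <= r by rewrite (le_trans ler01)// -lee_fin.
apply: gt0_ler_poweR; rewrite ?invr_ge0// ?in_itv/= ?leey ?andbT.
- by apply: integral_ge0 => x _; rewrite lee_fin powR_ge0.
- by apply: integral_ge0 => x _; rewrite lee_fin powR_ge0.
apply: ge0_le_integral => //.
- exact: measurable_norm_poweR.
- exact: measurable_norm_poweR.
- move=> x _; have := fgE x; rewrite !lee_fin => fgx.
  by apply: ge0_ler_powR => //; rewrite nnegrE.
Qed.

Lemma ge0_LnormZ f (a : R) : measurable_fun setT f -> (forall x, 0 <= f x) ->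
  ('N[mu]_p[EFin \o f] < +oo)%E ->
  ('N[mu]_p[(fun x => (`|a| * f x)%:E)] = `|a|%:E * 'N[mu]_p[EFin \o f])%E.
Proof.
move=> mf f0 foo.
have fL : f \in Lfun mu p.
  by rewrite inE; apply/andP; split; rewrite inE.
have := @LnormZ _ _ _ mu p p1 (Lfun_Sub p1 fL) `|a|.
by rewrite normr_id.
Qed.

Lemma eq_ae_Lnorm f g : measurable_fun setT f -> measurable_fun setT g ->
  f = g %[ae mu] -> ('N[mu]_p[EFin \o f] = 'N[mu]_p[EFin \o g])%E.
Proof.
move=> mf mg fg.
rewrite unlock /Lnorm; case: p p1 => [r r1|_|//]; last first.
  case: ifPn => // _; apply: eq_ess_sup.
  by apply: filterS fg => x /(_ I) /= ->.
congr (_ `^ _)%E; apply: ae_eq_integral => //.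
- exact: measurable_norm_poweR.
- exact: measurable_norm_poweR.
- by apply: filterS fg => x /(_ I) /= ->.
Qed.

End Lnorm_extra.

Section Lp.
Context d (T : measurableType d) (R : realType) (mu : {measure set T -> \bar R}).
Context (p : \bar R) (p1 : (1 <= p)%E) (E : normedModType R).

Definition Lfun_pred & (1 <= p)%E : {pred T -> E} := fun f =>
  `[< strongly_measurable f /\ ('N[mu]_p[(fun x => (`|f x|)%:E)] < +oo)%E >].

Local Notation Lp_pred := (Lfun_pred p1).

Lemma Lp_norm_lin (a : R) (f g : T -> E) : f \in Lp_pred -> g \in Lp_pred ->
  ('N[mu]_p[(fun x => (`|(a *: f + g) x|)%:E)] <=
   `|a|%:E * 'N[mu]_p[(fun x => (`|f x|)%:E)] + 'N[mu]_p[(fun x => (`|g x|)%:E)])%E.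
Proof.
move=> /asboolP[mf lf] /asboolP[mg lg].
have mNf := strongly_measurable_norm mf; have mNg := strongly_measurable_norm mg.
rewrite -(@ge0_LnormZ _ _ _ mu p p1 (fun x => `|f x|) a)//.
have maf : measurable_fun setT (fun x => `|a| * `|f x|) by exact: measurable_funM.
apply: le_trans (eminkowski mu maf mNg p1).
apply: (@le_Lnorm _ _ _ mu p p1 (fun x => `|(a *: f + g) x|)
  ((fun x => `|a| * `|f x|) \+ (fun x => `|g x|))).
- by move=> x; rewrite normr_ge0/= -normrZ; exact: ler_normD.
- exact/strongly_measurable_norm/strongly_measurable_lin.
- exact: measurable_funD.
Qed.

Lemma Lp_pred_submod_closed : submod_closed Lp_pred.
Proof.
split=> [|a f g lf lg].
  apply/asboolP; split; first exact: strongly_measurable0.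
  rewrite (_ : (fun _ => _) = cst 0%E); last first.
    by apply/funext => x /=; rewrite normr0.
  by rewrite Lnorm0// gt_eqF// (lt_le_trans _ p1).
apply/asboolP; split.
  by move: lf lg => /asboolP[mf _] /asboolP[mg _]; exact: strongly_measurable_lin.
apply: le_lt_trans (Lp_norm_lin a lf lg) _.
move: lf lg => /asboolP[mf lf] /asboolP[mg lg].
by rewrite lte_add_pinfty// lte_mul_pinfty.
Qed.

HB.instance Definition _ :=
  GRing.isSubmodClosed.Build _ _ Lp_pred Lp_pred_submod_closed.

Record preLp := PreLp { preLp_fun :> T -> E ; preLpP : preLp_fun \in Lp_pred }.
HB.instance Definition _ := [isSub for preLp_fun].
HB.instance Definition _ := [Choice of preLp by <:].
HB.instance Definition _ := [SubChoice_isSubLmodule of preLp by <:].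

Lemma preLp_measurable (f : preLp) : strongly_measurable f.
Proof. by case: f => f /= /asboolP[]. Qed.

Lemma preLp_fin (f : preLp) : ('N[mu]_p[(fun x => (`|f x|)%:E)] \is a fin_num)%E.
Proof. by case: f => f /= /asboolP[_ h]; rewrite ge0_fin_numE// Lnorm_ge0. Qed.

Definition preLp_norm (f : preLp) : R := fine ('N[mu]_p[(fun x => (`|f x|)%:E)])%E.

Lemma preLp_normD (f g : preLp) : preLp_norm (f + g) <= preLp_norm f + preLp_norm g.
Proof.
rewrite /preLp_norm -fineD ?preLp_fin// fine_le ?fin_numD ?preLp_fin//.
have := Lp_norm_lin 1 (valP f) (valP g).
by rewrite normr1 mul1e scale1r.
Qed.

Lemma preLp_normZ (a : R) (f : preLp) : preLp_norm (a *: f) = `|a| * preLp_norm f.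
Proof.
rewrite /preLp_norm -[`|a|]/(fine `|a|%:E) -fineM ?preLp_fin//; congr fine.
rewrite -ge0_LnormZ//; last 2 first.
- exact/strongly_measurable_norm/preLp_measurable.
- by have := preLp_fin f; rewrite ge0_fin_numE// Lnorm_ge0.
by apply: eq_Lnorm => x /=; rewrite normrZ.
Qed.

Definition preLp_equiv (f g : preLp) : bool := `[< {ae mu, forall x, f x = g x} >].

Lemma preLp_equiv_refl : reflexive preLp_equiv.
Proof. by move=> f; apply/asboolP/nearW. Qed.

Lemma preLp_equiv_sym : symmetric preLp_equiv.
Proof. by move=> f g; apply/asboolP/asboolP; apply: filterS => x ->. Qed.

Lemma preLp_equiv_trans : transitive preLp_equiv.
Proof.
by move=> g f h /asboolP fg /asboolP gh; apply/asboolP;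
  apply: filterS2 fg gh => x -> ->.
Qed.

Canonical preLp_equiv_canonical :=
  EquivRel preLp_equiv preLp_equiv_refl preLp_equiv_sym preLp_equiv_trans.

Local Open Scope quotient_scope.

(* The Lebesgue-Bochner space of a.e. classes of E-valued functions; the
   coercion to functions picks a representative. *)
Definition Lp : Type := {eq_quot preLp_equiv}.
HB.instance Definition _ := Choice.on Lp.
HB.instance Definition _ := EqQuotient.on Lp.
Definition Lp_fun (f : Lp) : T -> E := repr f.
Coercion Lp_fun : Lp >-> Funclass.

Lemma Lp_piP (f g : preLp) :
  \pi_Lp f = \pi_Lp g <-> {ae mu, forall x, f x = g x}.
Proof. by split=> [/eqmodP/asboolP//|fg]; apply/eqmodP/asboolP. Qed.

Lemma Lp_reprP (f : preLp) : {ae mu, forall x, (\pi_Lp f : Lp) x = f x}.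
Proof. by apply/Lp_piP; rewrite reprK. Qed.

Lemma Lp_ext (f g : Lp) : {ae mu, forall x, f x = g x} -> f = g.
Proof. by move=> fg; rewrite -(reprK f) -(reprK g); apply/Lp_piP. Qed.

Definition Lp_zero : Lp := \pi_Lp 0.
Definition Lp_add (f g : Lp) : Lp := \pi_Lp (repr f + repr g).
Definition Lp_opp (f : Lp) : Lp := \pi_Lp (- repr f).
Definition Lp_scale (a : R) (f : Lp) : Lp := \pi_Lp (a *: repr f).

Lemma Lp_zeroE : {ae mu, forall x, Lp_zero x = 0}.
Proof. exact: Lp_reprP. Qed.
Lemma Lp_addE (f g : Lp) : {ae mu, forall x, Lp_add f g x = f x + g x}.
Proof. exact: Lp_reprP. Qed.
Lemma Lp_oppE (f : Lp) : {ae mu, forall x, Lp_opp f x = - f x}.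
Proof. exact: Lp_reprP. Qed.
Lemma Lp_scaleE (a : R) (f : Lp) : {ae mu, forall x, Lp_scale a f x = a *: f x}.
Proof. exact: Lp_reprP. Qed.

Let aeI (P Q : T -> Prop) : {ae mu, forall x, P x} -> {ae mu, forall x, Q x} ->
  {ae mu, forall x, P x /\ Q x}.
Proof. by apply: filterS2. Qed.

Lemma Lp_addA : associative Lp_add.
Proof.
move=> f g h; apply: Lp_ext.
have H := aeI (aeI (Lp_addE f (Lp_add g h)) (Lp_addE g h))
  (aeI (Lp_addE (Lp_add f g) h) (Lp_addE f g)).
by apply: filterS H => x [[-> ->] [-> ->]]; rewrite addrA.
Qed.

Lemma Lp_addC : commutative Lp_add.
Proof.
move=> f g; apply: Lp_ext; have H := aeI (Lp_addE f g) (Lp_addE g f).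
by apply: filterS H => x [-> ->]; rewrite addrC.
Qed.

Lemma Lp_add0 : left_id Lp_zero Lp_add.
Proof.
move=> f; apply: Lp_ext; have H := aeI (Lp_addE Lp_zero f) Lp_zeroE.
by apply: filterS H => x [-> ->]; rewrite add0r.
Qed.

Lemma Lp_addN : left_inverse Lp_zero Lp_opp Lp_add.
Proof.
move=> f; apply: Lp_ext.
have H := aeI (Lp_addE (Lp_opp f) f) (aeI (Lp_oppE f) Lp_zeroE).
by apply: filterS H => x [-> [-> ->]]; rewrite addNr.
Qed.

HB.instance Definition _ :=
  GRing.isZmodule.Build Lp Lp_addA Lp_addC Lp_add0 Lp_addN.

Lemma Lp_scaleA (a b : R) (f : Lp) :
  Lp_scale a (Lp_scale b f) = Lp_scale (a * b) f.
Proof.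
apply: Lp_ext; have H := aeI (Lp_scaleE a (Lp_scale b f))
  (aeI (Lp_scaleE b f) (Lp_scaleE (a * b) f)).
by apply: filterS H => x [-> [-> ->]]; rewrite scalerA.
Qed.

Lemma Lp_scale1 : left_id 1 Lp_scale.
Proof.
move=> f; apply: Lp_ext; by apply: filterS (Lp_scaleE 1 f) => x ->; rewrite scale1r.
Qed.

Lemma Lp_scaleDr : right_distributive Lp_scale +%R.
Proof.
move=> a f g; apply: Lp_ext.
have H := aeI (aeI (Lp_scaleE a (f + g)) (Lp_addE f g))
  (aeI (Lp_addE (Lp_scale a f) (Lp_scale a g))
    (aeI (Lp_scaleE a f) (Lp_scaleE a g))).
by apply: filterS H => x [[-> ->] [-> [-> ->]]]; rewrite scalerDr.
Qed.

Lemma Lp_scaleDl (f : Lp) : {morph Lp_scale^~ f : a b / a + b}.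
Proof.
move=> a b; apply: Lp_ext.
have H := aeI (Lp_scaleE (a + b) f)
  (aeI (Lp_addE (Lp_scale a f) (Lp_scale b f))
    (aeI (Lp_scaleE a f) (Lp_scaleE b f))).
by apply: filterS H => x [-> [-> [-> ->]]]; rewrite scalerDl.
Qed.

HB.instance Definition _ :=
  GRing.Zmodule_isLmodule.Build R Lp Lp_scaleA Lp_scale1 Lp_scaleDr Lp_scaleDl.

Definition Lp_norm (f : Lp) : R := fine ('N[mu]_p[(fun x => (`|f x|)%:E)])%E.

Lemma Lp_norm_pi (f : preLp) : Lp_norm (\pi_Lp f) = preLp_norm f.
Proof.
rewrite /Lp_norm /preLp_norm; congr fine.
apply: (@eq_ae_Lnorm _ _ _ mu p p1 (fun x => `|(\pi_Lp f : Lp) x|)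
  (fun x => `|f x|)).
- exact/strongly_measurable_norm/preLp_measurable.
- exact/strongly_measurable_norm/preLp_measurable.
- by apply: filterS (Lp_reprP f) => x -> _.
Qed.

Lemma Lp_normD (f g : Lp) : Lp_norm (f + g) <= Lp_norm f + Lp_norm g.
Proof. by rewrite Lp_norm_pi preLp_normD. Qed.

Lemma Lp_normZ (a : R) (f : Lp) : Lp_norm (a *: f) = `|a| * Lp_norm f.
Proof. by rewrite Lp_norm_pi preLp_normZ. Qed.

Lemma Lp_norm0_eq0 (f : Lp) : Lp_norm f = 0 -> f = 0.
Proof.
move=> /eqP; rewrite -eqe fineK ?preLp_fin// => /eqP f0.
apply: Lp_ext.
have mf := strongly_measurable_norm (preLp_measurable (repr f)).
have p0 : (0 < p)%E by apply: lt_le_trans p1.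
have/measurable_EFinP/Lnorm_eq0_eq0 := mf.
move=> /(_ mu p p0 f0) {}f0; have H := aeI f0 Lp_zeroE.
apply: filterS H => x [/(_ I)[]/eqP]; rewrite normr_eq0 => /eqP fx ->.
exact: fx.
Qed.

HB.instance Definition _ :=
  Lmodule_isNormed.Build R Lp Lp_normD Lp_normZ Lp_norm0_eq0.

Lemma Lp_lin (a : R) (f g : Lp) :
  {ae mu, forall x, (a *: f + g : Lp) x = a *: f x + g x}.
Proof.
have H := aeI (Lp_addE (a *: f) g) (Lp_scaleE a f).
by apply: filterS H => x [-> ->].
Qed.

(* The class of f, meaningful when f is a.e. equal to an element of Lp. *)
Definition Lp_class (f : T -> E) : Lp :=
  xget 0 [set g : Lp | {ae mu, forall x, g x = f x}].

End Lp.

Section time_interval.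
Context (R : realType) (T : R).

Definition time_measure : set (measurableTypeR R) -> \bar R :=
  mrestr lebesgue_measure (measurable_itv `]0, T[).

HB.instance Definition _ := Measure.on time_measure.

Lemma time_measure_fin : fin_num_fun time_measure.
Proof.
move=> A mA; rewrite ge0_fin_numE ?measure_ge0//.
rewrite (@le_lt_trans _ _ (lebesgue_measure (`]0, T[%classic : set (measurableTypeR R))))//.
  rewrite /time_measure /mrestr le_measure// ?inE//.
  exact: measurableI.
by rewrite lebesgue_measure_itv/=; case: ifP => //; rewrite ltry.
Qed.

HB.instance Definition _ := Measure_isFinite.Build _ _ _ time_measure time_measure_fin.


Lemma one_le_two : (1 <= 2%:E :> \bar R)%E. Proof. by rewrite lee_fin ler1n. Qed.

Local Notation L2time E := (Lp time_measure one_le_two E).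

Definition test_function (phi : R -> R) : Prop :=
  (forall n t, derivable (phi^`(n)%classic) t 1) /\
  exists a b, [/\ 0 < a, b < T & forall t, t \notin `[a, b] -> phi t = 0].

(* The identity int (j u) phi' = - int w phi in Z, tested with the elements of
   the dual of Z. *)
Definition weak_derivative (V Z : normedModType R) (j : bounded_op V Z)
    (u : L2time V) (w : L2time Z) : Prop :=
  forall phi, test_function phi -> forall l : dual Z,
    \int[time_measure]_t (l (j (u t)) * phi^`()%classic t) =
    - \int[time_measure]_t (l (w t) * phi t).

Lemma test_function_bounded (g : R -> R) (a b : R) : continuous g ->
  (forall t, t \notin `[a, b] -> g t = 0) -> exists M, forall t, `|g t| <= M.
Proof.
move=> cg g0.
have /compact_bounded/pinfty_ex_gt0[M M0 h] : compact (g @` `[a, b]).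
  by apply: continuous_compact;
    [apply: continuous_subspaceT|exact: segment_compact].
exists M => t; have [tab|tab] := boolP (t \in `[a, b]).
  by apply: h => //; exists t.
by rewrite g0// normr0 ltW.
Qed.

Lemma test_function_cont (phi : R -> R) : test_function phi ->
  continuous phi /\ continuous phi^`()%classic.
Proof.
move=> [dphi _]; split=> t; apply/differentiable_continuous/derivable1_diffP.
- exact: (dphi 0%N).
- exact: (dphi 1%N).
Qed.

Lemma test_function_bnd (phi : R -> R) : test_function phi ->
  exists M, forall t, `|phi t| <= M /\ `|phi^`()%classic t| <= M.
Proof.
move=> tphi; have [cphi cdphi] := test_function_cont tphi.
move: (tphi) => [_ [a [b [_ _ phi0]]]].
have dphi0 t : t \notin `[a, b] -> phi^`()%classic t = 0.
  move=> tab; rewrite derive1E; transitivity ('D_1 (cst 0 : R -> R) t).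
    apply: near_eq_derive => //.
    have ot : open_nbhs t (~` [set` `[a, b]]).
      by split; [rewrite openC; exact: itv_closed | exact/negP].
    by apply: filterS (open_nbhs_nbhs ot) => s /negP; exact: phi0.
  exact: derive_cst.
have [M hM] := test_function_bounded cphi phi0.
have [N hN] := test_function_bounded cdphi dphi0.
by exists (Num.max M N) => t; rewrite !le_max hM hN orbT.
Qed.

Lemma L2time_integrable (E : normedModType R) (u : L2time E) (k : {linear E -> R^o})
    (g : R -> R) :
  continuous k -> continuous g -> (exists M, forall t, `|g t| <= M) ->
  time_measure.-integrable setT (fun t => (k (u t) * g t)%:E).
Proof.
move=> ck cg [M hM].
have /linear_boundedP/pinfty_ex_gt0[C C0 hC] := continuous_linear_bounded 0 (ck 0).
have mu2 : strongly_measurable u by exact: preLp_measurable.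
have mku : measurable_fun setT (fun t => k (u t)).
  have [s [ss su]] := mu2.
  apply: (@measurable_fun_cvg _ _ _ _ (fun n t => k (s n t))) => [n|t _].
    move=> mT Y mY; rewrite setTI.
    by have := @simple_function_preimage _ _ _ _ (s n) [set e | Y (k e)] (ss n).
  by apply: (cvg_comp _ _ (su t)); exact: ck.
have uL2 : (fun t => `|u t|) \in Lfun time_measure 2%:E.
  rewrite inE; apply/andP; split; rewrite inE.
    exact: strongly_measurable_norm.
  by have := preLp_fin (repr u); rewrite ge0_fin_numE// Lnorm_ge0.
have := Lfun_subset12 (fin_num_measure time_measure _ measurableT) uL2.
move=> /Lfun1_integrable uL1.
apply: (@le_integrable _ _ _ _ _ measurableT _
  (fun t => ((C * M) * `|u t|)%:E)) => //.
- apply/measurable_EFinP; apply: measurable_funM => //.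
  exact: continuous_measurable_fun.
- move=> t _; rewrite lee_fin normrM (ger0_norm (_ : 0 <= C * M * `|u t|)); last first.
    by rewrite mulr_ge0// mulr_ge0 ?(ltW C0)// (le_trans _ (hM 0)).
  by rewrite mulrAC; apply: ler_pM => //; exact: hC.
- by under eq_fun do rewrite EFinM; exact: integrableZl.
Qed.

Section evolution_space.
Context (V Z : normedModType R) (j : bounded_op V Z).

Lemma Rintegral_L2time_lin (E : normedModType R) (a : R) (u v : L2time E)
    (k : {linear E -> R^o}) (g : R -> R) :
  continuous k -> continuous g -> (exists M, forall t, `|g t| <= M) ->
  \int[time_measure]_t (k ((a *: u + v : L2time E) t) * g t) =
  a * (\int[time_measure]_t (k (u t) * g t)) +
    \int[time_measure]_t (k (v t) * g t).
Proof.
move=> ck cg bg.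
have iu := L2time_integrable u ck cg bg; have iv := L2time_integrable v ck cg bg.
have iau : time_measure.-integrable setT (fun t => (a * (k (u t) * g t))%:E).
  by have := @integrableZl _ _ _ time_measure _ measurableT a _ iu.
rewrite -RintegralZl// -RintegralD//.
congr fine; apply: ae_eq_integral => //.
- by have /integrableP[] := L2time_integrable (a *: u + v) ck cg bg.
- by have /integrableP[] := integrableD measurableT iau iv.
- apply: filterS (Lp_lin a u v) => t -> _.
  by rewrite linearP/= mulrDl -mulrA.
Qed.

Lemma Rintegral_L2time0 (E : normedModType R) (k : {linear E -> R^o})
    (g : R -> R) :
  continuous k -> continuous g -> (exists M, forall t, `|g t| <= M) ->
  \int[time_measure]_t (k ((0 : L2time E) t) * g t) = 0.
Proof.
move=> ck cg bg; have := Rintegral_L2time_lin (-1) 0 0 ck cg bg.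
by rewrite scaler0 addr0 mulN1r addNr.
Qed.

Definition evolution_pred : {pred L2time V * L2time Z} :=
  fun z => `[< weak_derivative j z.1 z.2 >].

Lemma evolution_submod_closed : submod_closed evolution_pred.
Proof.
have clj (l : dual Z) : continuous (l \o j).
  move=> x; apply: continuous_comp; first exact: op_continuous.
  exact: dual_continuous.
have weak_derivative_lin a u1 u2 v1 v2 : weak_derivative j u1 u2 ->
    weak_derivative j v1 v2 -> weak_derivative j (a *: u1 + v1) (a *: u2 + v2).
  move=> hu hv phi tphi l.
  have [cphi cdphi] := test_function_cont tphi.
  have [M hM] := test_function_bnd tphi.
  have ck := clj l.
  rewrite (@Rintegral_L2time_lin V a u1 v1 (l \o j : {linear V -> R^o}))//; last first.
    by exists M => t; case: (hM t).
  rewrite (@Rintegral_L2time_lin Z a u2 v2 l)//; last 2 first.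
  - exact: dual_continuous.
  - by exists M => t; case: (hM t).
  by rewrite /= hu// hv// opprD mulrN.
split=> [|a [u1 u2] [v1 v2] /asboolP hu /asboolP hv]; apply/asboolP.
- move=> phi tphi l.
  have [cphi cdphi] := test_function_cont tphi.
  have [M hM] := test_function_bnd tphi.
  have ck := clj l.
  rewrite (@Rintegral_L2time0 V (l \o j : {linear V -> R^o}))//; last first.
    by exists M => t; case: (hM t).
  rewrite (@Rintegral_L2time0 Z l) ?oppr0//; first exact: dual_continuous.
  by exists M => t; case: (hM t).
- exact: weak_derivative_lin.
Qed.

HB.instance Definition _ := GRing.isSubmodClosed.Build _ _ evolution_pred
  evolution_submod_closed.

(* An element is a pair (u, u'); the weak derivative u' is determined by u. *)
Record evolution := Evolution {
  evolution_val : L2time V * L2time Z ;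
  evolutionP : evolution_val \in evolution_pred }.
HB.instance Definition _ := [isSub for evolution_val].
HB.instance Definition _ := [Choice of evolution by <:].
HB.instance Definition _ := [SubChoice_isSubLmodule of evolution by <:].

Definition evolution_norm (u : evolution) : R :=
  Num.sqrt (`|(val u).1| ^+ 2 + `|(val u).2| ^+ 2).

Lemma sqrt_minkowski (a b c e : R) : 0 <= a -> 0 <= b -> 0 <= c -> 0 <= e ->
  Num.sqrt ((a + c) ^+ 2 + (b + e) ^+ 2) <=
  Num.sqrt (a ^+ 2 + b ^+ 2) + Num.sqrt (c ^+ 2 + e ^+ 2).
Proof.
move=> a0 b0 c0 e0; set p := Num.sqrt (a ^+ 2 + _); set q := Num.sqrt (c ^+ 2 + _).
have p0 : 0 <= p by exact: sqrtr_ge0.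
have q0 : 0 <= q by exact: sqrtr_ge0.
have p2 : p ^+ 2 = a ^+ 2 + b ^+ 2 by rewrite sqr_sqrtr// addr_ge0// sqr_ge0.
have q2 : q ^+ 2 = c ^+ 2 + e ^+ 2 by rewrite sqr_sqrtr// addr_ge0// sqr_ge0.
have cs : a * c + b * e <= p * q.
  rewrite -(@ler_pXn2r _ 2)// ?nnegrE ?addr_ge0 ?mulr_ge0//.
  rewrite exprMn p2 q2; have := sqr_ge0 (a * e - b * c); nra.
rewrite -(ger0_norm (addr_ge0 p0 q0)) -sqrtr_sqr ler_wsqrtr//.
have -> : (p + q) ^+ 2 = p ^+ 2 + q ^+ 2 + (p * q) *+ 2 by rewrite sqrrD addrAC.
rewrite p2 q2; nra.
Qed.

Lemma evolution_normD (u v : evolution) :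
  evolution_norm (u + v) <= evolution_norm u + evolution_norm v.
Proof.
apply: le_trans (sqrt_minkowski _ _ _ _) => //.
rewrite ler_wsqrtr// lerD// lerXn2r ?nnegrE ?addr_ge0//; exact: ler_normD.
Qed.

Lemma evolution_normZ (a : R) (u : evolution) :
  evolution_norm (a *: u) = `|a| * evolution_norm u.
Proof.
rewrite /evolution_norm !normrZ !exprMn -mulrDr sqrtrM ?sqr_ge0//.
by rewrite sqrtr_sqr normr_id.
Qed.

Lemma evolution_norm0_eq0 (u : evolution) : evolution_norm u = 0 -> u = 0.
Proof.
move=> /eqP; rewrite sqrtr_eq0 => h.
have := conj (sqr_ge0 `|(val u).1|) (sqr_ge0 `|(val u).2|) => -[h1 h2].
have : `|(val u).1| ^+ 2 == 0 by rewrite eq_le h1 andbT; lra.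
have : `|(val u).2| ^+ 2 == 0 by rewrite eq_le h2 andbT; lra.
rewrite !sqrf_eq0 !normr_eq0 => /eqP u2 /eqP u1.
by apply/val_inj; case: (val u) u1 u2 => ? ? /= -> ->.
Qed.

HB.instance Definition _ := Lmodule_isNormed.Build R evolution
  evolution_normD evolution_normZ evolution_norm0_eq0.

Definition evolution_fun (u : evolution) : R -> V := (val u).1.
Definition evolution_deriv (u : evolution) : L2time Z := (val u).2.
End evolution_space.
End time_interval.

Section lebesgue_outer.
Context (R : realType) (d : nat).
Local Notation Rd := 'rV[R]_d.+1.
Implicit Types (A : set Rd) (B : nat -> Rd * Rd).

Definition box (c : Rd * Rd) : set Rd :=
  [set x | forall i, c.1 0 i < x 0 i <= c.2 0 i].

Definition box_volume (c : Rd * Rd) : \bar R :=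
  (\prod_i Num.max 0 (c.2 0 i - c.1 0 i))%:E.

Definition lebesgue_outer A : \bar R :=
  ereal_inf [set (\sum_(k <oo) box_volume (B k))%E | B in
    [set B | A `<=` \bigcup_k box (B k)]].

Lemma box_volume_ge0 c : (0 <= box_volume c)%E.
Proof. by rewrite lee_fin prodr_ge0// => i _; rewrite le_max lexx. Qed.

Lemma lebesgue_outer_ge0 A : (0 <= lebesgue_outer A)%E.
Proof.
apply: le_ereal_inf_tmp => _ [B _ <-]; apply: nneseries_ge0 => k _ _.
exact: box_volume_ge0.
Qed.

Lemma le_lebesgue_outer :
  {homo lebesgue_outer : A B / A `<=` B >-> (A <= B)%E}.
Proof.
move=> A A' AA'; apply/ereal_inf_le_tmp => _ [B A'B <-].
by exists B => //=; exact: subset_trans A'B.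
Qed.

Lemma lebesgue_outer0 : lebesgue_outer set0 = 0%E.
Proof.
apply/eqP; rewrite eq_le lebesgue_outer_ge0 andbT.
apply: ereal_inf_lbound; exists (fun=> (0, 0)) => //=.
apply: eseries0 => k _ _.
by rewrite /box_volume big_ord_recl/= subrr maxxx mul0r.
Qed.

Lemma lebesgue_outer_sigma_subadditive : sigma_subadditive lebesgue_outer.
Proof.
move=> A; have [[i ioo]|] := pselect (exists i, lebesgue_outer (A i) = +oo%E).
  rewrite (eseries_pinfty _ _ ioo) ?leey// => n _.
  by rewrite -ltNye (lt_le_trans _ (lebesgue_outer_ge0 _)).
rewrite -forallNE => Aoo.
apply/lee_addgt0Pr => e e0.
rewrite (le_trans _ (epsilon_trick _ _ (ltW e0)))//; last first.
  by move=> n; exact: lebesgue_outer_ge0.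
pose P n B := (A n `<=` \bigcup_k box (B k)) /\
  (\sum_(k <oo) box_volume (B k) <=
   lebesgue_outer (A n) + (e / (2 ^ n.+1)%:R)%:E)%E.
have [G PG] : {G : nat -> nat -> Rd * Rd & forall n, P n (G n)}.
  apply: (@choice _ _ P) => n.
  have Afin : lebesgue_outer (A n) \is a fin_num.
    by rewrite ge0_fin_numE ?lebesgue_outer_ge0// ltey; exact/eqP/Aoo.
  have en0 : 0 < e / (2 ^ n.+1)%:R by rewrite divr_gt0// ltr0n expn_gt0.
  have [_ [B AB <-] hB] := lb_ereal_inf_adherent en0 Afin.
  by exists B; split => //; exact: ltW.
have G0 x : (0 <= box_volume (uncurry G x))%E by exact: box_volume_ge0.
apply: (@le_trans _ _ (\esum_(i in setT) box_volume (uncurry G i))).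
  apply: ereal_inf_lbound => /=.
  have /card_esym/ppcard_eqP[f] := card_nat2.
  exists (uncurry G \o f) => /=.
    move=> t [i _ /(proj1 (PG i))[j _ Gijt]]; exists (f^-1%FUN (i, j)) => //=.
    by rewrite invK ?inE.
  rewrite -(esum_pred_image (box_volume \o uncurry G) _ xpredT) ?[fun=> _]set_true//.
    by rewrite image_eq.
  by move=> n _; exact: G0.
have -> : (\esum_(i in setT) box_volume (uncurry G i) =
    \sum_(i <oo) \sum_(j <oo) box_volume (G i j))%E.
  pose J : nat -> set (nat * nat) := fun i => [set (i, j) | j in setT].
  rewrite (_ : setT = \bigcup_k J k); last first.
    by rewrite predeqE => -[a b]; split => // _; exists a => //; exists b.
  rewrite esum_bigcupT /=; last 2 first.
    - apply/trivIsetP => i j _ _ ij.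
      rewrite predeqE => -[n m] /=; split => //= -[] [_] _ [<-{n} _].
      by move=> [m' _] [] /esym/eqP; rewrite (negbTE ij).
    - by move=> /= [n m]; exact: (G0 (n, m)).
  rewrite -(image_id [set: nat]) -fun_true esum_pred_image//; last first.
    by move=> n _; exact: esum_ge0.
  apply: eq_eseriesr => /= j _.
  rewrite -(esum_pred_image (box_volume \o uncurry G) (pair j) predT)//=; last 2 first.
  - by move=> n _; exact: (G0 (j, n)).
  - by move=> ? ? _ _; exact: (@can_inj _ _ _ snd).
  by congr esum; rewrite predeqE => -[a b]; split; move=> [i _ <-]; exists i.
apply: lee_lim.
- apply: is_cvg_nneseries => n *.
  by apply: nneseries_ge0 => m *; exact: (G0 (n, m)).
- apply: is_cvg_nneseries => n *; apply: adde_ge0 => //.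
    exact: lebesgue_outer_ge0.
  by rewrite lee_fin divr_ge0// ltW.
- by near=> n; apply: lee_sum => i _; exact: (PG i).2.
Unshelve. all: by end_near. Qed.

Context (Omega : set Rd).

(* For Omega Lebesgue measurable (in particular open), the Caratheodory sets of
   this outer measure are the A such that A `&` Omega is Lebesgue measurable. *)
Definition lebesgue_on A : \bar R := lebesgue_outer (A `&` Omega).

Lemma lebesgue_on_sigma_subadditive : sigma_subadditive lebesgue_on.
Proof.
move=> A; rewrite /lebesgue_on setI_bigcupl.
exact: lebesgue_outer_sigma_subadditive.
Qed.

Lemma lebesgue_on0 : lebesgue_on set0 = 0%E.
Proof. by rewrite /lebesgue_on set0I lebesgue_outer0. Qed.

Lemma lebesgue_on_ge0 A : (0 <= lebesgue_on A)%E.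
Proof. exact: lebesgue_outer_ge0. Qed.

Lemma le_lebesgue_on : {homo lebesgue_on : A B / A `<=` B >-> (A <= B)%E}.
Proof. by move=> A B AB; apply: le_lebesgue_outer; exact: setSI. Qed.

HB.instance Definition _ := isOuterMeasure.Build R Rd lebesgue_on
  lebesgue_on0 lebesgue_on_ge0 le_lebesgue_on lebesgue_on_sigma_subadditive.


Definition domain_measure : set (caratheodory_type lebesgue_on) -> \bar R :=
  lebesgue_on.
HB.instance Definition _ := isMeasure.Build _ _ _ domain_measure
  (@caratheodory_measure0 R Rd lebesgue_on)
  (@caratheodory_measure_ge0 R Rd lebesgue_on)
  (@caratheodory_measure_sigma_additive R Rd lebesgue_on).
End lebesgue_outer.
Arguments lebesgue_on {R d} Omega A.
Arguments domain_measure {R d} Omega A.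

Notation L2time T E := (Lp (time_measure T) (one_le_two _) E).
Notation LpDomain Omega p1 := (Lp (domain_measure Omega) p1 _^o).

Lemma one_le_pinfty (R : realType) : (1 <= +oo :> \bar R)%E.
Proof. exact: leey. Qed.

(* (0,T) x Omega *)
Notation LinftyCylinder T Omega :=
  (Lp (time_measure T \x^ domain_measure Omega)%E (one_le_pinfty _) _^o).

Section domain.
Context (R : realType) (d : nat) (Omega : set 'rV[R]_d.+1).

(* In the rotated coordinates y around a boundary point x, Omega is locally the
   strict epigraph of a Lipschitz function of the first d coordinates. *)
Definition lipschitz_boundary : Prop :=
  forall x, (closure Omega `\` interior Omega) x ->
  exists (Q : 'M[R]_d.+1) (g : 'rV[R]_d -> R) (k r : R),
    [/\ Q *m Q^T = 1%:M, k.-lipschitz g, 0 < r &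
      forall y : 'rV[R]_d.+1, `|y| < r ->
        Omega (x + y *m Q) <-> g (col' ord_max y) < y 0 ord_max].

Definition bounded_lipschitz_domain : Prop :=
  [/\ Omega !=set0, open Omega, connected Omega, bounded_set Omega &
    lipschitz_boundary].

End domain.

Definition locally_lipschitz (R : realType) (sigma : R -> R) : Prop :=
  forall x : R, exists2 U : set R, nbhs x U & exists k : R, k.-lipschitz_U sigma.

Section neural_network.
Context (R : realType) (sigma : R -> R).

(* Parameters of a network with input dimension n0, hidden layers of widths
   hid and scalar output; the depth is (size hid).+1. *)
Fixpoint nn_params (n0 : nat) (hid : seq nat) : normedModType R :=
  if hid is n1 :: hid' then
    ('M[R]_(n1, n0) * 'cV[R]_n1 * nn_params n1 hid')%type
  else ('M[R]_(1, n0) * 'cV[R]_1)%type.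

Fixpoint nn (n0 : nat) (hid : seq nat) : nn_params n0 hid -> 'cV[R]_n0 -> R :=
  match hid with
  | [::] => fun theta z => (theta.1 *m z + theta.2) 0 0
  | n1 :: hid' => fun theta z =>
      nn theta.2 (map_mx sigma (theta.1.1 *m z + theta.1.2))
  end.

End neural_network.

Section evolution_embeddings.
Context (R : realType) (T : R) (V Z : normedModType R) (j : bounded_op V Z).

Section continuous_representative.
Context (H : normedModType R) (iVH : bounded_op V H).

Definition continuous_rep (u : evolution T j) (c : R -> H) : Prop :=
  {within `[0, T], continuous c} /\
  {ae time_measure T, forall t, c t = iVH (evolution_fun u t)}.

Definition embeds_in_C : Prop :=
  exists C : R, forall u : evolution T j, exists c : R -> H,
    continuous_rep u c /\ forall t, t \in `[0, T] -> `|c t| <= C * `|u|.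

(* The default value is irrelevant under embeds_in_C, which makes a continuous
   representative exist; it is unique on [0, T] when 0 < T. *)
Definition initial_value (u : evolution T j) : H :=
  xget (fun=> 0) [set c | continuous_rep u c] 0.

End continuous_representative.

Definition embeds_in_Linfty (d : nat) (Omega : set 'rV[R]_d.+1)
    (p : \bar R) (p1 : (1 <= p)%E) (iVL : bounded_op V (LpDomain Omega p1)) : Prop :=
  exists C : R, forall u : evolution T j, exists g : LinftyCylinder T Omega,
    {ae time_measure T, forall t, {ae domain_measure Omega, forall x,
      g (t, x) = (iVL (evolution_fun u t) : LpDomain Omega p1) x}} /\ `|g| <= C * `|u|.

End evolution_embeddings.

Section forward_operator.
Context (R : realType) (T : R) (d : nat) (Omega : set 'rV[R]_d.+1)
  (p : \bar R) (p1 : (1 <= p)%E) (X U0 V W Y Z H : normedModType R)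
  (j : bounded_op V Z) (iU0H : bounded_op U0 H) (iVH : bounded_op V H)
  (iVL : bounded_op V (LpDomain Omega p1))
  (iLW : bounded_op (LpDomain Omega p1) W)
  (F : R -> X -> V -> W)
  (ddt : bounded_op (evolution T j) (L2time T W))
  (M : bounded_op (evolution T j) (L2time T Y))
  (sigma : R -> R) (m : nat) (hid : seq nat).

Definition nemytskii_F (lambda : X) (u : evolution T j) : L2time T W :=
  Lp_class (time_measure T) (one_le_two R)
    (fun t => F t lambda (evolution_fun u t)).

(* For u in L^oo((0,T) x Omega) the inner function is in L^p(Omega) for a.e. t. *)
Definition nemytskii_nn (theta : nn_params R (m + 1) hid) (alpha : 'cV[R]_m)
    (u : evolution T j) : L2time T W :=
  Lp_class (time_measure T) (one_le_two R) (fun t =>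
    iLW (Lp_class (domain_measure Omega) p1 (fun x =>
      nn sigma theta (col_mx alpha ((iVL (evolution_fun u t) : LpDomain Omega p1) x)%:M)))).

Definition forward (z : X * 'cV[R]_m * U0 * evolution T j)
    (theta : nn_params R (m + 1) hid) : L2time T W * H * L2time T Y :=
  let: (lambda, alpha, u0, u) := z in
  (ddt u - nemytskii_F lambda u - nemytskii_nn theta alpha u,
   initial_value iVH u - iU0H u0, M u).

(* Squared norm of the Hilbert-type product norm; the library norm on products
   is the maximum. *)
Definition sqnorm3 (r : L2time T W * H * L2time T Y) : R :=
  `|r.1.1| ^+ 2 + `|r.1.2| ^+ 2 + `|r.2| ^+ 2.

Definition misfit (y : L2time T Y) (z : X * 'cV[R]_m * U0 * evolution T j)
    (theta : nn_params R (m + 1) hid) : R :=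
  sqnorm3 (forward z theta - (0, 0, y)).

Definition learning_objective (Reg1 : X * 'cV[R]_m * U0 * evolution T j -> \bar R)
    (Reg2 : nn_params R (m + 1) hid -> \bar R) (K : nat)
    (y : 'I_K -> L2time T Y) (z : 'I_K -> X * 'cV[R]_m * U0 * evolution T j)
    (theta : nn_params R (m + 1) hid) : \bar R :=
  (\sum_(k < K) ((misfit (y k) (z k) theta)%:E + Reg1 (z k)) + Reg2 theta)%E.

Definition identification_objective
    (Reg1 : X * 'cV[R]_m * U0 * evolution T j -> \bar R)
    (theta : nn_params R (m + 1) hid) (y : L2time T Y)
    (z : X * 'cV[R]_m * U0 * evolution T j) : \bar R :=
  ((misfit y z theta)%:E + Reg1 z)%E.

End forward_operator.

(* Main.v *)
(* The direct method.  Along a minimizing sequence the regularizers give weak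
   limits, so everything rests on the weak lower semicontinuity of the misfit,
   that is, of the L^2(0,T;W)-norm of the residual.  This norm is tested against
   simple functions with values in the dual of W, so that the dual of
   L^2(0,T;W) need not be identified.  A bounded sequence in L^2(0,T;W) that
   converges weakly in W at a.e. time converges against these test functions,
   hence pointwise convergence in time of F(lambda_n, u_n) and of the network
   term suffices.
   Weak convergence of u_n gives u_n(t) -> u(t) weakly in H for a.e. t, by the
   embedding into C(0,T;H), and strong convergence in L^p(Omega), in measure in
   time, by the compactness of the embedding of V; the network term is
   Lipschitz on bounded sets.  Under (A), F(t, ., .) is weakly continuous.
   Under (B), <F(t, lambda_n, u_n(t)), u_n(t) - u(t)> -> 0 for a.e. t along a
   subsequence, and pseudomonotonicity applied with v = u(t) - g and
   v = u(t) + g, for g in W*, gives the weak convergence of F(t, lambda_n, u_n(t)). *)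
From HB Require Import structures.
Require Import Defs.
From mathcomp Require Import all_boot all_order all_algebra.
From mathcomp Require Import all_classical all_reals all_analysis.
From mathcomp Require Import measurable_realfun ess_sup_inf ring lra.
Set Implicit Arguments.
Unset Strict Implicit.
Unset Printing Implicit Defensive.
Import Order.TTheory GRing.Theory Num.Theory numFieldNormedType.Exports.
Local Open Scope classical_set_scope.
Local Open Scope ring_scope.

(** * Hahn-Banach, duals and weak convergence *)

(** Two obstacles shape the proof: bounds on [lambda_n] and [u_n] alone do not bound F(lambda_n,
    u_n), and convergence at a.e. time is obtained only along subsequences. Both are met by showing
    lower semicontinuity of the misfit by contradiction. If the misfit stays, along a subsequence,
    at most equal to a number smaller than its value at the limit, then the residual is bounded
    there; subtracting the time derivative and the network term bounds F(lambda_n, u_n) in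
    L^2(0,T;W), and further extractions do no harm. The limits at a.e. time live in H, in L^p(Omega)
    and in W. They are identified inside W, through [iLW (iVL v) = iHW (iVH v)] and the injectivity
    of [iLW] and [iHW]. The time derivative converges only weakly in L^2(0,T;W), with no information
    at fixed times, and is therefore handled as the argument of a bounded functional. *)

Section hahn_banach.
Context (R : realType) (E : normedModType R).

(** Homogeneity is required only as an inequality for positive factors, a form that passes to
    infima; [sublinearZ] recovers equality by means of the inverse factor. *)
Definition sublinear (q : E -> R) : Prop :=
  (forall x y, q (x + y) <= q x + q y) /\
  (forall s x, 0 < s -> q (s *: x) <= s * q x).

Lemma sublinear0 (q : E -> R) : sublinear q -> q 0 = 0.
Proof.
move=> [qD qZ]; apply/eqP; rewrite eq_le; apply/andP; split.
  have /(_ 0) := @qZ (2^-1) _ _; rewrite scaler0 => /(_ ltac:(by []))/= h.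
  by lra.
by have := qD 0 0; rewrite addr0; lra.
Qed.

Lemma sublinearZ (q : E -> R) t x : sublinear q -> 0 <= t -> q (t *: x) = t * q x.
Proof.
move=> sq; rewrite le_eqVlt => /predU1P[<-|t0].
  by rewrite scale0r mul0r sublinear0.
apply/eqP; rewrite eq_le sq.2//=.
rewrite -[in q x](scalerK (lt0r_neq0 t0) x) -ler_pdivlMl//.
by rewrite sq.2// invr_gt0.
Qed.

Lemma sublinear_geN (q : E -> R) x : sublinear q -> - q (- x) <= q x.
Proof.
move=> sq; have := sq.1 x (- x); rewrite subrr sublinear0//; lra.
Qed.

(** The classical device behind Hahn-Banach: a sublinear minorant of [q] whose value at [- y] is at
    most [- q y] (take [t = 1]), so that it is linear along [y]. *)
Definition sublinear_shift (q : E -> R) (y x : E) : R :=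
  inf [set q (x + t *: y) - t * q y | t in [set t | 0 <= t]].

Lemma sublinear_shift_has_inf (q : E -> R) y x : sublinear q ->
  has_inf [set q (x + t *: y) - t * q y | t in [set t | 0 <= t]].
Proof.
move=> sq; split; first by eexists; exists 0 => /=.
(* [t * q y = q (t *: y) <= q (x + t *: y) + q (- x)]. *)
exists (- q (- x)) => _ [t /= t0 <-].
rewrite -(sublinearZ y sq t0).
have := sq.1 (x + t *: y) (- x); rewrite addrC addKr; lra.
Qed.

Lemma sublinear_shift_le (q : E -> R) y x t : sublinear q -> 0 <= t ->
  sublinear_shift q y x <= q (x + t *: y) - t * q y.
Proof.
move=> sq t0; apply: ge_inf; last by exists t.
by case: (sublinear_shift_has_inf y x sq).
Qed.

Lemma sublinear_shiftP (q : E -> R) y : sublinear q ->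
  sublinear (sublinear_shift q y).
Proof.
move=> sq; split=> [x x'|s x s0].
- rewrite -lerBlDl; apply: lb_le_inf.
    by case: (sublinear_shift_has_inf y x' sq).
  move=> _ [t' /= t'0 <-]; rewrite lerBlDl -lerBlDr.
  apply: lb_le_inf; first by case: (sublinear_shift_has_inf y x sq).
  move=> _ [t /= t0 <-]; rewrite lerBlDr.
  rewrite (le_trans (sublinear_shift_le y _ sq (addr_ge0 t0 t'0)))//.
  rewrite scalerDl addrACA (le_trans (lerB (sq.1 _ _) (lexx _)))//.
  by rewrite mulrDl; lra.
- rewrite -ler_pdivrMl//; apply: lb_le_inf.
    by case: (sublinear_shift_has_inf y x sq).
  move=> _ [t /= t0 <-]; rewrite ler_pdivrMl//.
  rewrite (le_trans (sublinear_shift_le y _ sq (mulr_ge0 (ltW s0) t0)))//.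
  rewrite -scalerA -scalerDr sublinearZ//; last exact: ltW.
  by rewrite mulrBr mulrA.
Qed.

(** Zorn's lemma for the reversed pointwise order. A chain is bounded by its pointwise infimum,
    which is finite because every member is at least [- p (- x)]. The infimum is subadditive since,
    of two members of a chain, the smaller one can be used at both points. *)
Lemma sublinear_minimal (p : E -> R) : sublinear p ->
  exists2 q, sublinear q & (forall x, q x <= p x) /\
    forall r, sublinear r -> (forall x, r x <= q x) -> r = q.
Proof.
move=> sp; pose T := {q : E -> R | sublinear q /\ forall x, q x <= p x}.
pose rel (q r : T) := `[< forall x, sval r x <= sval q x >].
have p0 : T by exists p.
have [| | |[q [sq qp]] qmin] := @ZL_preorder T p0 rel.
- by move=> q; apply/asboolP.
- by move=> r q s /asboolP rq /asboolP qs; apply/asboolP => x; exact: le_trans (qs x) (rq x).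
- move=> A totA; have [[q0 Aq0]|A0] := pselect (A !=set0); last first.
    by exists p0 => s As; case: A0; exists s.
  pose S x := [set sval q x | q in A].
  have hS x : has_inf (S x).
    split; first by exists (sval q0 x), q0.
    exists (- p (- x)) => _ [[q [sq qp]] Aq <-] /=.
    by rewrite (le_trans _ (sublinear_geN x sq))// lerN2.
  have Sle q x : A q -> inf (S x) <= sval q x.
    by move=> Aq; apply: ge_inf; [case: (hS x)|exists q].
  have si : sublinear (fun x => inf (S x)).
    split=> [x y|s x s0].
      rewrite -lerBlDl; apply: lb_le_inf; first by case: (hS y).
      move=> _ [q Aq <-]; rewrite lerBlDl -lerBlDr.
      apply: lb_le_inf; first by case: (hS x).
      move=> _ [r Ar <-]; rewrite lerBlDr.
      have [/asboolP qr|/asboolP rq] := totA _ _ Aq Ar.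
        rewrite (le_trans (Sle r _ Ar))// (le_trans ((svalP r).1.1 _ _))//.
        by rewrite lerD2l.
      rewrite (le_trans (Sle q _ Aq))// (le_trans ((svalP q).1.1 _ _))//.
      by rewrite lerD2r.
    rewrite -ler_pdivrMl//; apply: lb_le_inf; first by case: (hS x).
    move=> _ [q Aq <-]; rewrite ler_pdivrMl// (le_trans (Sle _ _ Aq))//.
    exact: (svalP q).1.2.
  have ip x : inf (S x) <= p x by rewrite (le_trans (Sle _ _ Aq0))//; exact: (svalP q0).2.
  unshelve eexists; first by exists (fun x => inf (S x)).
  by move=> q Aq; apply/asboolP => x /=; exact: Sle.
exists q => //; split=> // r sr rq.
have rp x : r x <= p x by rewrite (le_trans (rq x)).
apply/funext => x; apply/eqP; rewrite eq_le rq/=.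
have rT : sublinear r /\ forall x, r x <= p x by [].
have := qmin (exist (fun r : E -> R => sublinear r /\ forall x, r x <= p x) r rT) => /=.
by rewrite /rel/= => /(_ ltac:(exact/asboolP))/asboolP; exact.
Qed.

Lemma norm_sublinear : sublinear (fun x : E => `|x|).
Proof.
by split=> [x y|s x s0]; [exact: ler_normD|rewrite normrZ gtr0_norm].
Qed.

(* A minimal sublinear functional [q] coincides with each of its shifts, whence
   [q x + q y <= q (x + y)]. *)
Lemma linear_dominated (p : E -> R) : sublinear p ->
  exists2 f : E -> R^o, linear f & forall x, f x <= p x.
Proof.
move=> /sublinear_minimal[q sq [qp qmin]]; exists q => //.
have qD x y : q (x + y) = q x + q y.
  apply/eqP; rewrite eq_le sq.1/= -lerBrDr.
  have qy z : sublinear_shift q y z <= q z.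
    have := sublinear_shift_le y z sq (lexx 0).
    by rewrite scale0r addr0 mul0r subr0.
  have := sublinear_shift_le y x sq ler01; rewrite scale1r mul1r.
  by rewrite (qmin _ (sublinear_shiftP y sq) qy).
have qN x : q (- x) = - q x.
  by apply/eqP; rewrite -subr_eq0 opprK -qD addNr sublinear0.
move=> a x y; rewrite qD; congr +%R.
have [a0|/ltW a0] := leP 0 a; first by rewrite sublinearZ.
by rewrite -[a]opprK scaleNr qN sublinearZ ?oppr_ge0// -mulNr.
Qed.

Lemma bounded_linear_dual (f : E -> R^o) (C : R) : linear f ->
  (forall x, `|f x| <= C * `|x|) -> exists g : dual E, forall x, g x = f x.
Proof.
move=> lf fC.
pose lfi := HB.pack_for {linear E -> R^o} f (GRing.isLinear.Build _ _ _ _ f lf).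
suff cf : continuous (lfi : E -> R^o).
  have fP : (f : E -> R^o) \in @dual_pred R E by apply/asboolP.
  by exists (Dual fP).
apply/linear_bounded_continuous/linear_boundedP.
near=> r => x; rewrite (le_trans (fC x))// ler_wpM2r//.
Unshelve. all: by end_near. Qed.

Lemma dual_le (f : dual E) x : `|f x| <= `|f| * `|x|.
Proof.
have [->|x0] := eqVneq x 0; first by rewrite linear0 !normr0 mulr0.
have nx : 0 < `|x| by rewrite normr_gt0.
have /(dual_norm_ge f) : `| `|x|^-1 *: x| <= 1.
  by rewrite normrZ normfV normr_id mulVf// gt_eqF.
rewrite linearZ/= normrM normfV normr_id => h.
by rewrite -ler_pdivrMr// mulrC.
Qed.

(** The dominating functional is the shift of the norm in the direction [x] rather than the norm:
    its value at [- x] is at most minus the norm of [x], which forces [f] to attain the norm at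
    [x]. *)
Theorem hahn_banach_norming (x : E) :
  exists2 f : dual E, `|f| <= 1 & f x = `|x|.
Proof.
have [f lf fp] := linear_dominated (sublinear_shiftP x norm_sublinear).
have fle y : f y <= `|y|.
  rewrite (le_trans (fp y))//.
  have := sublinear_shift_le x y norm_sublinear (lexx 0).
  by rewrite scale0r addr0 mul0r subr0.
pose lfi := HB.pack_for {linear E -> R^o} f (GRing.isLinear.Build _ _ _ _ f lf).
have fN y : f (- y) = - f y by exact: (linearN lfi).
have fN1 y : `|f y| <= 1 * `|y|.
  by rewrite mul1r ler_norml fle andbT lerNl -fN -(normrN y) fle.
have [g gE] := bounded_linear_dual lf fN1.
exists g.
  by apply: dual_norm_le => y y1; rewrite gE (le_trans (fN1 y))// mul1r.
apply/eqP; rewrite eq_le gE fle/=.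
have := fp (- x); have := sublinear_shift_le x (- x) norm_sublinear ler01.
rewrite scale1r addNr normr0 mul1r sub0r => h1 h2.
by have := le_trans h2 h1; rewrite fN lerN2.
Qed.

Lemma dual_separates (x y : E) : (forall f : dual E, f x = f y) -> x = y.
Proof.
move=> h; apply/eqP; rewrite -subr_eq0 -normr_eq0.
have [f _ <-] := hahn_banach_norming (x - y).
by rewrite linearB/= h subrr.
Qed.

End hahn_banach.

Lemma increasing_cvg_oo (s : nat -> nat) :
  {homo s : m n / (m < n)%N} -> s n @[n --> \oo] --> \oo.
Proof.
move=> hs; apply/cvgnyPge => M; exists M => // n /= Mn.
suff : (n <= s n)%N by exact: leq_trans.
by elim: n {Mn} => // n; move/leq_ltn_trans; apply; exact: hs.
Qed.

Lemma homo_ltn_comp (s t : nat -> nat) :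
  {homo s : m n / (m < n)%N} -> {homo t : m n / (m < n)%N} ->
  {homo s \o t : m n / (m < n)%N}.
Proof. by move=> hs ht m n mn; apply/hs/ht. Qed.

(** * Completeness of the dual and weak convergence *)

Section dual_complete.
Context (R : realType) (E : normedModType R).

(** [weak_cvg_bounded] applies the uniform boundedness principle on the dual, which must be complete
    whether or not [E] is. The limit [l] is taken pointwise; the Cauchy estimates, linear in the
    norm of [x], survive the passage to the limit and give both the boundedness of [l] and
    convergence in norm. *)
Lemma dual_cauchy_cvg (F : set_system (dual E)) : ProperFilter F ->
  cauchy F -> cvg F.
Proof.
move=> FF /cauchyP Fc.
have Fb (e : R) : 0 < e -> exists g, \forall f \near F, `|g - f| < e.
  move=> /Fc[g Fg]; exists g; near=> f.
  have : ball g e f by near: f.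
  by rewrite -ball_normE.
have dx (f g : dual E) x : `|f x - g x| <= `|f - g| * `|x|.
  exact: (dual_le (f - g) x).
have cx x : exists l : R^o, ((fun f : dual E => f x) @ F) --> l.
  apply/cvg_ex; apply/cauchy_cvgP/cauchy_exP => e e0.
  have /Fb[g Fg] : 0 < e / (`|x| + 1) by rewrite divr_gt0// ltr_wpDl.
  exists (g x).
  suff : \forall f \near F, ball (g x : R^o) e ((f : dual E) x) by [].
  near=> f; rewrite -ball_normE/=; apply: le_lt_trans (dx g f x) _.
  apply: (@le_lt_trans _ _ (e / (`|x| + 1) * `|x|)).
    by rewrite ler_wpM2r//; apply/ltW; near: f.
  rewrite mulrAC -mulrA gtr_pMr// ltr_pdivrMr ?ltr_wpDl// mul1r.
  by rewrite ltrDl.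
have [l lE] : {l : E -> R^o & forall x, ((fun f : dual E => f x) @ F) --> l x}.
  exact: (@choice _ _ (fun x (y : R^o) => ((fun f : dual E => f x) @ F) --> y)).
have ll : linear l.
  move=> a x y; have := lE (a *: x + y).
  under eq_fun do rewrite linearP.
  move=> h; apply: (cvg_unique _ h); first exact: norm_hausdorff.
  by apply: cvgD; [apply: cvgZl_tmp; exact: lE|exact: lE].
have le (e : R) : 0 < e -> \forall f \near F, forall x, `|l x - (f : dual E) x| <= e * `|x|.
  move=> e0; have /Fb[g Fg] : 0 < e / 2 by rewrite divr_gt0.
  near=> f => x.
  have h1 : (fun h : dual E => `|h x - g x|) @ F --> `|l x - g x|.
    by apply: cvg_norm; apply: cvgB; [exact: lE|exact: cvg_cst].
  have h2 : `|l x - g x| <= e / 2 * `|x|.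
    apply: (cvgr_to_le h1); near=> h.
    rewrite distrC (le_trans (dx _ _ _))// ler_wpM2r//; apply/ltW; near: h.
    exact: Fg.
  rewrite [e]splitr mulrDl -[l x](subrK (g x)) -addrA (le_trans (ler_normD _ _))//.
  rewrite lerD// (le_trans (dx _ _ _))// ler_wpM2r//; apply/ltW; near: f.
  exact: Fg.
have /filter_ex[f0 lf0] := le _ ltr01.
have lb x : `|l x| <= (`|f0| + 1) * `|x|.
  rewrite -[l x](subrK (f0 x)) (le_trans (ler_normD _ _))//.
  by rewrite mulrDl addrC lerD ?dual_le.
have [g gE] := bounded_linear_dual ll lb.
apply/cvg_ex; exists g; apply/cvgrPdist_le => e e0.
near=> f; apply: dual_norm_le => x x1.
have h : forall x, `|l x - f x| <= e * `|x| by near: f; exact: le.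
have -> : (g - f : dual E) x = l x - f x by rewrite -gE.
by rewrite (le_trans (h x))// ler_piMr// ltW.
Unshelve. all: by end_near. Qed.

End dual_complete.

HB.instance Definition _ (R : realType) (E : normedModType R) :=
  Uniform_isComplete.Build (dual E) (@dual_cauchy_cvg R E).

Section weak.
Context (R : realType).

Lemma dual_op_exists (E F : normedModType R) (f : dual F) (g : bounded_op E F) :
  exists h : dual E, forall x, h x = f (g x).
Proof.
have hP : (f \o g : E -> R^o) \in @dual_pred R E.
  apply/asboolP; split; first by move=> a x y /=; rewrite !linearP.
  by move=> x; apply: continuous_comp; [exact: op_continuous|exact: dual_continuous].
by exists (Dual hP).
Qed.

Lemma weak_cvg_op (E F : normedModType R) (g : bounded_op E F) x l :
  weak_cvg x l -> weak_cvg (g \o x) (g l).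
Proof.
move=> xl f; have [h hE] := dual_op_exists f g.
by rewrite -hE; under eq_fun do rewrite /= -hE; exact: xl.
Qed.

Lemma weak_cvg_comp (E : normedModType R) (x : nat -> E) l (s : nat -> nat) :
  {homo s : m n / (m < n)%N} -> weak_cvg x l -> weak_cvg (x \o s) l.
Proof.
move=> hs xl f; exact: (cvg_comp _ _ (increasing_cvg_oo hs) (xl f)).
Qed.

(** The evaluations at [x n] are pointwise bounded on the dual, being convergent sequences there,
    hence uniformly bounded on its unit ball; norming functionals turn this into a bound on the
    norms. *)
Lemma weak_cvg_bounded (E : normedModType R) (x : nat -> E) l :
  weak_cvg x l -> exists C, forall n, `|x n| <= C.
Proof.
move=> xl; pose ev n := (fun f : dual E => f (x n) : R^o).
have [] := @Banach_Steinhauss R (dual E) R^o [set ev n | n in setT] _ _ 1.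
- move=> _ [n _ <-]; split; last by [].
  move=> r; exists (r * `|x n|) => f fr; rewrite (le_trans (dual_le f (x n)))//.
  by rewrite ler_wpM2r.
- move=> f; have /cvg_seq_bounded/pinfty_ex_gt0[C C0 fC] :
    cvgn (fun n => f (x n) : R^o) by apply/cvg_ex; exists (f l); exact: xl.
  by exists C => _ [n _ <-]; exact: fC.
move=> C hC; exists C => n; have [f f1 <-] := hahn_banach_norming (x n).
rewrite (le_trans (ler_norm _))//.
by have := hC _ (imageT ev n) f; apply.
Qed.

(** Lower semicontinuity of the norm, tested with the norming functional of [l]. It is phrased with
    strict lower bounds [a], the form in which the semicontinuity of each term of the misfit is
    later combined. *)
Lemma weak_cvg_norm_le (E : normedModType R) (x : nat -> E) l (a : R) :
  weak_cvg x l -> a < `|l| -> \forall n \near \oo, a < `|x n|.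
Proof.
move=> xl al; have [f f1 fl] := hahn_banach_norming l.
move: al; rewrite -fl => al; near=> n.
have : `|f (x n)| <= `|x n|.
  by rewrite (le_trans (dual_le _ _))// ler_piMl.
apply: lt_le_trans; rewrite (lt_le_trans _ (ler_norm _))//.
by near: n; exact: (cvgr_gt _ (xl f) _ al).
Unshelve. all: by end_near. Qed.

Definition fst_op (E F : normedModType R) : bounded_op (E * F)%type E :=
  @BoundedOp R (E * F)%type E (@fst E F) (fun x => cvg_fst).
Definition snd_op (E F : normedModType R) : bounded_op (E * F)%type F :=
  @BoundedOp R (E * F)%type F (@snd E F) (fun x => cvg_snd).

Lemma weak_cvg_pair (E F : normedModType R) (x : nat -> E) (y : nat -> F) l k :
  weak_cvg x l -> weak_cvg y k -> weak_cvg (fun n => (x n, y n)) (l, k).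
Proof.
move=> xl yk f.
have [f1 f1E] : exists g : dual E, forall z, g z = f (z, 0).
  apply: (@bounded_linear_dual _ _ _ `|f|) => [a u v|z].
    by rewrite -linearP; congr (f _); apply: injective_projections => /=; rewrite ?scaler0 ?addr0.
  rewrite (le_trans (dual_le _ _))// ler_wpM2l// prod_normE/= normr0.
  by rewrite ge_max lexx/=.
have [f2 f2E] : exists g : dual F, forall z, g z = f (0, z).
  apply: (@bounded_linear_dual _ _ _ `|f|) => [a u v|z].
    by rewrite -linearP; congr (f _); apply: injective_projections => /=; rewrite ?scaler0 ?addr0.
  rewrite (le_trans (dual_le _ _))// ler_wpM2l// prod_normE/= normr0.
  by rewrite ge_max lexx andbT.
have fE u v : f (u, v) = f1 u + f2 v.
  by rewrite f1E f2E -linearD; congr (f _);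
  apply: injective_projections => /=; rewrite ?addr0 ?add0r.
rewrite fE; under eq_fun do rewrite fE.
by apply: cvgD; [exact: xl|exact: yk].
Qed.

End weak.

(** * Finite-dimensional parameters and Lipschitz bounds for networks *)

Section finite_dimension.
Context (R : realType).

Lemma mx_norm_leP m n (A : 'M[R]_(m, n)) (M : R) : 0 <= M ->
  (forall i j, `|A i j| <= M) -> `|A| <= M.
Proof.
move=> M0 AM; rewrite [leLHS]/Num.norm/= mx_normrE.
by apply/bigmax_leP; split=> // -[i j] _; exact: AM.
Qed.

Lemma mx_norm_coord m n (A : 'M[R]_(m, n)) i j : `|A i j| <= `|A|.
Proof.
by rewrite [leRHS]/Num.norm/= mx_normrE (le_bigmax _ (fun ij => `|A ij.1 ij.2|) (i, j)).
Qed.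

Lemma mulmx_norm m n p (A : 'M[R]_(m, n)) (B : 'M[R]_(n, p)) :
  `|A *m B| <= n%:R * (`|A| * `|B|).
Proof.
apply: mx_norm_leP => [|i j]; first by rewrite !mulr_ge0.
rewrite mxE (le_trans (ler_norm_sum _ _ _))//.
have -> : n%:R * (`|A| * `|B|) = \sum_(k < n) (`|A| * `|B|).
  by rewrite sumr_const card_ord mulr_natl.
apply: ler_sum => k _.
by rewrite normrM ler_pM// mx_norm_coord.
Qed.

Lemma coord_linear m n i j : linear (fun A : 'M[R]_(m, n) => A i j : R^o).
Proof. by move=> a A B; rewrite !mxE. Qed.

Lemma weak_cvg_mx m n (x : nat -> 'M[R]_(m, n)) l : weak_cvg x l -> x @ \oo --> l.
Proof.
move=> xl; apply/cvgrPdist_le => e e0.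
have h i : \forall k \near \oo, forall j, `|l i j - x k i j| <= e.
  apply: filter_forall => j.
  have [f fE] : exists f : dual _, forall A : 'M[R]_(m, n), f A = A i j.
    apply: (bounded_linear_dual (C := 1) (coord_linear i j)) => A.
    by rewrite mul1r mx_norm_coord.
  have /cvgrPdist_le/(_ _ e0) := xl f.
  by apply: filterS => k; rewrite !fE.
have : \forall k \near \oo, forall i j, `|l i j - x k i j| <= e.
  exact: filter_forall.
apply: filterS => k hk.
by apply: mx_norm_leP => [|i j]; [exact: ltW|rewrite !mxE].
Qed.

Lemma weak_cvg_pair_norm (E F : normedModType R) (z : nat -> (E * F)%type) k :
    (forall y h, weak_cvg y h -> y @ \oo --> (h : E)) ->
    (forall y h, weak_cvg y h -> y @ \oo --> (h : F)) ->
  weak_cvg z k -> z @ \oo --> k.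
Proof.
move=> hE hF zk.
have /hE/cvgrPdist_le h1 := weak_cvg_op (g := fst_op E F) zk.
have /hF/cvgrPdist_le h2 := weak_cvg_op (g := snd_op E F) zk.
apply/cvgrPdist_le => e e0; apply: filterS2 (h1 _ e0) (h2 _ e0) => n.
by rewrite prod_normE/= ge_max => -> ->.
Qed.

Lemma weak_cvg_nn_params hid n0 (x : nat -> nn_params R n0 hid) l :
  weak_cvg x l -> x @ \oo --> l.
Proof.
elim: hid n0 x l => [|n1 hid IH] n0 x l; apply: weak_cvg_pair_norm => y h.
- exact: weak_cvg_mx.
- exact: weak_cvg_mx.
- by apply: weak_cvg_pair_norm => y' h'; exact: weak_cvg_mx.
- exact: IH.
Qed.

End finite_dimension.

Section network_lipschitz.
Context (R : realType) (sigma : R -> R) (hsigma : locally_lipschitz sigma).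

(** A continuation argument: [S] collects the [t] such that [sigma] is Lipschitz on the segment from
    [- r] to [t]. Near [sup S] the local constant takes over, and the two constants add up across an
    intermediate point, so [S] cannot stop before [r]. *)
Lemma locally_lipschitz_segment (r : R) : exists2 L, 0 <= L &
  forall x y, `|x| <= r -> `|y| <= r -> `|sigma x - sigma y| <= L * `|x - y|.
Proof.
have [r0|r0] := ltP r 0.
  exists 0 => // x y xr; have := normr_ge0 x; lra.
pose lip t L := forall x y, - r <= x -> x <= y -> y <= t ->
  `|sigma x - sigma y| <= L * `|x - y|.
pose S := [set t | - r <= t <= r /\ exists2 L, 0 <= L & lip t L].
have Sr : S (- r).
  split; first by rewrite lexx/=; lra.
  exists 0 => // x y rx xy yr; have -> : x = y by apply/eqP; rewrite eq_le; lra.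
  by rewrite !subrr normr0 mulr0.
have hS : has_sup S.
  by split; [exists (- r)|exists r => t [/andP[]]].
have [U /nbhs_ballP[e /= e0 eU] [k kU]] := hsigma (sup S).
have {}kU x y : `|x - sup S| < e -> `|y - sup S| < e ->
    `|sigma x - sigma y| <= `|k| * `|x - y|.
  move=> xe ye; have := kU (x, y); rewrite /= => /(_ _)/le_trans; apply.
    by split; apply: eU; rewrite -ball_normE/= distrC.
  by rewrite ler_wpM2r// ler_norm.
have [t [/andP[rt tr] [L L0 Lt]] ts] := sup_adherent e0 hS.
have ts' : t <= sup S by apply: ub_le_sup; [case: hS|split; [rewrite rt|exists L]].
(* [u] would exceed [sup S] unless the minimum is [r]; membership of [u] in [S] therefore forces
   [u = r]. *)
pose u := Num.min r (sup S + e / 2).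
have ur : u <= r by rewrite ge_min lexx.
have us : u <= sup S + e / 2 by rewrite ge_min lexx orbT.
have tu : t <= u by rewrite le_min tr/=; lra.
have Su : S u.
  split; first by rewrite ur andbT; lra.
  exists (L + `|k|); first by rewrite addr_ge0.
  have ball z : t <= z -> z <= u -> `|z - sup S| < e.
    by move=> tz zu; rewrite ltr_norml; apply/andP; split; lra.
  move=> x y rx xy yu; have [yt|/ltW ty] := leP y t.
    by rewrite (le_trans (Lt _ _ rx xy yt))// ler_wpM2r// lerDl.
  have [tx|/ltW xt] := leP t x.
    rewrite (le_trans (kU _ _ (ball x tx _) (ball y ty _)))//; first exact: le_trans xy yu.
    by rewrite ler_wpM2r// lerDr.
  rewrite -[sigma x](subrK (sigma t)) -addrA (le_trans (ler_normD _ _))//.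
  rewrite mulrDl lerD//.
    rewrite (le_trans (Lt _ _ rx xt (lexx _)))// ler_wpM2l//.
    by rewrite !ler0_norm; lra.
  rewrite (le_trans (kU _ _ (ball t _ _) (ball y ty _)))// ler_wpM2l//.
  by rewrite !ler0_norm; lra.
have us2 : u <= sup S by apply: ub_le_sup => //; case: hS.
have ure : u = r.
  have [rs|sr] := leP r (sup S + e / 2); first by rewrite /u min_l.
  move: us2; rewrite /u min_r; last exact: ltW.
  by move=> h2; exfalso; lra.
have [_ [K K0 lipK]] := Su; exists K => // x y.
move=> /ler_normlP[xr rx] /ler_normlP[yr ry].
have [xy|/ltW yx] := leP x y; first by apply: lipK => //; rewrite ?ure//; lra.
by rewrite distrC [in leRHS]distrC; apply: lipK => //; rewrite ?ure//; lra.
Qed.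

Lemma map_mx_lipschitz (r : R) : exists2 L, 0 <= L &
  forall m n (z z' : 'M[R]_(m, n)), `|z| <= r -> `|z'| <= r ->
    `|map_mx sigma z - map_mx sigma z'| <= L * `|z - z'|.
Proof.
have [L L0 hL] := locally_lipschitz_segment r; exists L => // m n z z' zr z'r.
apply: mx_norm_leP => [|i j]; first by rewrite mulr_ge0.
rewrite !mxE (le_trans (hL _ _ _ _))//.
- exact: le_trans (mx_norm_coord _ _ _) zr.
- exact: le_trans (mx_norm_coord _ _ _) z'r.
- by rewrite ler_wpM2l// (le_trans _ (mx_norm_coord _ i j))// !mxE.
Qed.

Lemma map_mx_bounded (r : R) : exists2 L, 0 <= L &
  forall m n (z : 'M[R]_(m, n)), `|z| <= r -> `|map_mx sigma z| <= L.
Proof.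
have [L L0 hL] := locally_lipschitz_segment r.
exists (`|sigma 0| + L * `|r|); first by rewrite addr_ge0// mulr_ge0.
move=> m n z zr; apply: mx_norm_leP => [|i j].
  by rewrite addr_ge0// mulr_ge0.
have zijr : `|z i j| <= r by exact: le_trans (mx_norm_coord _ _ _) zr.
rewrite mxE -[sigma (z i j)](subrK (sigma 0)) addrC (le_trans (ler_normD _ _))//.
rewrite lerD2l (le_trans (hL _ _ _ _))// ?normr0 ?subr0.
  by rewrite (le_trans _ zijr).
by rewrite ler_wpM2l// (le_trans zijr)// ler_norm.
Qed.

Lemma affine_lipschitz m n p (r : R) : 0 <= r -> exists2 L, 0 <= L &
  forall (A A' : 'M[R]_(m, n)) (z z' : 'M[R]_(n, p)) b b', `|A| <= r -> `|A'| <= r ->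
    `|z| <= r -> `|z'| <= r ->
    `|(A *m z + b) - (A' *m z' + b')| <= L * (Num.max `|A - A'| `|b - b'| + `|z - z'|).
Proof.
(* The factor [n] comes from [mulmx_norm] for the entrywise maximum norm, the summand 1 from
   [b - b']. The maximum in the bound is the product norm of [(A - A', b - b')]. *)
move=> r0; exists (n%:R * r + 1); first by rewrite addr_ge0// mulr_ge0.
move=> A A' z z' b b' Ar A'r zr z'r.
have -> : (A *m z + b) - (A' *m z' + b') =
    (A *m (z - z') + (A - A') *m z') + (b - b').
  by rewrite mulmxBr mulmxBl [X in _ = X + _]addrA subrK opprD addrACA.
rewrite (le_trans (ler_normD _ _))//.
rewrite (le_trans (lerD (ler_normD _ _) (lexx _)))//.
have h1 := mulmx_norm A (z - z'); have h2 := mulmx_norm (A - A') z'.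
have h3 : `|A| * `|z - z'| <= r * `|z - z'| by rewrite ler_wpM2r.
have h4 : `|A - A'| * `|z'| <= Num.max `|A - A'| `|b - b'| * r.
  by rewrite ler_pM// le_max lexx.
have h5 : `|b - b'| <= Num.max `|A - A'| `|b - b'| by rewrite le_max lexx orbT.
have n0 : 0 <= n%:R :> R by [].
have := ler_wpM2l n0 h3; have := ler_wpM2l n0 h4.
set M := Num.max _ _ in h4 h5 *; have := normr_ge0 (z - z').
move: h1 h2; nra.
Qed.

Lemma affine_bounded m n p (r : R) : 0 <= r -> exists2 L, 0 <= L &
  forall (A : 'M[R]_(m, n)) (z : 'M[R]_(n, p)) b, `|A| <= r -> `|b| <= r ->
    `|z| <= r -> `|A *m z + b| <= L.
Proof.
move=> r0; exists (n%:R * (r * r) + r); first by rewrite addr_ge0// !mulr_ge0.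
move=> A z b Ar br zr; rewrite (le_trans (ler_normD _ _))// lerD//.
by rewrite (le_trans (mulmx_norm _ _))// ler_wpM2l// ler_pM.
Qed.

(** Lipschitz jointly in parameters and input, by induction on the layers. The radius must vary in
    the induction, because the output of the first layer need not stay in the ball of radius [r]. *)
Lemma nn_lipschitz hid n0 (r : R) : exists2 L, 0 <= L &
  forall (theta theta' : nn_params R n0 hid) z z', `|theta| <= r -> `|theta'| <= r ->
    `|z| <= r -> `|z'| <= r ->
    `|nn sigma theta z - nn sigma theta' z'| <= L * (`|theta - theta'| + `|z - z'|).
Proof.
elim: hid n0 r => [|n1 hid IH] n0 r.
  have [r0|r0] := ltP r 0.
    by exists 0 => // theta theta' z z' h; have := normr_ge0 theta; lra.
  have [L L0 hL] := affine_lipschitz 1 n0 1 r0.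
  exists L => // -[A b] [A' b'] z z'; rewrite !prod_normE/= !ge_max.
  move=> /andP[Ar br] /andP[A'r b'r] zr z'r.
  rewrite (le_trans _ (hL A A' z z' b b' Ar A'r zr z'r))//.
  by rewrite (le_trans _ (mx_norm_coord _ 0 0))// !mxE.
have [r0|r0] := ltP r 0.
  by exists 0 => // theta theta' z z' h; have := normr_ge0 theta; lra.
have [L L0 hL] := affine_lipschitz n1 n0 1 r0.
have [r1 r10 hr1] := affine_bounded n1 n0 1 r0.
have [Ls Ls0 hLs] := map_mx_lipschitz r1.
have [r2 r20 hr2] := map_mx_bounded r1.
(* [r] bounds the parameters of the remaining layers and [r2] the output of the first layer, which
   is their input. *)
have [L' L'0 hL'] := IH n1 (Num.max r r2).
exists (L' * (1 + Ls * L)); first by rewrite mulr_ge0// addr_ge0// mulr_ge0.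
move=> [[A b] th] [[A' b'] th'] z z'; rewrite !prod_normE/= !ge_max.
move=> /andP[/andP[Ar br] thr] /andP[/andP[A'r b'r] th'r] zr z'r.
rewrite (le_trans (hL' _ _ _ _ _ _ _ _))//.
- by rewrite le_max thr.
- by rewrite le_max th'r.
- by rewrite le_max hr2 ?orbT//; exact: hr1.
- by rewrite le_max hr2 ?orbT//; exact: hr1.
rewrite -mulrA ler_wpM2l//.
have := hLs _ _ _ _ (hr1 _ _ _ Ar br zr) (hr1 _ _ _ A'r b'r z'r).
move=> /le_trans/(_ (ler_wpM2l Ls0 (hL A A' z z' b b' Ar A'r zr z'r))) h.
rewrite (le_trans (lerD (lexx _) h))//.
rewrite mulrDl mul1r !mulrA lerD//.
  rewrite (le_trans _ (_ : Num.max (Num.max `|A - A'| `|b - b'|) `|th - th'| <= _))//.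
    by rewrite le_max lexx orbT.
  by rewrite lerDl.
by rewrite ler_wpM2l ?mulr_ge0// lerD2r le_max lexx.
Qed.

End network_lipschitz.

(** * Integration and strong measurability *)

Lemma subsequence_eventually (P : nat -> nat -> Prop) :
  (forall n, \forall m \near \oo, P n m) ->
  exists2 s : nat -> nat, {homo s : m n / (m < n)%N} & forall n, P n (s n).
Proof.
move=> hP; have [N NP] : {N : nat -> nat & forall n m, (N n <= m)%N -> P n m}.
  apply: (@choice _ _ (fun n k => forall m, (k <= m)%N -> P n m)) => n.
  by have [k _ hk] := hP n; exists k => m km; exact: hk.
pose s := fix s n := if n is n'.+1 then maxn (s n').+1 (N n) else N 0%N.
exists s.
  apply: homo_ltn; first exact: ltn_trans.
  by move=> n; rewrite /= leq_max leqnn.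
by case=> [|n]; apply: NP => //=; rewrite leq_maxr.
Qed.

(** A one-sided form of convergence to 0, meant for integrals of nonnegative functions; comparison
    of integrals then suffices, without the topology of the extended reals. *)
Definition vanishes (R : realType) (u : nat -> \bar R) : Prop :=
  forall e : R, 0 < e -> \forall n \near \oo, (u n <= e%:E)%E.

Lemma cvg_vanishes (R : realType) (u : nat -> \bar R) :
  u n @[n --> \oo] --> 0%E -> vanishes u.
Proof.
move=> /fine_cvgP[fu /cvgrPdist_le u0] e e0.
apply: filterS2 fu (u0 e e0) => n fu.
by rewrite sub0r normrN -[u n]fineK//= lee_fin; apply: le_trans; exact: ler_norm.
Qed.

Lemma vanishes_le (R : realType) (u v : nat -> \bar R) :
  vanishes v -> (forall n, u n <= v n)%E -> vanishes u.
Proof. by move=> hv uv e e0; apply: filterS (hv e e0) => n; apply: le_trans. Qed.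

Section integral_limits.
Context d (T : measurableType d) (R : realType) (mu : {measure set T -> \bar R}).
Implicit Types h : nat -> T -> R.

(** The sum of the [h n] has a finite integral, hence is finite a.e., and the terms of a convergent
    series tend to 0. *)
Lemma summable_ae_cvg0 h : (forall n, measurable_fun setT (h n)) ->
  (forall n x, 0 <= h n x) ->
  (\sum_(n <oo) \int[mu]_x (h n x)%:E < +oo)%E ->
  {ae mu, forall x, h n x @[n --> \oo] --> 0}.
Proof.
move=> mh h0 hoo; pose H x := (\sum_(n <oo) (h n x)%:E)%E.
have H0 x : (0 <= H x)%E by apply: nneseries_ge0 => n _ _; rewrite lee_fin.
have mH : measurable_fun setT H.
  apply: ge0_emeasurable_sum => [n x _ _|n _]; first by rewrite lee_fin.
  exact/measurable_EFinP.
have iH : mu.-integrable setT H.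
  apply/integrableP; split => //; under eq_integral do rewrite gee0_abs//.
  rewrite integral_nneseries//; first by move=> n; exact/measurable_EFinP.
  by move=> n x _; rewrite lee_fin.
apply: filterS (integrable_ae measurableT iH) => x /(_ I) Hx.
apply: cvg_series_cvg_0; apply: nnseries_is_cvg => //.
by rewrite -ge0_fin_numE//; exact: H0.
Qed.

(** The subsequence is chosen with integrals below a geometric sequence, so that they are
    summable. *)
Lemma integral_cvg0_subsequence h : (forall n, measurable_fun setT (h n)) ->
  (forall n x, 0 <= h n x) ->
  vanishes (fun n => \int[mu]_x (h n x)%:E)%E ->
  exists2 s : nat -> nat, {homo s : m n / (m < n)%N} &
    {ae mu, forall x, h (s n) x @[n --> \oo] --> 0}.
Proof.
move=> mh h0 hc.
have [|s hs sP] := @subsequence_eventually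
    (fun n m => (\int[mu]_x (h m x)%:E <= ((2^-1) ^+ n.+1)%:E)%E).
  by move=> n; apply: hc; rewrite exprn_gt0.
exists s => //; apply: summable_ae_cvg0 => //.
apply: (@le_lt_trans _ _ (\sum_(n <oo) (1 / (2 ^ n.+1)%:R)%:E)%E); last first.
  by rewrite (le_lt_trans (epsilon_trick0 xpredT ler01))// ltry.
apply: lee_nneseries => [n _ _|n _].
  by apply: integral_ge0 => x _; rewrite lee_fin.
by rewrite (le_trans (sP n))// lee_fin div1r natrX exprVn.
Qed.

Hypothesis muoo : (mu setT < +oo)%E.

Lemma bounded_integral_cvg0 h (M : R) : (forall n, measurable_fun setT (h n)) ->
  (forall n x, 0 <= h n x <= M) ->
  {ae mu, forall x, h n x @[n --> \oo] --> 0} ->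
  vanishes (fun n => \int[mu]_x (h n x)%:E)%E.
Proof.
move=> mh hM hc.
have := @dominated_convergence _ _ _ mu setT measurableT
  (fun n x => (h n x)%:E) (cst 0%E) (cst M%:E).
case=> [n|||||_ _ hc'].
- exact/measurable_EFinP.
- exact: measurable_cst.
- by apply: filterS hc => x hx _; apply/fine_cvgP; split => //=; exact: nearW.
- apply/integrableP; split; first exact: measurable_cst.
  by rewrite integral_cst//= lte_mul_pinfty.
- apply/nearW => x n _; rewrite lee_fin ger0_norm; by case/andP: (hM n x).
- by apply: cvg_vanishes; rewrite integral0 in hc'.
Qed.

End integral_limits.

Section strong_measurability.
Context d (T : measurableType d) (R : realType) (mu : {measure set T -> \bar R}).

Lemma simple_function_comp (E F : normedModType R) (g : E -> F) (s : T -> E) :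
  simple_function s -> simple_function (g \o s).
Proof.
move=> ss; split.
  apply: (@sub_finite_set _ _ (g @` range s)); last by apply: finite_image; case: ss.
  by move=> _ [x _ <-]; exists (s x).
move=> e; rewrite (_ : _ @^-1` _ = s @^-1` [set a | g a = e])//.
exact: simple_function_preimage.
Qed.

Lemma strongly_measurable_comp (E F : normedModType R) (g : E -> F) (f : T -> E) :
  continuous g -> strongly_measurable f -> strongly_measurable (g \o f).
Proof.
move=> cg [s [ss sf]]; exists (fun n => g \o s n); split => [n|x].
  exact: simple_function_comp.
by apply: (cvg_comp _ _ (sf x)); exact: cg.
Qed.

Lemma simple_function_patch (E : normedModType R) (A : set T) (s : T -> E) :
  measurable A -> simple_function s ->
  simple_function (fun x => if x \in A then s x else 0).
Proof.
move=> mA ss; split.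
  apply: (@sub_finite_set _ _ (range s `|` [set 0])); last first.
    by rewrite finite_setU; split; [case: ss|exact: finite_set1].
  by move=> _ [x _ <-]; case: ifPn => _; [left; exists x|right].
move=> e; rewrite (_ : _ @^-1` _ =
    (A `&` s @^-1` [set e]) `|` (~` A `&` [set x | 0 = e])); last first.
  apply/seteqP; split => x /=.
    by case: ifPn => [/set_mem Ax|/negP xA] <-;
      [left|right; split => // Ax; apply: xA; exact: mem_set].
  move=> [[Ax <-]|[Ax <-]]; first by rewrite mem_set.
  by rewrite memNset.
apply: measurableU; apply: measurableI => //; first by case: ss.
  exact: measurableC.
have [e0|e0] := pselect (0 = e); first by rewrite (_ : [set _ | _] = setT) //; apply/seteqP; split.
by rewrite (_ : [set _ | _] = set0) //; apply/seteqP; split => // x.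
Qed.

(* Borel-Cantelli: a sequence of simple functions with summable truncated
   L1-distances to f_n has the same a.e. limit as f_n. *)
Lemma ae_strongly_measurable_lim (E : normedModType R) (f_ : nat -> T -> E) (f : T -> E) :
  (mu setT < +oo)%E ->
  (forall n, ae_strongly_measurable mu (f_ n)) ->
  {ae mu, forall x, f_ n x @[n --> \oo] --> f x} ->
  ae_strongly_measurable mu f.
Proof.
move=> muoo mf fc.
have [g_ gP] : {g_ : nat -> T -> E & forall n, strongly_measurable (g_ n) /\
    {ae mu, forall x, f_ n x = g_ n x}}.
  apply: (@choice _ _ (fun n g => strongly_measurable g /\
    {ae mu, forall x, f_ n x = g x})) => n.
  by have [g mg fg] := mf n; exists g.
have dist_meas (g s : T -> E) : strongly_measurable g -> strongly_measurable s ->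
    measurable_fun setT (fun x => Num.min 1 `|g x - s x|).
  move=> mg ms; apply: measurable_minr => //.
  have := strongly_measurable_norm (strongly_measurable_lin (-1) ms mg).
  by congr (measurable_fun _ _); apply/funext => x /=;
    rewrite -[LHS]/(`|-1 *: s x + g x|) scaleN1r addrC.
have simple_meas (s : T -> E) : simple_function s -> strongly_measurable s.
  by move=> ss; exists (fun=> s); split => // x; exact: cvg_cst.
have [s sP] : {s : nat -> T -> E & forall n, simple_function (s n) /\
   (\int[mu]_x (Num.min 1 `|g_ n x - s n x|)%:E <= (1 / (2 ^ n.+1)%:R)%:E)%E}.
  apply: (@choice _ _ (fun n s => simple_function s /\
   (\int[mu]_x (Num.min 1 `|g_ n x - s x|)%:E <= (1 / (2 ^ n.+1)%:R)%:E)%E)) => n.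
  have [[s [ss sg]] _] := gP n.
  have e0 : 0 < 1 / (2 ^ n.+1)%:R :> R by rewrite divr_gt0// ltr0n expn_gt0.
  have [|||m _ hm] := @bounded_integral_cvg0 _ _ _ mu muoo
    (fun m x => Num.min 1 `|g_ n x - s m x|) 1 _ _ _ _ e0.
  - by move=> m; apply: dist_meas; [exact: (gP n).1|exact: simple_meas].
  - by move=> m x; rewrite le_min ler01 normr_ge0/= ge_min lexx.
  - apply/nearW => x.
    have /cvgrPdist_le h := sg x; apply/cvgrPdist_le => e e0'.
    apply: filterS (h e e0') => m hm.
    rewrite sub0r normrN ger0_norm ?le_min ?ler01 ?normr_ge0//.
    by rewrite ge_min hm orbT.
  by exists (s m); split => //; apply: hm => /=.
have hs : {ae mu, forall x, Num.min 1 `|g_ n x - s n x| @[n --> \oo] --> 0}.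
  apply: summable_ae_cvg0.
  - by move=> n; apply: dist_meas; [exact: (gP n).1|apply: simple_meas; exact: (sP n).1].
  - by move=> n x; rewrite le_min ler01/=.
  - apply: (@le_lt_trans _ _ (\sum_(n <oo) (1 / (2 ^ n.+1)%:R)%:E)%E); last first.
      by rewrite (le_lt_trans (epsilon_trick0 xpredT ler01))// ltry.
    apply: lee_nneseries => [n _ _|n _]; last exact: (sP n).2.
    by apply: integral_ge0 => x _; rewrite lee_fin le_min ler01/=.
have hg : {ae mu, forall x, forall n, f_ n x = g_ n x}.
  by apply/ae_foralln => n; exact: (gP n).2.
have [N [mN N0 NP]] : {ae mu, forall x, s n x @[n --> \oo] --> f x}.
  apply: filterS3 fc hs hg => x fx sx fg.
  apply/cvgrPdist_le => e e0.
  (* A threshold below 1 makes the truncation [Num.min 1] inactive. *)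
  have e'0 : 0 < Num.min (1 / 2) (e / 2) by rewrite lt_min !divr_gt0.
  move/cvgrPdist_le : sx => /(_ _ e'0) sx; move/cvgrPdist_le : fx => /(_ (e / 2)) fx.
  apply: filterS2 sx (fx _) => [n|]; last by rewrite divr_gt0.
  rewrite sub0r normrN ger0_norm ?le_min ?ler01 ?normr_ge0// => /andP[h1 h2] h3.
  have h4 : `|g_ n x - s n x| <= e / 2.
    move: h1 h2; rewrite !ge_min => /orP[h1|h1] /orP[h2|h2] //; first lra.
    by move: h1; lra.
  rewrite [e]splitr -[f x](subrK (f_ n x)) -addrA (le_trans (ler_normD _ _))//.
  by rewrite lerD// fg.
(* [strongly_measurable] asks for convergence at every point, so the functions are set to 0 on the
   null set [N]. *)
exists (fun x => if x \in ~` N then f x else 0).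
  exists (fun n x => if x \in ~` N then s n x else 0); split.
    move=> n; apply: simple_function_patch; first exact: measurableC.
    exact: (sP n).1.
  move=> x; case: ifPn => [/set_mem Nx|_]; last exact: cvg_cst.
  by apply: contrapT => h; apply: Nx; exact: NP.
exists N; split => // x /=; apply: contra_notP => Nx.
by rewrite mem_set.
Qed.

(** The null set on which [f ^~ v] differs from a measurable function depends on [v]. Along a simple
    function only finitely many [v] occur, so their union is still null; continuity of [f t] then
    carries the result to the limit [u]. *)
Lemma caratheodory_ae_strongly_measurable (E F : normedModType R)
    (f : T -> E -> F) (u : T -> E) : (mu setT < +oo)%E ->
  (forall v, ae_strongly_measurable mu (f ^~ v)) ->
  {ae mu, forall t, continuous (f t)} -> strongly_measurable u ->
  ae_strongly_measurable mu (fun t => f t (u t)).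
Proof.
move=> muoo mf cf [s [ss su]].
apply: (@ae_strongly_measurable_lim _ (fun n t => f t (s n t))) => //; last first.
  by apply: filterS cf => t cft; apply: (cvg_comp _ _ (su t)); exact: cft.
move=> n.
have [g gP] : {g : E -> T -> F & forall v, strongly_measurable (g v) /\
    {ae mu, forall t, f t v = g v t}}.
  apply: (@choice _ _ (fun v g => strongly_measurable g /\
    {ae mu, forall t, f t v = g t})) => v.
  by have [g mg fg] := mf v; exists g.
have [r rP] : {r : E -> nat -> T -> F & forall v, (forall k, simple_function (r v k)) /\
    forall x, r v k x @[k --> \oo] --> g v x}.
  by apply: (@choice _ _ (fun v r => (forall k, simple_function (r k)) /\
    forall x, r k x @[k --> \oo] --> g v x)) => v; exact: (gP v).1.
have [fs ms] := ss n.
exists (fun t => g (s n t) t).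
  exists (fun k t => r (s n t) k t); split; last by move=> x; exact: (rP _).2.
  move=> k; split.
    apply: (@sub_finite_set _ _ (\bigcup_(v in range (s n)) range (r v k))).
      by move=> _ [t _ <-]; exists (s n t); [exists t|exists t].
    by apply: bigcup_finite => // v _; case: ((rP v).1 k).
  move=> e; rewrite (_ : _ @^-1` _ = \bigcup_(v in range (s n))
      (s n @^-1` [set v] `&` r v k @^-1` [set e])); last first.
    apply/seteqP; split => [t /= <-|t [v _ [/= <- <-]]//].
    by exists (s n t) => //; exists t.
  apply: fin_bigcup_measurable => // v _; apply: measurableI => //.
  by case: ((rP v).1 k).
have : {ae mu, forall t, forall v, range (s n) v -> f t v = g v t}.
  have [X ->] := (finite_seqP _).1 fs.
  elim: X => [|v X IH]; first exact/nearW.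
  apply: filterS2 (gP v).2 IH => t fg h w /=; rewrite inE => /predU1P[->//|].
  exact: h.
by apply: filterS => t; apply; exists t.
Qed.

End strong_measurability.

(** * Lebesgue-Bochner spaces *)

Section Lp_lemmas.
Context d (T : measurableType d) (R : realType) (mu : {measure set T -> \bar R}).
Context (p : \bar R) (p1 : (1 <= p)%E).

(** The minimum of the two absolute values equals [f] a.e. and is dominated everywhere, as
    [le_Lnorm] requires. *)
Lemma Lnorm_le_ae (f g : T -> R) : measurable_fun setT f -> measurable_fun setT g ->
  {ae mu, forall x, 0 <= f x <= g x} ->
  ('N[mu]_p[EFin \o f] <= 'N[mu]_p[EFin \o g])%E.
Proof.
move=> mf mg fg; have mfg : measurable_fun setT (fun x => Num.min `|f x| `|g x|).
  by apply: measurable_minr; exact: measurableT_comp.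
have mng : measurable_fun setT (fun x => `|g x|) by exact: measurableT_comp.
rewrite (@eq_ae_Lnorm _ _ _ mu p p1 f (fun x => Num.min `|f x| `|g x|))//; last first.
  apply: filterS fg => x /andP[f0 fg] _.
  by rewrite !ger0_norm ?min_l// (le_trans f0).
rewrite (@eq_ae_Lnorm _ _ _ mu p p1 g (fun x => `|g x|))//; last first.
  by apply: filterS fg => x /andP[f0 fg] _; rewrite ger0_norm// (le_trans f0).
by apply: le_Lnorm => // x; rewrite le_min !normr_ge0/= ge_min lexx orbT.
Qed.

Context (E : normedModType R).
Local Notation LpE := (Lp mu p1 E).

Lemma Lp_norm_meas (f : LpE) : measurable_fun setT (fun x => `|f x|).
Proof. exact/strongly_measurable_norm/preLp_measurable. Qed.

Lemma Lp_normE (f : LpE) : (`|f|%:E = 'N[mu]_p[(fun x => (`|f x|)%:E)])%E.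
Proof. by rewrite fineK//; exact: preLp_fin. Qed.

(** A majorant [h] of finite norm ensures that [f] has a class, so that [Lp_class] does not fall
    back on its default value 0. *)
Lemma Lp_class_ae (f : T -> E) (h : T -> R) : ae_strongly_measurable mu f ->
  measurable_fun setT h -> ('N[mu]_p[EFin \o h] < +oo)%E ->
  {ae mu, forall x, `|f x| <= h x} ->
  {ae mu, forall x, (Lp_class mu p1 f : LpE) x = f x}.
Proof.
move=> [g mg fg] mh hoo fh.
have gL : g \in Lfun_pred mu p1.
  apply/asboolP; split => //; apply: le_lt_trans hoo.
  apply: (@Lnorm_le_ae (fun x => `|g x|)) => //.
    exact: strongly_measurable_norm.
  by apply: filterS2 fg fh => x <- ->; rewrite normr_ge0.
rewrite /Lp_class; case: xgetP => [_ -> //|h0].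
have := Lp_reprP (PreLp gL).
set G := (X in {ae mu, forall x, Lp_fun X x = _}) => hG.
by have := h0 G; case; apply: filterS2 fg hG => x -> ->.
Qed.

Lemma LpBE (f g : LpE) : {ae mu, forall x, (f - g : LpE) x = f x - g x}.
Proof.
by apply: filterS (Lp_lin (-1) g f) => x; rewrite !scaleN1r addrC => ->; rewrite addrC.
Qed.

End Lp_lemmas.

Section L2.
Context d (T : measurableType d) (R : realType) (mu : {measure set T -> \bar R}).
Context (E : normedModType R).
Local Notation L2 := (Lp mu (one_le_two R) E).

Lemma L2_sqr_norm (f : L2) : (\int[mu]_x (`|f x| ^+ 2)%:E = (`|f| ^+ 2)%:E)%E.
Proof.
have := @powR_Lnorm _ _ _ mu (fun x => (`|f x|)%:E) 2 ltac:(by []).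
rewrite -Lp_normE poweR_EFin powR_mulrn// => ->.
apply: eq_integral => x _.
by rewrite gee0_abs ?lee_fin// poweR_EFin powR_mulrn.
Qed.

End L2.

(** * Testing L^2 functions against simple functions with values in the dual *)

Section pairing.
Context d (T : measurableType d) (R : realType) (mu : {measure set T -> \bar R}).
Hypothesis muoo : (mu setT < +oo)%E.

(** An L^2 bound gives uniform integrability: [h n] is at most its truncation at [M] plus
    [h n ^+ 2 / M]. The truncations have vanishing integrals, and the second term contributes at
    most [C / M]. *)
Lemma L2_bounded_integral_cvg0 (h : nat -> T -> R) (C : R) :
  (forall n, measurable_fun setT (h n)) -> (forall n x, 0 <= h n x) ->
  (forall n, \int[mu]_x (h n x ^+ 2)%:E <= C%:E)%E ->
  {ae mu, forall x, h n x @[n --> \oo] --> 0} ->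
  vanishes (fun n => \int[mu]_x (h n x)%:E)%E.
Proof.
move=> mh h0 hC hc e e0.
have C0 : 0 <= C.
  by rewrite -lee_fin (le_trans _ (hC 0%N))// integral_ge0// => x _; rewrite lee_fin sqr_ge0.
(* Chosen so that [C / M <= e / 2]; the summand 1 keeps [M] positive when [C = 0]. *)
pose M := 2 * C / e + 1.
have M0 : 0 < M by rewrite ltr_wpDl// divr_ge0 ?mulr_ge0// ltW.
have mM n : measurable_fun setT (fun x => Num.min M (h n x)) by exact: measurable_minr.
have e20 : 0 < e / 2 by rewrite divr_gt0.
have hm : vanishes (fun n => \int[mu]_x (Num.min M (h n x))%:E)%E.
  apply: (@bounded_integral_cvg0 _ _ _ mu muoo _ M) => //.
    by move=> n x; rewrite le_min h0 ltW//= ge_min lexx.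
  apply: filterS hc => x /cvgrPdist_le hx; apply/cvgrPdist_le => e' e'0.
  apply: filterS (hx e' e'0) => n.
  rewrite !sub0r !normrN !ger0_norm ?le_min ?h0 ?(ltW M0)//.
  by move=> hn; rewrite ge_min hn orbT.
apply: filterS (hm _ e20) => n hn.
have m2 : measurable_fun setT (fun x => h n x ^+ 2) by exact: measurable_funX.
have le1 : (\int[mu]_x (h n x)%:E <=
    \int[mu]_x ((Num.min M (h n x))%:E + (M^-1)%:E * (h n x ^+ 2)%:E))%E.
  apply: ge0_le_integral => //.
  - by move=> x _; rewrite lee_fin.
  - exact/measurable_EFinP.
  - apply: emeasurable_funD; first exact/measurable_EFinP.
    by apply: measurable_funeM; exact/measurable_EFinP.
  - move=> x _; rewrite -EFinM -EFinD lee_fin.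
    have [Mh|hM] := leP M (h n x); last by rewrite lerDl mulr_ge0 ?sqr_ge0// invr_ge0 ltW.
    rewrite (le_trans _ (_ : M^-1 * h n x ^+ 2 <= _)) ?lerDr ?(ltW M0)//.
    by rewrite ler_pdivlMl// expr2 ler_wpM2r.
apply: (le_trans le1); rewrite ge0_integralD//.
- rewrite ge0_integralZl//; last 3 first.
  + exact/measurable_EFinP.
  + by move=> x _; rewrite lee_fin sqr_ge0.
  + by rewrite lee_fin invr_ge0 ltW.
  rewrite [e]splitr EFinD leeD// (le_trans (lee_wpmul2l _ (hC n)))//.
    by rewrite lee_fin invr_ge0 ltW.
  rewrite -EFinM lee_fin ler_pdivrMl// /M.
  have : 2 * C / e * (e / 2) = C by field; lra.
  by nra.
- by move=> x _; rewrite lee_fin le_min h0 ltW.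
- exact/measurable_EFinP.
- by move=> x _; rewrite -EFinM lee_fin mulr_ge0 ?sqr_ge0// invr_ge0 ltW.
- by apply: measurable_funeM; exact/measurable_EFinP.
Qed.

Context (E : normedModType R).
Local Notation L2 := (Lp mu (one_le_two R) E).
Implicit Types s : T -> dual E.

Lemma simple_function_pair (A B C : normedModType R) (g : A -> B -> C)
    (s : T -> A) (t : T -> B) :
  simple_function s -> simple_function t -> simple_function (fun x => g (s x) (t x)).
Proof.
move=> ss st; split.
  apply: (@sub_finite_set _ _ [set g a b | a in range s & b in range t]).
    by move=> _ [x _ <-]; exists (s x); [exists x|exists (t x); [exists x|]].
  by apply: finite_image2; [case: ss | case: st].
move=> e; rewrite (_ : _ @^-1` _ = \bigcup_(a in range s)
    (s @^-1` [set a] `&` t @^-1` [set b | g a b = e])); last first.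
  apply/seteqP; split => [x /= <-|x [a _ [/= -> ->]]//].
  by exists (s x) => //; exists x.
apply: fin_bigcup_measurable => [|a _]; first by case: ss.
by apply: measurableI; exact: simple_function_preimage.
Qed.

Lemma simple_function_bounded (A : normedModType R) (s : T -> A) :
  simple_function s -> exists2 K, 0 <= K & forall x, `|s x| <= K.
Proof.
move=> [fs _].
have /compact_bounded/pinfty_ex_gt0[K K0 hK] : compact (range s).
  exact: finite_compact.
by exists K; [exact: ltW|move=> x; apply: hK; exists x].
Qed.

Lemma pairing_measurable s (f : T -> E) : simple_function s -> strongly_measurable f ->
  measurable_fun setT (fun x => s x (f x)).
Proof.
move=> ss [t [st tf]].
apply: (@measurable_fun_cvg _ _ _ _ (fun n x => s x (t n x))) => [n|x _].
  move=> mT Y mY; rewrite setTI.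
  have := @simple_function_pair (dual E) E R^o (fun a b => a b) s (t n) ss (st n).
  by move=> /(@simple_function_preimage _ _ _ _ _ Y).
by apply: (cvg_comp _ _ (tf x)); exact: dual_continuous.
Qed.

Lemma simple_function_norm_meas (A : normedModType R) (s : T -> A) :
  simple_function s -> measurable_fun setT (fun x => `|s x|).
Proof.
move=> ss; apply: strongly_measurable_norm.
by exists (fun=> s); split => // x; exact: cvg_cst.
Qed.

Lemma finite_norm_bounded (p : R) (f : T -> R) (K : R) : 1 <= p ->
  measurable_fun setT f -> 0 <= K -> {ae mu, forall x, 0 <= f x <= K} ->
  ('N[mu]_p%:E[EFin \o f] < +oo)%E.
Proof.
move=> p1 mf K0 fK.
have p1' : (1 <= p%:E)%E by rewrite lee_fin.
apply: (@le_lt_trans _ _ ('N[mu]_p%:E[EFin \o cst K])%E).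
  by apply: Lnorm_le_ae.
rewrite unlock poweR_lty//.
rewrite (_ : (fun x => _) = cst ((`|K| `^ p)%:E)); last by apply/funext.
by rewrite integral_cst// lte_mul_pinfty// lee_fin powR_ge0.
Qed.

Lemma pairing_abs_le s (f : L2) : simple_function s ->
  (\int[mu]_x `|s x (f x)|%:E <=
    (fine 'N[mu]_2%:E[EFin \o (fun x => `|s x|)] * `|f|)%:E)%E.
Proof.
move=> ss; have [K K0 sK] := simple_function_bounded ss.
have mf : strongly_measurable f by exact: preLp_measurable.
have ms := simple_function_norm_meas ss; have mnf := strongly_measurable_norm mf.
rewrite EFinM Lp_normE fineK; last first.
  rewrite ge0_fin_numE ?Lnorm_ge0//; apply: (@finite_norm_bounded _ _ K) => //.
    by rewrite ler1n.
  by apply/nearW => x; rewrite normr_ge0/=.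
have := @hoelder _ _ _ mu (fun x => `|s x|) (fun x => `|f x|) 2 2 ms mnf.
move=> /(_ _ _ _)/(le_trans _) -> //; last by lra.
rewrite Lnorm1; apply: ge0_le_integral => //=.
- by apply/measurable_EFinP; apply: measurableT_comp => //; exact: pairing_measurable.
- by apply/measurable_EFinP; apply: measurableT_comp => //; exact: measurable_funM.
- move=> x _; rewrite lee_fin [leRHS]ger0_norm ?mulr_ge0//.
  exact: dual_le.
Qed.

Lemma pairing_integrable s (f : L2) : simple_function s ->
  mu.-integrable setT (EFin \o (fun x => s x (f x) : R)).
Proof.
move=> ss; apply/integrableP; split.
  by apply/measurable_EFinP; apply: pairing_measurable => //; exact: preLp_measurable.
by rewrite (le_lt_trans (pairing_abs_le f ss))// ltry.
Qed.

Definition pairing s (f : L2) : R := \int[mu]_x (s x (f x) : R).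

Lemma pairing_linear s : simple_function s -> linear (pairing s : L2 -> R^o).
Proof.
move=> ss; suff lin a (f g : L2) :
    pairing s (a *: f + g) = a * pairing s f + pairing s g by move=> a f g; exact: lin.
have i1 := pairing_integrable f ss; have i2 := pairing_integrable g ss.
have ia : mu.-integrable setT (EFin \o (fun x => a * (s x (f x) : R))).
  by have := @integrableZl _ _ _ mu _ measurableT a _ i1.
rewrite /pairing -RintegralZl// -RintegralD//.
congr fine; apply: ae_eq_integral => //.
- by have /integrableP[] := pairing_integrable (a *: f + g) ss.
- by have /integrableP[] := integrableD measurableT ia i2.
- by apply: filterS (Lp_lin a f g) => x -> _ /=; rewrite linearP.
Qed.

Lemma pairing_le s (f : L2) : simple_function s ->
  `|pairing s f| <= fine 'N[mu]_2%:E[EFin \o (fun x => `|s x|)] * `|f|.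
Proof.
move=> ss; rewrite -lee_fin (le_trans _ (pairing_abs_le f ss))//.
have := le_normr_Rintegral measurableT (pairing_integrable f ss).
rewrite -lee_fin => /le_trans; apply; rewrite /Rintegral fineK//.
apply: integrable_fin_num => //.
exact: (integrable_norm (pairing_integrable f ss)).
Qed.

Lemma pairing_dual s : simple_function s ->
  exists g : dual L2, forall f, g f = pairing s f.
Proof.
move=> ss; apply: (bounded_linear_dual (pairing_linear ss)) => f.
exact: pairing_le.
Qed.

(** Only the finitely many values of [s] act on [f_ n - f], and the pointwise pairing tends to 0
    a.e. The L^2 bound on [f_] replaces a common majorant. *)
Lemma pairing_cvg s (f_ : nat -> L2) (f : L2) (C : R) : simple_function s ->
  (forall n, `|f_ n| <= C) ->
  {ae mu, forall x, weak_cvg (fun n => f_ n x) (f x)} ->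
  pairing s (f_ n) @[n --> \oo] --> pairing s f.
Proof.
move=> ss fC fw; have [K K0 sK] := simple_function_bounded ss.
have [g gE] := pairing_dual ss.
have mfn n : strongly_measurable (f_ n - f : L2) by exact: preLp_measurable.
have mp n := pairing_measurable ss (mfn n).
have : vanishes (fun n => \int[mu]_x `|s x ((f_ n - f : L2) x)|%:E)%E.
  apply: (@L2_bounded_integral_cvg0 _ (K ^+ 2 * (C + `|f|) ^+ 2)).
  - by move=> n; exact: measurableT_comp.
  - by [].
  - move=> n; apply: (@le_trans _ _ (\int[mu]_x ((K ^+ 2)%:E * (`|(f_ n - f : L2) x| ^+ 2)%:E))%E).
      apply: ge0_le_integral => //.
      + by apply/measurable_EFinP; apply: measurable_funX; exact: measurableT_comp.
      + apply: measurable_funeM; apply/measurable_EFinP; apply: measurable_funX.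
        exact: Lp_norm_meas.
      + move=> x _; rewrite -EFinM lee_fin -exprMn lerXn2r ?nnegrE ?mulr_ge0//.
        by rewrite (le_trans (dual_le _ _))// ler_wpM2r.
    rewrite ge0_integralZl//; last 2 first.
    + by apply/measurable_EFinP; apply: measurable_funX; exact: Lp_norm_meas.
    + by rewrite lee_fin sqr_ge0.
    rewrite L2_sqr_norm -EFinM lee_fin ler_wpM2l ?sqr_ge0//.
    rewrite lerXn2r ?nnegrE ?addr_ge0// ?(le_trans _ (fC 0%N))//.
    by rewrite (le_trans (ler_normB _ _))// lerD2r.
  - have : {ae mu, forall x, forall n, (f_ n - f : L2) x = f_ n x - f x}.
      by apply/ae_foralln => n; exact: LpBE.
    apply: filterS2 fw => x fx dE; under eq_fun do rewrite dE linearB/=.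
    rewrite -(normr0 R) -(subrr (s x (f x))); apply: cvg_norm; apply: cvgB.
      exact: fx.
    exact: cvg_cst.
move=> hv; apply/cvgrPdist_le => e e0; apply: filterS (hv e e0) => n hn.
rewrite distrC -!gE -linearB/= gE -lee_fin; apply: le_trans hn.
have := le_normr_Rintegral measurableT (pairing_integrable (f_ n - f) ss).
rewrite -lee_fin => /le_trans; apply; rewrite /Rintegral fineK//.
apply: integrable_fin_num => //.
exact: (integrable_norm (pairing_integrable (f_ n - f) ss)).
Qed.

End pairing.

Section L2_lower_semicontinuity.
Context d (T : measurableType d) (R : realType) (mu : {measure set T -> \bar R}).
Hypothesis muoo : (mu setT < +oo)%E.
Context (E : normedModType R).
Local Notation L2 := (Lp mu (one_le_two R) E).

Lemma simple_function_L2 (s : T -> E) : simple_function s ->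
  exists S : L2, {ae mu, forall x, S x = s x}.
Proof.
move=> ss; have [K K0 sK] := simple_function_bounded ss.
exists (Lp_class mu (one_le_two R) s).
apply: (@Lp_class_ae _ _ _ _ _ _ _ _ (fun x => `|s x|)).
- exists s; last exact/nearW.
  by exists (fun=> s); split => // x; exact: cvg_cst.
- exact: simple_function_norm_meas.
- apply: (finite_norm_bounded muoo (K := K)) => //.
  + by rewrite ler1n.
  + exact: simple_function_norm_meas.
  + by apply/nearW => x; rewrite normr_ge0/=.
- exact/nearW.
Qed.

(** Approximating simple functions need not be dominated by [f]. Replacing [s n] by 0 where its norm
    exceeds twice that of [f] keeps the pointwise limit and bounds the error by three times the norm
    of [f], whence the factor 9 in the dominating function. *)
Lemma L2_simple_approx (f : L2) (e : R) : 0 < e ->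
  exists2 s : T -> E, simple_function s &
    exists2 S : L2, {ae mu, forall x, S x = s x} & `|f - S| <= e.
Proof.
move=> e0; have [s [ss sf]] : strongly_measurable f by exact: preLp_measurable.
have mns n : measurable_fun setT (fun x => `|s n x|) by exact: simple_function_norm_meas.
have mnf := Lp_norm_meas f.
pose A n := [set x | `|s n x| <= 2 * `|f x|].
have mA n : measurable (A n).
  have mh : measurable_fun setT (fun x => `|s n x| - 2 * `|f x|).
    by apply: measurable_funB => //; exact: measurable_funM.
  have := mh measurableT _ (measurable_itv `]-oo, 0]); rewrite setTI.
  congr measurable; apply/seteqP.
  by split => x; rewrite /A/= in_itv/= subr_le0.
pose t n x := if x \in A n then s n x else 0.
have st n : simple_function (t n) by exact: simple_function_patch.
have tf x : t n x @[n --> \oo] --> f x.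
  have [fx0|fx0] := eqVneq (f x) 0.
    rewrite (_ : (fun n => t n x) = cst 0); first by rewrite fx0; exact: cvg_cst.
    apply/funext => n; rewrite /t; case: ifPn => // /set_mem.
    by rewrite /A/= fx0 normr0 mulr0 normr_le0 => /eqP.
  apply: cvg_trans (sf x); apply: near_eq_cvg.
  have f0 : 0 < `|f x| by rewrite normr_gt0.
  have : `|s n x| @[n --> \oo] --> `|f x| by apply: cvg_norm; exact: sf.
  move=> /cvgr_lt/(_ (2 * `|f x|)) h.
  have : \forall n \near \oo, `|s n x| < 2 * `|f x| by apply: h; lra.
  apply: filterS => n /ltW hn.
  by rewrite /t mem_set.
have tle n x : `|t n x| <= 2 * `|f x|.
  rewrite /t; case: ifPn => [/set_mem//|_].
  by rewrite normr0 mulr_ge0.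
have mft n : strongly_measurable (fun x => f x - t n x).
  have -> : (fun x => f x - t n x) = (-1) *: t n + (f : T -> E).
    by apply/funext => x; rewrite addrC -scaleN1r.
  apply: strongly_measurable_lin; last exact: preLp_measurable.
  by exists (fun=> t n); split => // x; exact: cvg_cst.
have mft2 n : measurable_fun setT (fun x => (`|f x - t n x| ^+ 2)%:E).
  apply/measurable_EFinP; apply: measurable_funX.
  exact: (strongly_measurable_norm (mft n)).
have := @dominated_convergence _ _ _ mu setT measurableT
  (fun n x => (`|f x - t n x| ^+ 2)%:E) (cst 0%E) (fun x => (9 * `|f x| ^+ 2)%:E).
case=> [//|||||_ _ hc].
- exact: measurable_cst.
- apply/nearW => x _; apply/fine_cvgP; split => /=; first exact: nearW.
  rewrite [X in _ --> X](_ : 0 = `|f x - f x| ^+ 2); last first.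
    by rewrite subrr normr0 expr0n.
  rewrite (_ : _ \o _ = (fun n => `|f x - t n x| * `|f x - t n x|)); last first.
    by apply/funext.
  by rewrite expr2; apply: cvgM; apply: cvg_norm; (apply: cvgB; [exact: cvg_cst|exact: tf]).
- apply/integrableP; split.
    by apply/measurable_EFinP; apply: measurable_funM => //; exact: measurable_funX.
  under eq_integral do rewrite gee0_abs ?lee_fin ?mulr_ge0 ?sqr_ge0// EFinM.
  rewrite ge0_integralZl//; last by apply/measurable_EFinP; exact: measurable_funX.
  by rewrite L2_sqr_norm -EFinM ltry.
- apply/nearW => x n _; rewrite lee_fin ger0_norm ?sqr_ge0//.
  have -> : 9 * `|f x| ^+ 2 = (3 * `|f x|) ^+ 2 :> R by rewrite exprMn; congr (_ * _); ring.
  rewrite lerXn2r ?nnegrE ?mulr_ge0// (le_trans (ler_normB _ _))//.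
  by have := tle n x; lra.
rewrite integral0 in hc.
have [N _ hN] := cvg_vanishes hc (exprn_gt0 2 e0).
exists (t N) => //; have [S St] := simple_function_L2 (st N); exists S => //.
rewrite -(@ler_pXn2r _ 2)// ?nnegrE ?(ltW e0)// -lee_fin -L2_sqr_norm.
apply: le_trans (hN N (leqnn N)).
rewrite le_eqVlt; apply/orP; left; apply/eqP; apply: ae_eq_integral => //.
  by apply/measurable_EFinP; apply: measurable_funX; exact: Lp_norm_meas.
by apply: filterS2 St (LpBE f S) => x <- -> _.
Qed.

(** The test function [z] is a duality map applied to a simple approximation [s] of [f]: the norm of
    [z x] is at most that of [s x], and [z x] pairs with [s x] to the squared norm. As a function of
    [s x] it is again simple, so no measurable selection of norming functionals is required. *)
Lemma L2_norm_lsc (f_ : nat -> L2) (f : L2) (a : R) :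
  (forall s : T -> dual E, simple_function s ->
    pairing s (f_ n) @[n --> \oo] --> pairing s f) ->
  a < `|f| -> \forall n \near \oo, a < `|f_ n|.
Proof.
move=> hf af; have [a0|a0] := ltP a 0.
  by apply/nearW => n; rewrite (lt_le_trans a0).
(* Three losses of [e] occur: the norm of [S] against that of [f], the pairing of [z] with [f]
   against its pairing with [S], and the passage to large [n]. A fourth [e] makes the final
   inequality strict. *)
pose e := (`|f| - a) / 4; have e0 : 0 < e by rewrite divr_gt0// subr_gt0.
have [s ss [S Ss fS]] := L2_simple_approx f e0.
have [phi phiP] : {phi : E -> dual E & forall v, `|phi v| <= 1 /\ phi v v = `|v|}.
  apply: (@choice _ _ (fun v (g : dual E) => `|g| <= 1 /\ g v = `|v|)) => v.
  by have [g] := hahn_banach_norming v; exists g.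
pose z x := `|s x| *: phi (s x).
have sz : simple_function z by exact: (simple_function_comp (fun v => `|v| *: phi v)).
have zN : fine ('N[mu]_2%:E[EFin \o (fun x => `|z x|)]) <= `|S|.
  apply: fine_le.
  - rewrite ge0_fin_numE ?Lnorm_ge0//.
    have [K K0 zK] := simple_function_bounded sz.
    apply: (finite_norm_bounded muoo (K := K)) => //.
    + by rewrite ler1n.
    + exact: simple_function_norm_meas.
    + by apply/nearW => x; rewrite normr_ge0/=.
  - exact: preLp_fin.
  - apply: (@Lnorm_le_ae _ _ _ _ _ _ (fun x => `|z x|) (fun x => `|S x|)).
    + by rewrite lee_fin ler1n.
    + exact: simple_function_norm_meas.
    + exact: Lp_norm_meas.
    + apply: filterS Ss => x ->; rewrite normr_ge0/= normrZ normr_id.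
      by rewrite ler_piMr//; exact: (phiP _).1.
have zS : pairing z S = `|S| ^+ 2.
  rewrite -[RHS]/(fine (`|S| ^+ 2)%:E) -L2_sqr_norm; congr fine.
  apply: ae_eq_integral => //.
  - by have /integrableP[] := pairing_integrable muoo S sz.
  - by apply/measurable_EFinP; apply: measurable_funX; exact: Lp_norm_meas.
  - apply: filterS Ss => x Sx _; rewrite Sx; congr EFin.
    by rewrite /z -[LHS]/(`|s x| * phi (s x) (s x)) (phiP _).2 expr2.
have [g gE] := pairing_dual muoo sz.
have gle h : g h <= `|S| * `|h|.
  rewrite gE (le_trans (ler_norm _))// (le_trans (pairing_le muoo h sz))//.
  by rewrite ler_wpM2r.
have SF : `|f| - e <= `|S|.
  rewrite lerBlDr -[X in `|X| <= _](subrK S) addrC (le_trans (ler_normD _ _))//.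
  by rewrite lerD2l.
have S0 : 0 < `|S| by rewrite (lt_le_trans _ SF)// /e; lra.
have gf : `|S| * (`|S| - e) <= g f.
  have := gle (S - f); rewrite linearB/= gE zS distrC => h.
  have := ler_wpM2l (ltW S0) fS; rewrite mulrBr -expr2; lra.
have lt : `|S| * (`|S| - e - e) < pairing z f.
  by rewrite -gE (lt_le_trans _ gf)// ltr_pM2l// ltrBlDr ltrDl.
apply: filterS (cvgr_gt _ (hf z sz) _ lt).
move=> n; rewrite -gE => /lt_le_trans/(_ (gle _)); rewrite ltr_pM2l//.
apply: le_lt_trans; move: SF; rewrite /e; lra.
Qed.

End L2_lower_semicontinuity.

(** * The evolution space *)

Lemma bounded_op_exists (R : realType) (E F : normedModType R) (f : E -> F) (C : R) :
  linear f -> (forall x, `|f x| <= C * `|x|) ->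
  exists g : bounded_op E F, forall x, g x = f x.
Proof.
move=> lf fC.
pose lfi := HB.pack_for {linear E -> F} f (GRing.isLinear.Build _ _ _ _ f lf).
suff cf : continuous (lfi : E -> F) by exists (BoundedOp cf).
apply/linear_bounded_continuous/linear_boundedP.
by near=> r => x; rewrite (le_trans (fC x))// ler_wpM2r//.
Unshelve. all: by end_near. Qed.

Lemma bounded_op_le (R : realType) (E F : normedModType R) (g : bounded_op E F) :
  exists2 C, 0 < C & forall x, `|g x| <= C * `|x|.
Proof.
have /linear_boundedP/pinfty_ex_gt0[C C0 h] :=
  continuous_linear_bounded 0 (@op_continuous _ _ _ g 0).
by exists C.
Qed.

Section almost_everywhere.
Context d (X : measurableType d) (R : realType) (mu : {measure set X -> \bar R}).

Lemma ae_imp (P Q : X -> Prop) : (forall x, P x -> Q x) ->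
  {ae mu, forall x, P x} -> {ae mu, forall x, Q x}.
Proof. by move=> PQ; apply: filterS. Qed.

Lemma ae_imp2 (P Q S : X -> Prop) : (forall x, P x -> Q x -> S x) ->
  {ae mu, forall x, P x} -> {ae mu, forall x, Q x} -> {ae mu, forall x, S x}.
Proof. by move=> PQS; apply: filterS2. Qed.

Lemma ae_imp3 (P Q S U : X -> Prop) : (forall x, P x -> Q x -> S x -> U x) ->
  {ae mu, forall x, P x} -> {ae mu, forall x, Q x} -> {ae mu, forall x, S x} ->
  {ae mu, forall x, U x}.
Proof. by move=> PQSU; apply: filterS3. Qed.

End almost_everywhere.

Section time.
Context (R : realType) (T : R) (T0 : 0 < T).

Lemma time_measure_setT : (time_measure T setT < +oo)%E.
Proof. by have := time_measure_fin T measurableT; rewrite ge0_fin_numE. Qed.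

Lemma time_ae_itv : {ae time_measure T, forall t, t \in `]0, T[}.
Proof.
exists (~` `]0, T[%classic); split.
- by apply: measurableC; exact: measurable_itv.
- by rewrite /time_measure /mrestr setICl measure0.
- by move=> t /= /negP h; apply/negP.
Qed.

Lemma time_ae_ex (a b : R) (P : R -> Prop) : 0 <= a -> a < b -> b <= T ->
  {ae time_measure T, forall t, P t} -> exists2 t, t \in `]a, b[ & P t.
Proof.
move=> a0 ab bT [N [mN N0 NP]]; apply: contrapT => h.
have abN : `]a, b[%classic `<=` N.
  by move=> t /= tab; apply: NP => Pt; apply: h; exists t.
have : (time_measure T `]a, b[%classic <= time_measure T N)%E.
  by apply: le_measure => //; rewrite inE//; exact: measurable_itv.
rewrite N0 /time_measure /mrestr (_ : _ `&` _ = `]a, b[%classic); last first.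
  apply/setIidl => t /=; rewrite !in_itv/= => /andP[at_ tb].
  by rewrite (le_lt_trans a0)//= (lt_le_trans tb).
rewrite lebesgue_measure_itv/= lte_fin ab -EFinD lee_fin.
by rewrite leNgt subr_gt0 ab.
Qed.

Lemma continuous_ae_eq (H : normedModType R) (c c' : R -> H) :
  {within `[0, T], continuous c} -> {within `[0, T], continuous c'} ->
  {ae time_measure T, forall t, c t = c' t} ->
  forall t, t \in `[0, T] -> c t = c' t.
Proof.
move=> /subspace_continuousP cc /subspace_continuousP cc' e t tT.
apply: contrapT => ne.
have D0 : 0 < `|c t - c' t| by rewrite normr_gt0 subr_eq0; exact/eqP.
have : (fun s => `|c s - c' s|) @ within `[0, T] (nbhs t) --> `|c t - c' t|.
  by apply: cvg_norm; apply: cvgB; [exact: cc|exact: cc'].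
move=> /cvgr_gt/(_ 0 D0); rewrite near_withinE => /nbhs_ballP[r /= r0 hr].
have /andP[t0 tT'] : 0 <= t <= T by move: tT; rewrite in_itv.
(* At an endpoint only one side of [t] lies in the interval; [0 < T] keeps [a < b] in this case
   too. *)
pose a := Num.max 0 (t - r); pose b := Num.min T (t + r).
have ab : a < b.
  rewrite /a /b lt_min !gt_max T0/=; apply/and3P; split; lra.
have [||s] := @time_ae_ex a b _ _ ab _ e.
- by rewrite /a le_max lexx.
- by rewrite /b ge_min lexx.
rewrite in_itv/= /a /b gt_max lt_min => /andP[/andP[s0 sr] /andP[sT sr']] cs.
have sball : ball t r s.
  by rewrite -ball_normE/= ltr_norml; apply/andP; split; lra.
have : 0 < `|c s - c' s| by apply: hr => //=; rewrite in_itv/= !ltW.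
by rewrite cs subrr normr0 ltxx.
Qed.

End time.

Lemma evolution_norm_fst (R : realType) (T : R) (V Z : normedModType R)
    (j : bounded_op V Z) (u : evolution T j) : `|(evolution_val u).1| <= `|u|.
Proof.
rewrite [leRHS]/Num.norm/= /evolution_norm.
by rewrite -[leLHS](ger0_norm (normr_ge0 _)) -sqrtr_sqr ler_wsqrtr// lerDl sqr_ge0.
Qed.

Section continuous_representatives.
Context (R : realType) (T : R) (T0 : 0 < T) (V Z H : normedModType R)
  (j : bounded_op V Z) (iVH : bounded_op V H).
Hypothesis hC : @embeds_in_C R T V Z j H iVH.
Local Notation evol := (evolution T j).

Lemma continuous_rep_unique (u : evol) (c c' : R -> H) t :
  continuous_rep iVH u c -> continuous_rep iVH u c' -> t \in `[0, T] -> c t = c' t.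
Proof.
move=> [cc ce] [cc' ce']; apply: continuous_ae_eq => //.
by apply: ae_imp2 ce ce' => s -> ->.
Qed.

Lemma evolution_funD a (u v : evol) : {ae time_measure T, forall t,
  evolution_fun (a *: u + v) t = a *: evolution_fun u t + evolution_fun v t}.
Proof. exact: Lp_lin. Qed.

(** Evaluation at a time as a bounded operator, which transports weak convergence of trajectories to
    fixed times. Its linearity rests on the uniqueness of continuous representatives. *)
Lemma evaluation_op : exists2 C, 0 <= C & exists ev : R -> bounded_op evol H,
  (forall u c t, continuous_rep iVH u c -> t \in `[0, T] -> ev t u = c t) /\
  (forall u t, t \in `[0, T] -> `|ev t u| <= C * `|u|).
Proof.
have [C hCC] := hC.
have [c cP] : {c : evol -> R -> H & forall u, continuous_rep iVH u (c u) /\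
    forall t, t \in `[0, T] -> `|c u t| <= C * `|u|}.
  apply: (@choice _ _ (fun u (c : R -> H) => continuous_rep iVH u c /\
    forall t, t \in `[0, T] -> `|c t| <= C * `|u|)) => u.
  by have [c hc] := hCC u; exists c.
have cC u t : t \in `[0, T] -> `|c u t| <= `|C| * `|u|.
  by move=> tT; rewrite (le_trans ((cP u).2 t tT))// ler_wpM2r// ler_norm.
exists `|C| => //.
have ev t : exists g : bounded_op evol H, forall u, t \in `[0, T] -> g u = c u t.
  (* Outside the interval representatives are unconstrained and the zero operator is taken. *)
  have [tT|tT] := boolP (t \in `[0, T]); last first.
    have l0 : linear (fun _ : evol => 0 : H) by move=> a x y; rewrite scaler0 addr0.
    have [|g gE] := @bounded_op_exists _ evol H _ 0 l0.
      by move=> x; rewrite normr0 mul0r.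
    by exists g => u h; case: (negP tT).
  have lc : linear (c ^~ t).
    move=> a u v; apply: (@continuous_rep_unique (a *: u + v) _
      (fun s => a *: c u s + c v s)) => //; first exact: (cP _).1.
    have [[cu eu] _] := cP u; have [[cv ev] _] := cP v; split.
      by move=> s; apply: cvgD; [apply: cvgZl_tmp; exact: cu|exact: cv].
    apply: ae_imp3 eu ev (evolution_funD a u v) => s -> -> ->.
    by rewrite linearP.
  by have [g gE] := bounded_op_exists lc (fun u => cC u t tT); exists g.
have [g gP] := choice ev; exists g; split => [u c' t uc tT|u t tT].
  by rewrite gP//; apply: continuous_rep_unique uc tT; exact: (cP u).1.
by rewrite gP// cC.
Qed.

Lemma evolution_continuous_rep (u : evol) : exists c, continuous_rep iVH u c.
Proof. by have [C /(_ u)[c [hc _]]] := hC; exists c. Qed.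

Lemma initial_value_op : exists g : bounded_op evol H,
  forall u, initial_value iVH u = g u.
Proof.
have [C C0 [ev [evE _]]] := evaluation_op; exists (ev 0) => u.
have z0 : 0 \in `[0, T] by rewrite in_itv/= lexx ltW.
have [c hc] := evolution_continuous_rep u.
rewrite (evE u _ 0 hc)// /initial_value; case: xgetP => [c' -> /= hc'|/(_ c)//].
exact: continuous_rep_unique hc' hc z0.
Qed.

Lemma evolution_bounded_H : exists2 C, 0 <= C & forall u : evol,
  {ae time_measure T, forall t, `|iVH (evolution_fun u t)| <= C * `|u|}.
Proof.
have [C C0 [ev [evE evC]]] := evaluation_op; exists C => // u.
have [c hc] := evolution_continuous_rep u.
have [_ hce] := hc; apply: (ae_imp2 _ hce (time_ae_itv T)) => t <- /subset_itv_oo_cc tT.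
by rewrite -(evE u c t hc tT) evC.
Qed.

(** The continuous representatives converge weakly at every time. The null set only stems from
    comparing them with the chosen representatives of the countably many classes involved. *)
Lemma weak_cvg_evolution (u_ : nat -> evol) (u : evol) : weak_cvg u_ u ->
  {ae time_measure T, forall t,
    weak_cvg (fun n => iVH (evolution_fun (u_ n) t)) (iVH (evolution_fun u t))}.
Proof.
move=> uw; have [C C0 [ev [evE evC]]] := evaluation_op.
have hev (v : evol) : {ae time_measure T, forall t, ev t v = iVH (evolution_fun v t)}.
  have [c hc] := evolution_continuous_rep v.
  have [_ hce] := hc; apply: (ae_imp2 _ hce (time_ae_itv T)) => t <- /subset_itv_oo_cc tT.
  exact: evE.
have : {ae time_measure T, forall t, forall n, ev t (u_ n) = iVH (evolution_fun (u_ n) t)}.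
  by apply/ae_foralln => n; exact: hev.
apply: ae_imp2 (hev u) => t <- h.
rewrite (_ : (fun n => _) = ev t \o u_); first exact: weak_cvg_op.
by apply/funext => n; rewrite /= h.
Qed.

End continuous_representatives.

(** At a fixed time weak convergence is known only after mapping into a larger space, not in [V]. If
    convergence failed, compactness would give a cluster point of terms staying at distance [e] from
    [i l]; its image under [k] is the weak limit, so injectivity makes it equal to [i l]. *)
Lemma compact_op_weak_cvg (R : realType) (V E W : normedModType R)
    (i : bounded_op V E) (k : bounded_op E W) (x : nat -> V) (l : V) (M : R) :
  compact_op i -> injective k -> (forall n, `|x n| <= M) ->
  weak_cvg (fun n => k (i (x n))) (k (i l)) -> i (x n) @[n --> \oo] --> i l.
Proof.
move=> ci ik xM xw; apply: contrapT => nc.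
have {nc}[e e0 he] : exists2 e : R, 0 < e &
    forall N, exists2 n, (N <= n)%N & e <= `|i l - i (x n)|.
  apply: contrapT => h; apply: nc; apply/cvgrPdist_lt => e e0.
  apply: contrapT => h'; apply: h; exists e => // N; apply: contrapT => h.
  apply: h'; exists N => // n /= Nn; rewrite ltNge; apply/negP => en.
  by apply: h; exists n.
have [s sP] : {s : nat -> nat & forall N, (N <= s N)%N /\ e <= `|i l - i (x (s N))|}.
  apply: (@choice _ _ (fun N n => (N <= n)%N /\ e <= `|i l - i (x n)|)) => N.
  by have [n] := he N; exists n.
have soo : s N @[N --> \oo] --> \oo.
  by apply/cvgnyPge => A; exists A => // N /= AN; rewrite (leq_trans AN)//; case: (sP N).
pose y N := i (x (s N)).
have [K cK yK] : exists2 K : set E, compact K & forall N, K (y N).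
  have bA : bounded_set [set v : V | `|v| <= M].
    by exists M; split; [exact: num_real|move=> r Mr v /= vM; exact: le_trans (ltW Mr)].
  have := ci _ bA; rewrite precompactE => cK.
  exists (closure (i @` [set v : V | `|v| <= M])) => // N.
  by apply: subset_closure; exists (x (s N)) => //=.
have [z [_ zc]] := cK (y @ \oo) _ (ltac:(by exists 0%N => // n _ /=)).
have zl : z = i l.
  apply: ik; apply: dual_separates => f.
  have [//|d0] := eqVneq (f (k z)) (f (k (i l))); exfalso.
  rewrite -subr_eq0 -normr_gt0 in d0.
  set dd := `|_| in d0; have d20 : 0 < dd / 2 by rewrite divr_gt0.
  have cf : f (k w) @[w --> z] --> f (k z).
    by apply: continuous_comp; [exact: op_continuous|exact: dual_continuous].
  have A : (y @ \oo) [set w | `|f (k (i l)) - f (k w)| < dd / 2].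
    have /cvgrPdist_lt/(_ _ d20) := cvg_comp _ _ soo (xw f).
    exact.
  move/cvgrPdist_lt : cf => /(_ _ d20) B.
  have [w [/= w1 w2]] := zc _ _ A B.
  have : dd <= `|f (k z) - f (k w)| + `|f (k (i l)) - f (k w)|.
    by rewrite [X in _ + X]distrC (le_trans _ (ler_normD _ _))// addrA subrK.
  by lra.
have A : (y @ \oo) (range y) by exists 0%N => // n _ /=; exists n.
have [_ [[N _ <-]]] := zc _ _ A (nbhsx_ballx z _ e0).
rewrite -ball_normE/= zl /y; have [_] := sP N.
by rewrite leNgt => /negP.
Qed.

Section L2_compactness.
Context d (T : measurableType d) (R : realType) (mu : {measure set T -> \bar R}).
Hypothesis muoo : (mu setT < +oo)%E.
Context (V E W : normedModType R) (i : bounded_op V E) (k : bounded_op E W).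
Local Notation L2 := (Lp mu (one_le_two R) V).

Lemma op_dist_measurable (f g : L2) : measurable_fun setT (fun x => `|i (f x) - i (g x)|).
Proof.
have -> : (fun x => `|i (f x) - i (g x)|) = (fun x => `|i ((-1 *: (g : T -> V) + f) x)|).
  by apply/funext => x; rewrite -linearB addrC -scaleN1r.
apply: strongly_measurable_norm.
have : strongly_measurable (-1 *: (g : T -> V) + f).
  by apply: strongly_measurable_lin; exact: preLp_measurable.
exact: strongly_measurable_comp (@op_continuous _ _ _ i).
Qed.

(* No Aubin-Lions argument is needed: where |f_n(x)| stays below a threshold,
   compactness turns weak into strong convergence, and the exceptional set has
   small measure by Chebyshev's inequality. *)
Lemma L2_compact_cvg (f_ : nat -> L2) (f : L2) (C : R) :
  compact_op i -> injective k -> (forall n, `|f_ n| <= C) ->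
  {ae mu, forall x, weak_cvg (fun n => k (i (f_ n x))) (k (i (f x)))} ->
  vanishes (fun n => \int[mu]_x (Num.min 1 `|i (f_ n x) - i (f x)|)%:E)%E.
Proof.
move=> ci ik fC fw e e0.
(* The weight of a penalty [q] times the squared norm of [f_ n x], whose integral is then at most
   [e / 2]. *)
pose q := e / (2 * (C ^+ 2 + 1)).
have C1 : 0 < C ^+ 2 + 1 by rewrite ltr_wpDl// sqr_ge0.
have q0 : 0 < q by rewrite divr_gt0// mulr_gt0.
pose dn n x := Num.min 1 `|i (f_ n x) - i (f x)|.
have mdn n : measurable_fun setT (dn n) by apply: measurable_minr => //; exact: op_dist_measurable.
have mfn n : measurable_fun setT (fun x => q * `|f_ n x| ^+ 2).
  by apply: measurable_funM => //; apply: measurable_funX; exact: Lp_norm_meas.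
have dn01 n x : 0 <= dn n x <= 1 by rewrite le_min ler01 normr_ge0 ge_min lexx.
have qf0 n x : 0 <= q * `|f_ n x| ^+ 2 by rewrite mulr_ge0 ?sqr_ge0// ltW.
(* What remains of the truncated distance after the penalty. It is 0 where the norm of [f_ n x]
   exceeds [q^-1 + 1], since the penalty is then at least 1, so compactness is needed only on
   bounded values. *)
pose h n x := Num.max 0 (dn n x - q * `|f_ n x| ^+ 2).
have mh n : measurable_fun setT (h n).
  by apply: measurable_maxr => //; exact: measurable_funB.
have hv : vanishes (fun n => \int[mu]_x (h n x)%:E)%E.
  apply: (@bounded_integral_cvg0 _ _ _ _ muoo _ 1) => //.
    move=> n x; rewrite le_max lexx/= ge_max ler01/= lerBlDr.
    have /andP[_ /le_trans] := dn01 n x; apply.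
    by rewrite lerDl.
  apply: filterS fw => x fx.
  pose M := Num.max (q^-1 + 1) `|f x|.
  (* Large values are replaced by the limit itself, which preserves weak convergence and makes the
     sequence bounded in [V]. *)
  pose x' n := if `|f_ n x| <= q^-1 + 1 then f_ n x else f x.
  have x'M n : `|x' n| <= M by rewrite /x' /M le_max; case: ifPn => [->//|_]; rewrite lexx orbT.
  have x'w : weak_cvg (fun n => k (i (x' n))) (k (i (f x))).
    move=> g; apply/cvgrPdist_le => r r0; have /cvgrPdist_le/(_ _ r0) := fx g.
    by apply: filterS => n; rewrite /x'; case: ifPn => // _ _; rewrite subrr normr0 ltW.
  have /cvgrPdist_le x'c := compact_op_weak_cvg ci ik x'M x'w.
  apply/cvgrPdist_le => r r0; apply: filterS (x'c r r0) => n.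
  rewrite sub0r normrN ger0_norm ?le_max ?lexx// /x' distrC ge_max (ltW r0)/=.
  case: ifPn => [_ hr|].
    by rewrite lerBlDr (le_trans _ (_ : r <= _)) ?lerDl// ge_min hr orbT.
  rewrite -ltNge => fM _.
  suff : 1 <= q * `|f_ n x| ^+ 2 by have /andP[_] := dn01 n x; lra.
  have qi0 : 0 < q^-1 by rewrite invr_gt0.
  rewrite -ler_pdivrMl// mulr1 expr2.
  rewrite (le_trans (_ : _ <= `|f_ n x|)) ?ler_peMl//; lra.
have e20 : 0 < e / 2 by rewrite divr_gt0.
apply: filterS (hv _ e20) => n hn.
apply: (@le_trans _ _ (\int[mu]_x ((h n x)%:E + q%:E * (`|f_ n x| ^+ 2)%:E))%E).
  apply: ge0_le_integral => //.
  - by apply/measurable_EFinP; exact: (mdn n).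
  - by apply/measurable_EFinP; exact: (measurable_funD (mh n) (mfn n)).
  - by move=> x _; rewrite lee_fin -lerBlDr /h le_max lexx orbT.
rewrite ge0_integralD//; last 4 first.
- by move=> x _; rewrite lee_fin le_max lexx.
- by apply/measurable_EFinP; exact: (mh n).
- by move=> x _; rewrite -EFinM lee_fin.
- by apply/measurable_EFinP; exact: (mfn n).
have -> : (e%:E = (e / 2)%:E + (e / 2)%:E)%E by rewrite -EFinD -splitr.
rewrite leeD//.
rewrite ge0_integralZl//; last 2 first.
- by apply/measurable_EFinP; apply: measurable_funX; exact: Lp_norm_meas.
- by rewrite lee_fin ltW.
rewrite L2_sqr_norm -EFinM lee_fin.
rewrite (@le_trans _ _ (q * (C ^+ 2 + 1)))//.
  rewrite ler_wpM2l ?(ltW q0)// (@le_trans _ _ (C ^+ 2)) ?lerDl//.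
  by rewrite lerXn2r ?nnegrE// (le_trans _ (fC n)).
by rewrite /q invfM mulrA -mulrA mulVf ?mulr1// gt_eqF.
Qed.

End L2_compactness.

(** * Superposition operators on the domain *)

Section domain.
Context (R : realType) (d : nat) (Omega : set 'rV[R]_d.+1).

Lemma lebesgue_outer_box (c : 'rV[R]_d.+1 * 'rV[R]_d.+1) (A : set 'rV[R]_d.+1) :
  A `<=` box c -> (lebesgue_outer A < +oo)%E.
Proof.
move=> Ac; pose B n : 'rV[R]_d.+1 * 'rV[R]_d.+1 := if n is 0%N then c else (0, 0).
apply: (@le_lt_trans _ _ (\sum_(k <oo) box_volume (B k))%E).
  by apply: ereal_inf_lbound; exists B => //= x /Ac cx; exists 0%N.
rewrite nneseries_recl//; last by move=> k _; exact: box_volume_ge0.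
rewrite eseries_cond eseries0 ?adde0; first exact: ltry.
move=> [//|k] _ _; rewrite /box_volume big_ord_recl/= subrr maxxx mul0r.
by [].
Qed.

Lemma domain_measure_finite : bounded_set Omega -> (domain_measure Omega setT < +oo)%E.
Proof.
move=> /pinfty_ex_gt0[M M0 OM].
(* Boxes are open on the left, hence the lower corner [- (M + 1)] instead of [- M]. *)
apply: (@lebesgue_outer_box (const_mx (- (M + 1)), const_mx M)) => x [_ /OM xM] i.
rewrite /= !mxE; have := le_trans (mx_norm_coord x 0 i) xM.
rewrite ler_norml => /andP[h ->]; rewrite andbT (lt_le_trans _ h)//.
by rewrite ltrN2 ltrDl.
Qed.

End domain.

(** Tonelli for a null set. By uniqueness of the product measure, the measure of [N] is also the
    integral over the first factor of the measures of the sections taken in the second. *)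
Lemma ae_product_section d1 d2 (T1 : measurableType d1) (T2 : measurableType d2)
    (R : realType) (m1 : {sigma_finite_measure set T1 -> \bar R})
    (m2 : {sigma_finite_measure set T2 -> \bar R}) (P : T1 * T2 -> Prop) :
  {ae (m1 \x^ m2)%E, forall z, P z} ->
  {ae m1, forall x, {ae m2, forall y, P (x, y)}}.
Proof.
move=> [N [mN N0 NP]].
have : (m1 \x m2)%E N = 0%E.
  rewrite (@product_measure_unique _ _ _ _ _ m1 m2 (m1 \x^ m2)%E)//.
  by move=> A B mA mB; exact: product_measure2E.
rewrite /product_measure1 => i0.
have mx : measurable_fun setT (m2 \o xsection N) by exact: measurable_fun_xsection.
have [h _] := ae_eq_integral_abs m1 measurableT mx.
have /h hae : (\int[m1]_(x in setT) `|(m2 \o xsection N) x| = 0)%E.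
  by rewrite -i0; apply: eq_integral => x _; rewrite gee0_abs.
apply: filterS hae => x /(_ I) /= Nx; exists (xsection N x); split => //.
  exact: measurable_xsection.
by move=> y /= nP; rewrite /xsection/= inE; apply: NP.
Qed.

Section Linfty_bound.
Context (R : realType) (T : R) (V Z : normedModType R) (j : bounded_op V Z)
  (d : nat) (Omega : set 'rV[R]_d.+1) (p : \bar R) (p1 : (1 <= p)%E)
  (iVL : bounded_op V (LpDomain Omega p1)).
Hypothesis bOmega : bounded_set Omega.
Hypothesis hLinfty : @embeds_in_Linfty R T V Z j d Omega p p1 iVL.

Lemma ae_cylinder_section (P : R * _ -> Prop) :
  {ae (time_measure T \x^ domain_measure Omega)%E, forall z, P z} ->
  {ae time_measure T, forall t, {ae domain_measure Omega, forall x, P (t, x)}}.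
Proof.
have fin : fin_num_fun (domain_measure Omega).
  move=> A mA; rewrite ge0_fin_numE// (le_lt_trans _ (domain_measure_finite bOmega))//.
  by rewrite le_measure// ?inE.
pose m2 := HB.pack_for {finite_measure set (caratheodory_type (lebesgue_on Omega)) -> \bar R}
  (domain_measure Omega) (Measure_isFinite.Build _ _ _ (domain_measure Omega) fin).
exact: (@ae_product_section _ _ _ _ _ (time_measure T) m2).
Qed.

Lemma evolution_bounded_Linfty : exists2 C, 0 <= C & forall u : evolution T j,
  {ae time_measure T, forall t, {ae domain_measure Omega, forall x,
    `|(iVL (evolution_fun u t) : LpDomain Omega p1) x| <= C * `|u|}}.
Proof.
have [C hC] := hLinfty; exists `|C| => // u; have [g [gu gC]] := hC u.
have : {ae (time_measure T \x^ domain_measure Omega)%E, forall z, `|g z| <= `|g|}.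
  (* The L^oo norm is an essential supremum only if the total measure is positive; otherwise every
     property holds a.e. *)
  have := Lp_normE g; rewrite unlock; case: ifPn => [_ h|].
    have := @ess_sup_ge _ _ _ (time_measure T \x^ domain_measure Omega)%E
      (abse \o (fun z => (`|g z|)%:E)).
    by apply: filterS => z; rewrite -h /= lee_fin normr_id.
  rewrite -leNgt measure_le0 => /eqP m0 _.
  by exists setT; split.
move=> /ae_cylinder_section.
apply: ae_imp2 gu => t; apply: ae_imp2 => x <- /le_trans; apply.
by rewrite (le_trans gC)// ler_wpM2r// ler_norm.
Qed.

End Linfty_bound.

Section superposition.
Context d (T : measurableType d) (R : realType) (mu : {measure set T -> \bar R}).
Hypothesis muoo : (mu setT < +oo)%E.
Context (p : R) (p1 : (1 <= p%:E)%E).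

Definition norm_one : R := fine ('N[mu]_(p%:E)[EFin \o cst (1%R : R)])%E.

Lemma norm_one_ge0 : 0 <= norm_one.
Proof. by rewrite fine_ge0// Lnorm_ge0. Qed.

Lemma norm_one_fin : ('N[mu]_(p%:E)[EFin \o cst (1%R : R)] < +oo)%E.
Proof.
apply: (finite_norm_bounded muoo (K := 1)) => //.
by apply/nearW => x /=; rewrite ler01 lexx.
Qed.

Lemma Lp_class_eq (E : normedModType R) (f g : T -> E) :
  {ae mu, forall x, f x = g x} -> Lp_class mu p1 f = Lp_class mu p1 g.
Proof.
move=> fg; rewrite /Lp_class; congr (xget 0 _); apply/seteqP.
by split => h /=; apply: filterS2 fg => x ->.
Qed.

Lemma Lp_norm_le_affine (E F : normedModType R) (h : Lp mu p1 E) (w : Lp mu p1 F) (a L : R) :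
  0 <= a -> 0 <= L -> {ae mu, forall x, `|h x| <= a + L * `|w x|} ->
  `|h| <= a * norm_one + L * `|w|.
Proof.
move=> a0 L0 hw; have mw := Lp_norm_meas w.
have mLw : measurable_fun setT (fun x => `|L| * `|w x|) by exact: measurable_funM.
have ma : measurable_fun setT (fun x : T => `|a| * (cst (1%R : R) : T -> R) x).
  exact: measurable_funM.
have Na : ('N[mu]_(p%:E)[(fun x => (`|a| * (cst (1%R : R) : T -> R) x)%:E)] =
    `|a|%:E * 'N[mu]_(p%:E)[EFin \o cst (1%R : R)])%E.
  by apply: (@ge0_LnormZ _ _ _ mu _ p1 (cst (1%R : R))) => //; exact: norm_one_fin.
have NL : ('N[mu]_(p%:E)[(fun x => (`|L| * `|w x|)%:E)] =
    `|L|%:E * 'N[mu]_(p%:E)[(fun x => (`|w x|)%:E)])%E.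
  apply: (@ge0_LnormZ _ _ _ mu _ p1 (fun x => `|w x|)) => //.
  by have := preLp_fin (repr w); rewrite ge0_fin_numE// Lnorm_ge0.
have := eminkowski mu ma mLw p1.
rewrite [X in (_ <= X)%E -> _](_ : _ = (a * norm_one + L * `|w|)%:E); last first.
  rewrite [X in (X + _)%E]Na [X in (_ + X)%E]NL !ger0_norm// EFinD !EFinM Lp_normE.
  by rewrite fineK// ge0_fin_numE ?Lnorm_ge0//; exact: norm_one_fin.
move=> hm; rewrite -lee_fin; apply: le_trans hm.
rewrite Lp_normE; apply: (@Lnorm_le_ae _ _ _ _ _ p1 (fun x => `|h x|)
  ((fun x : T => `|a| * (cst (1%R : R) : T -> R) x) \+ (fun x => `|L| * `|w x|))).
- exact: Lp_norm_meas.
- exact: measurable_funD.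
- by apply: filterS hw => x hx; rewrite normr_ge0/= !ger0_norm// mulr1.
Qed.

Lemma Lp_norm_le_bounded (E : normedModType R) (h : Lp mu p1 E) (a : R) :
  0 <= a -> {ae mu, forall x, `|h x| <= a} -> `|h| <= a * norm_one.
Proof.
move=> a0 ha; have := @Lp_norm_le_affine E E h h a 0 a0 (lexx _).
rewrite mul0r addr0; apply; apply: filterS ha => x.
by rewrite mul0r addr0.
Qed.

Lemma superposition_ae (phi : R -> R) (M : R) (v : Lp mu p1 R^o) :
  continuous phi -> (forall s, `|phi s| <= M) ->
  {ae mu, forall x, (Lp_class mu p1 (fun x => phi (v x) : R^o) : Lp mu p1 R^o) x = phi (v x)}.
Proof.
move=> cphi phiM.
apply: (@Lp_class_ae _ _ _ _ _ _ _ _ (cst M)).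
- exists (fun x => phi (v x) : R^o); last exact/nearW.
  apply: (@strongly_measurable_comp _ _ _ R^o R^o phi v cphi).
  exact: preLp_measurable.
- exact: measurable_cst.
- have M0 : 0 <= M by rewrite (le_trans _ (phiM 0)).
  apply: (finite_norm_bounded muoo (K := M)) => //.
  by apply/nearW => x /=; rewrite M0 lexx.
- by apply/nearW => x; exact: phiM.
Qed.

Context (sigma : R -> R) (hsigma : locally_lipschitz sigma) (m : nat) (hid : seq nat).

Definition nn_slice (theta : nn_params R (m + 1) hid) (alpha : 'cV[R]_m) (s : R) : R :=
  nn sigma theta (col_mx alpha s%:M).

(** The network is bounded and Lipschitz only on bounded sets. Precomposed with the projection onto
    [[- r, r]] it becomes a bounded, globally Lipschitz function of the scalar state, hence acts on
    all of L^p(Omega), and nothing changes on states bounded by [r] a.e. *)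
Definition clip (r s : R) : R := Num.max (- r) (Num.min r s).

Lemma clip_le r s : 0 <= r -> `|clip r s| <= r.
Proof. by move=> r0; rewrite ler_norml /clip le_max lexx/= ge_max ge_min lexx; lra. Qed.

Lemma clip_id r s : `|s| <= r -> clip r s = s.
Proof. by rewrite ler_norml => /andP[h1 h2]; rewrite /clip min_r// max_r. Qed.

Lemma clip_lipschitz r s s' : `|clip r s - clip r s'| <= `|s - s'|.
Proof.
have /andP[h1 h2] : - `|s - s'| <= s - s' <= `|s - s'| by rewrite -ler_norml.
rewrite /clip ler_norml; apply/andP; split;
  case: (leP r s) => ?; case: (leP r s') => ?;
  case: (leP (- r) r) => ?; case: (leP (- r) s) => ?; case: (leP (- r) s') => ?; lra.
Qed.

Lemma col_mx_scalar_norm (alpha : 'cV[R]_m) (s : R) :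
  `|col_mx alpha (s%:M : 'cV[R]_1)| <= `|alpha| + `|s|.
Proof.
apply: mx_norm_leP => [|i j]; first by rewrite addr_ge0.
rewrite mxE; case: splitP => k _.
  by rewrite (le_trans (mx_norm_coord _ _ _))// lerDl.
by rewrite !ord1 mxE eqxx mulr1n lerDr.
Qed.

Lemma nn_slice_lipschitz (r : R) : exists2 L, 0 <= L &
  forall theta theta' alpha alpha' s s',
    `|theta| <= r -> `|theta'| <= r -> `|alpha| <= r -> `|alpha'| <= r ->
    `|s| <= r -> `|s'| <= r ->
    `|nn_slice theta alpha s - nn_slice theta' alpha' s'| <=
      L * (`|theta - theta'| + `|alpha - alpha'| + `|s - s'|).
Proof.
(* The input [col_mx alpha s%:M] has norm at most [r + r]. *)
have [L L0 hL] := nn_lipschitz hsigma hid (m + 1) (r + r); exists L => //.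
move=> theta theta' alpha alpha' s s' thr th'r ar a'r sr s'r.
have r0 : 0 <= r by rewrite (le_trans _ sr).
rewrite (le_trans (hL _ _ _ _ _ _ _ _))//.
- by rewrite (le_trans thr)// lerDl.
- by rewrite (le_trans th'r)// lerDl.
- by rewrite (le_trans (col_mx_scalar_norm _ _))// lerD.
- by rewrite (le_trans (col_mx_scalar_norm _ _))// lerD.
rewrite ler_wpM2l// -addrA lerD2l opp_col_mx add_col_mx.
have -> : (s%:M - s'%:M : 'cV[R]_1) = (s - s')%:M by rewrite raddfB.
exact: col_mx_scalar_norm.
Qed.

Definition nn_superposition (r : R) theta alpha (v : Lp mu p1 R^o) : Lp mu p1 R^o :=
  Lp_class mu p1 (fun x => nn_slice theta alpha (clip r (v x)) : R^o).

Lemma nn_superposition_lipschitz (r : R) : 0 <= r -> exists2 L, 0 <= L &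
  forall theta theta' alpha alpha' v v',
    `|theta| <= r -> `|theta'| <= r -> `|alpha| <= r -> `|alpha'| <= r ->
    `|nn_superposition r theta alpha v - nn_superposition r theta' alpha' v'| <=
      L * (`|theta - theta'| + `|alpha - alpha'| + `|v - v'|) /\
    `|nn_superposition r theta alpha v| <= L.
Proof.
move=> r0; have [L L0 hL] := nn_slice_lipschitz r.
pose M := `|nn_slice 0 0 0| + L * (r + r + r).
have k0 := norm_one_ge0.
have M0 : 0 <= M by rewrite addr_ge0// mulr_ge0// !addr_ge0.
have slice_ae theta alpha v : `|theta| <= r -> `|alpha| <= r ->
    {ae mu, forall x, nn_superposition r theta alpha v x = nn_slice theta alpha (clip r (v x))} /\
    (forall s, `|nn_slice theta alpha (clip r s)| <= M).
  move=> thr ar.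
  have bnd s : `|nn_slice theta alpha (clip r s)| <= M.
    have /(_ (clip r s) 0) := hL theta 0 alpha 0; rewrite !subr0 !normr0.
    move=> /(_ thr r0 ar r0 (clip_le _ r0) r0) h.
    rewrite -[nn_slice _ _ _](subrK (nn_slice 0 0 0)) addrC.
    rewrite (le_trans (ler_normD _ _))// lerD2l (le_trans h)// ler_wpM2l//.
    by rewrite !lerD// clip_le.
  split => //; apply: (@superposition_ae (fun s => nn_slice theta alpha (clip r s)) M) => //.
  move=> s; apply/cvgrPdist_le => e e0.
  have L10 : 0 < L + 1 by rewrite ltr_wpDl.
  near=> s'; rewrite (le_trans (hL _ _ _ _ _ _ _ _ _ _ _ _)) ?clip_le//.
  rewrite !subrr !normr0 !add0r.
  apply: (@le_trans _ _ ((L + 1) * `|s - s'|)).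
    by rewrite ler_pM// ?lerDl// clip_lipschitz.
  rewrite -ler_pdivlMl//; near: s'.
  have : 0 < (L + 1)^-1 * e by rewrite mulr_gt0// invr_gt0.
  by move=> e'0; have /cvgrPdist_le := @cvg_id _ (nbhs s); apply.
(* One constant for both claims: [L * norm_one] for the parameter differences, which are constant in
   [x], [L] for [v - v'], and [M * norm_one] for the bound. *)
exists (L * (norm_one + 1) + M * norm_one).
  by rewrite addr_ge0 ?mulr_ge0// addr_ge0.
move=> theta theta' alpha alpha' v v' thr th'r ar a'r.
have [h1 b1] := slice_ae theta alpha v thr ar.
have [h2 b2] := slice_ae theta' alpha' v' th'r a'r.
split; last first.
  rewrite (@le_trans _ _ (M * norm_one)) ?lerDr ?mulr_ge0 ?addr_ge0//.
  by apply: Lp_norm_le_bounded => //; apply: filterS h1 => x ->.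
rewrite (@le_trans _ _ (L * (`|theta - theta'| + `|alpha - alpha'|) * norm_one + L * `|v - v'|))//.
  apply: Lp_norm_le_affine => //; first by rewrite mulr_ge0// addr_ge0.
  have hB := LpBE (nn_superposition r theta alpha v) (nn_superposition r theta' alpha' v').
  apply: filterS3 (filterI h1 h2) hB (LpBE v v') => x [e1 e2] -> ->.
  rewrite e1 e2 -mulrDr (le_trans (hL _ _ _ _ _ _ _ _ _ _ _ _)) ?clip_le//.
  by rewrite ler_wpM2l// lerD2l clip_lipschitz.
have t0 := normr_ge0 (theta - theta'); have a0 := normr_ge0 (alpha - alpha').
have v0 := normr_ge0 (v - v').
rewrite mulrDl; apply: ler_wpDr; first by rewrite !mulr_ge0// !addr_ge0.
set A := `|theta - theta'| + _.
have A0 : 0 <= A by rewrite addr_ge0.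
rewrite -subr_ge0 (_ : _ - _ = L * (norm_one * `|v - v'| + A)); last by ring.
by rewrite mulr_ge0// addr_ge0// mulr_ge0.
Unshelve. all: by end_near. Qed.

End superposition.

(** * Nemytskii operators *)

Lemma lipschitz_continuous_fun (R : realType) (E F : normedModType R) (f : E -> F) (L : R) :
  0 <= L -> (forall v w, `|f v - f w| <= L * `|v - w|) -> continuous f.
Proof.
move=> L0 hf v; apply/cvgrPdist_le => e e0.
have L10 : 0 < L + 1 by rewrite ltr_wpDl.
near=> w; rewrite (le_trans (hf _ _))//.
apply: (@le_trans _ _ ((L + 1) * `|v - w|)); first by rewrite ler_wpM2r// lerDl.
rewrite -ler_pdivlMl//; near: w.
have e'0 : 0 < (L + 1)^-1 * e by rewrite mulr_gt0// invr_gt0.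
by have /cvgrPdist_le := @cvg_id _ (nbhs v); apply.
Unshelve. all: by end_near. Qed.

Lemma continuous_compose (R : realType) (E F G : normedModType R) (f : E -> F) (g : F -> G) :
  continuous f -> continuous g -> continuous (g \o f).
Proof. by move=> cf cg x; apply: continuous_comp; [exact: cf|exact: cg]. Qed.

Lemma op_cvg (R : realType) (E F : normedModType R) (g : bounded_op E F) (x : nat -> E) l :
  (forall e, 0 < e -> \forall n \near \oo, `|l - x n| <= e) ->
  g (x n) @[n --> \oo] --> g l.
Proof.
move=> h; have xl : x @ \oo --> l by apply/cvgrPdist_le.
exact: (cvg_comp _ _ xl (@op_continuous _ _ _ g l)).
Qed.

Lemma L2_op_cvg (R : realType) (T : R) (E W : normedModType R) (g : bounded_op E W)
    (N_ : nat -> L2time T W) (N : L2time T W) (x_ : nat -> R -> E) (x : R -> E) :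
  (forall n, {ae time_measure T, forall t, N_ n t = g (x_ n t)}) ->
  {ae time_measure T, forall t, N t = g (x t)} ->
  {ae time_measure T, forall t, forall e, 0 < e ->
    \forall n \near \oo, `|x t - x_ n t| <= e} ->
  {ae time_measure T, forall t, N_ n t @[n --> \oo] --> N t}.
Proof.
move=> /ae_foralln; apply: ae_imp3 => t e1 -> h.
by under eq_fun do rewrite e1; exact: op_cvg.
Qed.

Section nemytskii_network.
Context (R : realType) (T : R) (d : nat) (Omega : set 'rV[R]_d.+1)
  (p : R) (p1 : (1 <= p%:E)%E) (V W Z : normedModType R)
  (j : bounded_op V Z) (iVL : bounded_op V (LpDomain Omega p1))
  (iLW : bounded_op (LpDomain Omega p1) W)
  (sigma : R -> R) (m : nat) (hid : seq nat).
Hypothesis bOmega : bounded_set Omega.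
Hypothesis hLinfty : @embeds_in_Linfty R T V Z j d Omega _ p1 iVL.
Hypothesis hsigma : locally_lipschitz sigma.
Local Notation evol := (evolution T j).
Local Notation net := (@nemytskii_nn R T d Omega _ p1 V W Z j iVL iLW sigma m hid).
Local Notation netS := (@nn_superposition _ _ R (domain_measure Omega) p p1 sigma m hid).

(** [C] is the constant of the embedding into L^oo, so clipping at [r] does not affect [u]. At a.e.
    time the network term is thus a continuous bounded map applied to the state, which gives strong
    measurability and a bound depending on [r] only. *)
Lemma nemytskii_nn_ae : exists2 C, 0 <= C & forall r, 0 <= r -> exists2 K, 0 <= K &
  forall theta alpha (u : evol), `|theta| <= r -> `|alpha| <= r -> C * `|u| <= r ->
  `|net theta alpha u| <= K /\ {ae time_measure T, forall t,
    net theta alpha u t = iLW (netS r theta alpha (iVL (evolution_fun u t)))}.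
Proof.
have [C C0 uC] := evolution_bounded_Linfty bOmega hLinfty; exists C => // r r0.
have muO := domain_measure_finite bOmega.
have [L L0 hL] := nn_superposition_lipschitz muO p1 hsigma m hid r0.
have [D D0 hD] := bounded_op_le iLW.
have muT := time_measure_setT T.
have DL0 : 0 <= D * L by rewrite mulr_ge0// ltW.
exists (D * L * norm_one (time_measure T) 2); first by rewrite mulr_ge0// norm_one_ge0.
move=> theta alpha u thr ar ur.
have e1 : {ae time_measure T, forall t,
    iLW (Lp_class (domain_measure Omega) p1 (fun x =>
      nn sigma theta (col_mx alpha ((iVL (evolution_fun u t) : LpDomain Omega p1) x)%:M))) =
    iLW (netS r theta alpha (iVL (evolution_fun u t)))}.
  apply: ae_imp (uC u) => t ht; congr (iLW _).
  apply: Lp_class_eq; apply: filterS ht => x hx.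
  by rewrite /nn_slice clip_id// (le_trans hx).
have bS t : `|iLW (netS r theta alpha (iVL (evolution_fun u t)))| <= D * L.
  rewrite (le_trans (hD _))// ler_wpM2l ?(ltW D0)//.
  by have [] := hL theta theta alpha alpha (iVL (evolution_fun u t))
    (iVL (evolution_fun u t)) thr thr ar ar.
have cS : continuous (netS r theta alpha : LpDomain Omega p1 -> LpDomain Omega p1).
  apply: (@lipschitz_continuous_fun _ _ _ _ L) => // v w.
  have [h _] := hL theta theta alpha alpha v w thr thr ar ar.
  by rewrite (le_trans h)// !subrr !normr0 !add0r.
have e2 : {ae time_measure T, forall t, net theta alpha u t =
    iLW (Lp_class (domain_measure Omega) p1 (fun x =>
      nn sigma theta (col_mx alpha ((iVL (evolution_fun u t) : LpDomain Omega p1) x)%:M)))}.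
  apply: (@Lp_class_ae _ _ _ _ _ _ _ _ (cst (D * L))).
  - exists (fun t => iLW (netS r theta alpha (iVL (evolution_fun u t)))) => //.
    apply: (@strongly_measurable_comp _ _ _ V W
      (fun v => iLW (netS r theta alpha (iVL v)))); last exact: preLp_measurable.
    exact: (continuous_compose (continuous_compose (@op_continuous _ _ _ iVL) cS)
      (@op_continuous _ _ _ iLW)).
  - exact: measurable_cst.
  - apply: (finite_norm_bounded muT (K := D * L)) => //; first by rewrite ler1n.
    by apply/nearW => x /=; rewrite DL0 lexx.
  - by apply: ae_imp e1 => t ->.
split; last by apply: ae_imp2 e1 e2 => t <-.
apply: Lp_norm_le_bounded => //.
by apply: ae_imp2 e1 e2 => t h ->; rewrite h.
Unshelve. all: by end_near. Qed.

Lemma nemytskii_nn_cvg (theta_ : nat -> nn_params R (m + 1) hid) theta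
    (alpha_ : nat -> 'cV[R]_m) alpha (u_ : nat -> evol) u (C : R) :
  theta_ n @[n --> \oo] --> theta -> alpha_ n @[n --> \oo] --> alpha ->
  (forall n, `|theta_ n| <= C) -> `|theta| <= C ->
  (forall n, `|alpha_ n| <= C) -> `|alpha| <= C ->
  (forall n, `|u_ n| <= C) -> `|u| <= C ->
  (exists K, forall n, `|net (theta_ n) (alpha_ n) (u_ n)| <= K) /\
  ({ae time_measure T, forall t,
     `|iVL (evolution_fun (u_ n) t) - iVL (evolution_fun u t)| @[n --> \oo] --> 0} ->
   {ae time_measure T, forall t,
     net (theta_ n) (alpha_ n) (u_ n) t @[n --> \oo] --> net theta alpha u t}).
Proof.
move=> thc ac thC thC' aC aC' uC uC'.
have C0 : 0 <= C by rewrite (le_trans _ thC').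
have [D D0 hnet] := nemytskii_nn_ae.
(* Dominates the parameters, bounded by [C], as well as the essential bounds of the states, at most
   [D * C]. *)
pose r := C + D * C; have DC0 : 0 <= D * C by rewrite mulr_ge0.
have r0 : 0 <= r by rewrite addr_ge0.
have Cr x : x <= C -> x <= r by move=> xC; rewrite (le_trans xC)// lerDl.
have Dr x : x <= C -> D * x <= r.
  by move=> xC; rewrite (le_trans (ler_wpM2l D0 xC))// lerDr.
have [K K0 hK] := hnet r r0; split.
  exists K => n.
  by case: (hK (theta_ n) (alpha_ n) (u_ n) (Cr _ (thC n)) (Cr _ (aC n)) (Dr _ (uC n))).
move=> uae.
have [L L0 hL] := nn_superposition_lipschitz (domain_measure_finite bOmega) p1 hsigma m hid r0.
apply: (@L2_op_cvg _ _ _ _ iLW _ _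
  (fun n t => netS r (theta_ n) (alpha_ n) (iVL (evolution_fun (u_ n) t)))
  (fun t => netS r theta alpha (iVL (evolution_fun u t)))).
- by move=> n; have [] :=
    hK (theta_ n) (alpha_ n) (u_ n) (Cr _ (thC n)) (Cr _ (aC n)) (Dr _ (uC n)).
- by have [] := hK theta alpha u (Cr _ thC') (Cr _ aC') (Dr _ uC').
apply: ae_imp uae => t ut e e0.
have e'0 : 0 < e / 3 / (L + 1) by rewrite !divr_gt0// ltr_wpDl.
move/cvgrPdist_le : thc => /(_ _ e'0) thc.
move/cvgrPdist_le : ac => /(_ _ e'0) ac.
move/cvgrPdist_le : ut => /(_ _ e'0) ut.
apply: filterS3 thc ac ut => n hth ha; rewrite sub0r normrN normr_id distrC => hu.
have [h _] := hL theta (theta_ n) alpha (alpha_ n) (iVL (evolution_fun u t))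
  (iVL (evolution_fun (u_ n) t)) (Cr _ thC') (Cr _ (thC n)) (Cr _ aC') (Cr _ (aC n)).
apply: (le_trans h).
apply: (@le_trans _ _ ((L + 1) * (e / 3 / (L + 1) + e / 3 / (L + 1) + e / 3 / (L + 1)))).
  by rewrite ler_pM ?lerDl ?addr_ge0// !lerD.
have L10 : L + 1 != 0 by rewrite gt_eqF// ltr_wpDl.
by rewrite le_eqVlt; apply/orP; left; apply/eqP; field.
Qed.

End nemytskii_network.

Section nemytskii_model.
Context (R : realType) (T : R) (X V W Z H : normedModType R)
  (j : bounded_op V Z) (iVH : bounded_op V H) (F : R -> X -> V -> W)
  (B : R -> R -> R) (gamma : L2time T R^o).
Hypothesis T0 : 0 < T.
Hypothesis hC : @embeds_in_C R T V Z j H iVH.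
Hypothesis hFmeas : forall lambda v,
  ae_strongly_measurable (time_measure T) (fun t => F t lambda v).
Hypothesis hFcont : forall lambda, {ae time_measure T, forall t, continuous (F t lambda)}.
Hypothesis hB : forall a, {homo B a : b c / b <= c}.
Hypothesis hFgrowth : {ae time_measure T, forall t, forall lambda v,
  `|F t lambda v| <= B `|lambda| `|iVH v| * (gamma t + `|v|)}.

Lemma nemytskii_F_ae (lambda : X) (u : evolution T j) :
  {ae time_measure T, forall t, nemytskii_F F lambda u t = F t lambda (evolution_fun u t)}.
Proof.
have [C C0 uC] := evolution_bounded_H T0 hC.
(* [B] may be negative; monotonicity places its value between those at 0 and at the H-bound of [u],
   so the sum of the two absolute values dominates it. *)
pose b := `|B `|lambda| 0| + `|B `|lambda| (C * `|u|)|.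
have b0 : 0 <= b by rewrite addr_ge0.
pose h t := b * (`|gamma t| + `|evolution_fun u t|).
have su : @strongly_measurable _ (measurableTypeR R) _ _ (evolution_fun u) := preLp_measurable _.
have mg := Lp_norm_meas gamma; have mu := strongly_measurable_norm su.
have one2 : (1 <= 2%:E :> \bar R)%E := one_le_two R.
apply: (@Lp_class_ae _ _ _ _ _ _ _ _ h).
- exact: (caratheodory_ae_strongly_measurable (time_measure_setT T) (hFmeas lambda)
    (hFcont lambda) su).
- by apply: measurable_funM => //; exact: measurable_funD.
- pose gu (t : measurableTypeR R) : R := `|gamma t| + `|evolution_fun u t|.
  have mgu : measurable_fun setT gu by exact: measurable_funD mg mu.
  have guoo : ('N[time_measure T]_(2%:E)[EFin \o gu] < +oo)%E.
    apply: (le_lt_trans (eminkowski (time_measure T) mg mu one2)).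
    rewrite lte_add_pinfty//.
      by have := preLp_fin (repr gamma); rewrite ge0_fin_numE// Lnorm_ge0.
    by have := preLp_fin (repr (evolution_val u).1); rewrite ge0_fin_numE// Lnorm_ge0.
  have gu0 t : 0 <= gu t by rewrite addr_ge0.
  have := ge0_LnormZ one2 b mgu gu0 guoo.
  rewrite ger0_norm// => hE.
  rewrite -[X in (X < _)%E]/('N[time_measure T]_(2%:E)[(fun t => (b * gu t)%:E)])%E hE.
  by rewrite lte_mul_pinfty// lee_fin.
- apply: ae_imp2 hFgrowth (uC u) => t Ft ut; rewrite (le_trans (Ft _ _))//.
  rewrite (le_trans (ler_norm _))// normrM ler_pM//; last first.
    by rewrite (le_trans (ler_normD _ _))// lerD2l normr_id.
  have B1 : B `|lambda| 0 <= B `|lambda| `|iVH (evolution_fun u t)| by exact: hB.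
  have B2 : B `|lambda| `|iVH (evolution_fun u t)| <= B `|lambda| (C * `|u|) by exact: hB.
  have := ler_norm (B `|lambda| (C * `|u|)); have := normr_ge0 (B `|lambda| (C * `|u|)).
  have := ler_norm (- B `|lambda| 0); rewrite normrN; have := normr_ge0 (B `|lambda| 0).
  by rewrite ler_norml /b; move=> *; apply/andP; split; lra.
Qed.

End nemytskii_model.

Section limit_inferior.
Context (R : realType).
Implicit Types (u : nat -> \bar R).

Lemma limn_esup_lt u (c : \bar R) : (limn_esup u < c)%E ->
  \forall n \near \oo, (u n < c)%E.
Proof.
move=> /ereal_inf_lt[_ [A [N _ NA] <-]] Ac; exists N => // n /= Nn.
by apply: le_lt_trans Ac; apply: ereal_sup_ubound; exists n => //; exact: NA.
Qed.

Lemma limn_einf_gt u (c : \bar R) : (c < limn_einf u)%E ->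
  \forall n \near \oo, (c < u n)%E.
Proof.
rewrite /limn_einf lteNr => /limn_esup_lt; apply: filterS => n.
by rewrite lteNl oppeK.
Qed.

Lemma cvg0_limn_einf_ge0 (v : nat -> R) : v n @[n --> \oo] --> 0 ->
  (0 <= limn_einf (fun n => (v n)%:E))%E.
Proof.
move=> v0; have : (fun n => (v n)%:E) @ \oo --> 0%E.
  by apply/fine_cvgP; split => //=; exact: nearW.
by move=> /cvg_einfs/cvg_lim; rewrite limn_einf_lim => ->.
Qed.

End limit_inferior.

(** Young's inequality splits the product into [dl * b ^+ 2], small in the mean by the choice of
    [dl], and [a ^+ 2 / (4 * dl)]. Since [a] is at most [M], its square is at most
    [(1 + M) ^+ 2 * Num.min 1 a], so convergence in measure is enough. *)
Lemma product_vanishes d (T : measurableType d) (R : realType)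
    (mu : {measure set T -> \bar R}) (a b : nat -> T -> R) (M K : R) :
  (forall n, measurable_fun setT (a n)) -> (forall n, measurable_fun setT (b n)) ->
  (forall n x, 0 <= a n x <= M) -> (forall n x, 0 <= b n x) ->
  (forall n, \int[mu]_x (b n x ^+ 2)%:E <= K%:E)%E ->
  vanishes (fun n => \int[mu]_x (Num.min 1 (a n x))%:E)%E ->
  vanishes (fun n => \int[mu]_x (a n x * b n x)%:E)%E.
Proof.
move=> ma mb aM b0 bK av e e0.
have K0 : 0 <= K.
  by rewrite -lee_fin (le_trans _ (bK 0%N))// integral_ge0// => x _; rewrite lee_fin sqr_ge0.
pose dl := e / (2 * (K + 1)).
have dl0 : 0 < dl by rewrite divr_gt0// mulr_gt0// ltr_wpDl.
pose q := (1 + M) ^+ 2 / (4 * dl).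
have q0 : 0 <= q by rewrite divr_ge0 ?sqr_ge0// mulr_ge0// ltW.
have e'0 : 0 < e / (2 * (q + 1)) by rewrite divr_gt0// mulr_gt0// ltr_wpDl.
apply: filterS (av _ e'0) => n hn.
have m1 : measurable_fun setT (fun x => b n x ^+ 2) by exact: measurable_funX.
have m2 : measurable_fun setT (fun x => Num.min 1 (a n x)) by exact: measurable_minr.
have min0 x : 0 <= Num.min 1 (a n x) by rewrite le_min ler01; case/andP: (aM n x).
apply: (@le_trans _ _ (\int[mu]_x (dl%:E * (b n x ^+ 2)%:E + q%:E * (Num.min 1 (a n x))%:E))%E).
  apply: ge0_le_integral => //.
  - by move=> x _; rewrite lee_fin mulr_ge0//; case/andP: (aM n x).
  - by apply/measurable_EFinP; exact: measurable_funM.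
  - apply: emeasurable_funD; apply: measurable_funeM; exact/measurable_EFinP.
  - move=> x _; rewrite -!EFinM -EFinD lee_fin.
    have /andP[a0 aMx] := aM n x; have M0 : 0 <= M by exact: le_trans aMx.
    have h1 : a n x ^+ 2 <= (1 + M) ^+ 2 * Num.min 1 (a n x).
      by have [a1|a1] := leP 1 (a n x); rewrite ?mulr1; nra.
    have h2 : a n x ^+ 2 / (4 * dl) <= q * Num.min 1 (a n x).
      by rewrite /q [leRHS]mulrAC; apply: ler_wpM2r => //; rewrite invr_ge0 mulr_ge0// ltW.
    apply: le_trans (lerD (lexx _) h2).
    rewrite -subr_ge0 (_ : _ - _ = (2 * dl * b n x - a n x) ^+ 2 / (4 * dl)).
      by rewrite divr_ge0 ?sqr_ge0// mulr_ge0// ltW.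
    by field; rewrite gt_eqF.
rewrite ge0_integralD//; last 4 first.
- by move=> x _; rewrite -EFinM lee_fin mulr_ge0 ?sqr_ge0// ltW.
- by apply: measurable_funeM; exact/measurable_EFinP.
- by move=> x _; rewrite -EFinM lee_fin mulr_ge0.
- by apply: measurable_funeM; exact/measurable_EFinP.
rewrite ge0_integralZl//; last 3 first.
- exact/measurable_EFinP.
- by move=> x _; rewrite lee_fin sqr_ge0.
- by rewrite lee_fin ltW.
rewrite ge0_integralZl//; last 2 first.
- exact/measurable_EFinP.
- by move=> x _; rewrite lee_fin.
have h1 := @lee_wpmul2l _ dl%:E ltac:(by rewrite lee_fin ltW) _ _ (bK n).
have h2 := @lee_wpmul2l _ q%:E ltac:(by rewrite lee_fin) _ _ hn.
apply: (le_trans (leeD h1 h2)); rewrite -!EFinM -EFinD lee_fin [leRHS]splitr.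
rewrite lerD//.
  rewrite /dl -mulrA ler_pM2l// ler_pdivrMl ?mulr_gt0 ?ltr_wpDl//.
  by have -> : 2 * (K + 1) * 2^-1 = K + 1 by [field]; rewrite lerDl.
rewrite mulrCA ler_pM2l// ler_pdivrMr ?mulr_gt0 ?ltr_wpDl//.
by have -> : 2^-1 * (2 * (q + 1)) = q + 1 by [field]; rewrite lerDl.
Qed.

(** * Weak limits of the model term under conditions (A) and (B) *)

Section pseudomonotone.
Context (R : realType) (T : R) (X V W Z H : normedModType R)
  (j : bounded_op V Z) (iVH : bounded_op V H) (iHW : bounded_op H W)
  (F : R -> X -> V -> W).
Hypothesis T0 : 0 < T.
Hypothesis hC : @embeds_in_C R T V Z j H iVH.
Hypothesis iHW_inj : injective iHW.
Hypothesis hFae : forall lambda (u : evolution T j), {ae time_measure T, forall t,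
  nemytskii_F F lambda u t = F t lambda (evolution_fun u t)}.
Context (u_ : nat -> evolution T j) (u : evolution T j) (lambda_ : nat -> X) (lambda : X).
Hypothesis uw : weak_cvg u_ u.
Hypothesis lw : weak_cvg lambda_ lambda.

Lemma weak_cvg_F_of_weakly_continuous (Fb : R -> X -> H -> W) :
  (forall t l v, t \in `]0, T[ -> F t l v = Fb t l (iVH v)) ->
  {ae time_measure T, forall t, weakly_continuous (fun z : X * H => Fb t z.1 z.2)} ->
  {ae time_measure T, forall t,
    weak_cvg (fun n => F t (lambda_ n) (evolution_fun (u_ n) t))
      (F t lambda (evolution_fun u t))}.
Proof.
move=> FE Fw.
apply: ae_imp3 Fw (weak_cvg_evolution T0 hC uw) (time_ae_itv T) => t Ft ut tT.
have := Ft _ _ (weak_cvg_pair lw ut); rewrite /= FE//.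
by rewrite (_ : _ \o _ = (fun n => F t (lambda_ n) (evolution_fun (u_ n) t)))//;
  apply/funext => n /=; rewrite FE.
Qed.

(** Compactness of [iVH] makes the states converge in H, in measure in time. Multiplied by the
    L^2-bounded model terms, the distances vanish in L^1(0,T), and a subsequence makes the duality
    products tend to 0 at a.e. time, which meets the premise of pseudomonotonicity. *)
Lemma weak_cvg_F_of_pseudomonotone (J : bounded_op H (dual W)) (C K : R) :
  (forall n, `|u_ n| <= C) ->
  (forall n, `|nemytskii_F F (lambda_ n) (u_ n)| <= K) ->
  compact_op iVH ->
  {ae time_measure T, forall t,
    forall (w_ : nat -> V) (w : V) (lambda_ : nat -> X) (lambda : X),
    weak_cvg (fun k => (iVH (w_ k), lambda_ k) : H * X) (iVH w, lambda) ->
    (0 <= limn_einf (fun k =>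
       ((J (iVH (w_ k - w)) : dual W) (F t (lambda_ k) (w_ k)))%:E))%E ->
    forall v : dual W,
    (limn_esup (fun k =>
       ((J (iVH (w_ k)) - v : dual W) (F t (lambda_ k) (w_ k)))%:E) <=
     ((J (iVH w) - v : dual W) (F t lambda w))%:E)%E} ->
  exists2 s : nat -> nat, {homo s : m n / (m < n)%N} & {ae time_measure T, forall t,
    weak_cvg (fun n => F t (lambda_ (s n)) (evolution_fun (u_ (s n)) t))
      (F t lambda (evolution_fun u t))}.
Proof.
move=> uC FK ci pm; have muT := time_measure_setT T.
have [D D0 uD] := evolution_bounded_H T0 hC.
have [DJ DJ0 hJ] := bounded_op_le J.
pose M := D * C + D * `|u|.
have C0 : 0 <= C by exact: le_trans (uC 0%N).
have M0 : 0 <= M by rewrite addr_ge0 ?mulr_ge0.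
pose f n : L2time T V := (evolution_val (u_ n)).1.
pose f0 : L2time T V := (evolution_val u).1.
have fC n : `|f n| <= C by exact: le_trans (evolution_norm_fst _) (uC n).
(* [product_vanishes] wants a bound at every [t]; by [hU] the truncation at [M] is inactive a.e. *)
pose a n t := Num.min M `|iVH (f n t) - iVH (f0 t)|.
pose b n t := `|nemytskii_F F (lambda_ n) (u_ n) t|.
have uwae := weak_cvg_evolution T0 hC uw.
have hv : vanishes (fun n => \int[time_measure T]_t (Num.min 1 `|iVH (f n t) - iVH (f0 t)|)%:E)%E.
  apply: (L2_compact_cvg muT ci iHW_inj fC).
  by apply: ae_imp uwae => t ut; exact: (weak_cvg_op (g := iHW) ut).
have ma n : measurable_fun setT (a n).
  by apply: measurable_minr => //; exact: op_dist_measurable.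
have mb n : measurable_fun setT (b n) by exact: Lp_norm_meas.
have habv : vanishes (fun n => \int[time_measure T]_t (a n t * b n t)%:E)%E.
  apply: (@product_vanishes _ _ _ _ a b M (K ^+ 2)) => //.
  - by move=> n t; rewrite le_min M0 normr_ge0/= ge_min lexx.
  - by move=> n t; exact: normr_ge0.
  - move=> n; apply: (@le_trans _ _ ((`|nemytskii_F F (lambda_ n) (u_ n)| ^+ 2)%:E)).
      by rewrite -L2_sqr_norm.
    rewrite lee_fin lerXn2r ?nnegrE//.
    by rewrite (le_trans _ (FK n)).
  - apply: vanishes_le hv _ => n; apply: ge0_le_integral => //.
    + by move=> t _; rewrite lee_fin !le_min ler01 M0/=.
    + by apply/measurable_EFinP; exact: measurable_minr.
    + by apply/measurable_EFinP; apply: measurable_minr => //; exact: op_dist_measurable.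
    + by move=> t _; rewrite lee_fin le_min !ge_min lexx/= lexx !orbT.
have [s hs sae] := integral_cvg0_subsequence
  (fun n => measurable_funM (ma n) (mb n))
  (fun n t => mulr_ge0 (ltac:(by rewrite le_min M0/=) : 0 <= a n t) (normr_ge0 _)) habv.
exists s => //.
have hF : {ae time_measure T, forall t, forall n,
    nemytskii_F F (lambda_ n) (u_ n) t = F t (lambda_ n) (evolution_fun (u_ n) t)}.
  by apply/ae_foralln => n; exact: hFae.
have hU : {ae time_measure T, forall t, forall n, `|iVH (f n t) - iVH (f0 t)| <= M}.
  apply/ae_foralln => n; apply: ae_imp2 (uD (u_ n)) (uD u) => t h1 h2.
  rewrite (le_trans (ler_normB _ _))// lerD// (le_trans h1)//.
  by rewrite ler_wpM2l.
have {}uwae : {ae time_measure T, forall t,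
    weak_cvg (fun n => iVH (evolution_fun (u_ (s n)) t)) (iVH (evolution_fun u t))}.
  by apply: ae_imp uwae => t; exact: (weak_cvg_comp hs).
have all4 := ae_imp2 (fun t => @conj _ _) (ae_imp2 (fun t => @conj _ _) pm sae) uwae.
apply: ae_imp3 all4 hF hU => t [[pmt st] ut] Ft Ut.
pose x k := F t (lambda_ (s k)) (evolution_fun (u_ (s k)) t).
pose dk k := (J (iVH (evolution_fun (u_ (s k)) t - evolution_fun u t)) : dual W) (x k).
have dk0 : dk k @[k --> \oo] --> 0.
  apply/cvgrPdist_le => e e0; have e'0 : 0 < e / DJ by rewrite divr_gt0.
  move/cvgrPdist_le : st => /(_ _ e'0); apply: filterS => n.
  rewrite /= !sub0r !normrN ger0_norm; last first.
    by apply: mulr_ge0; [rewrite /a le_min M0/=|exact: normr_ge0].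
  rewrite /a /b Ft min_r// => h.
  rewrite (le_trans (dual_le _ _))// (le_trans (ler_wpM2r _ (hJ _)))//.
  by rewrite linearB -mulrA -ler_pdivlMl// [leRHS]mulrC.
have lim v := pmt _ _ _ _ (weak_cvg_pair ut (weak_cvg_comp hs lw)) (cvg0_limn_einf_ge0 dk0) v.
(* With [v = J u - g] the duality product becomes [dk n + g (x n)], and [dk n] tends to 0. The
   inequality bounds [g (x n)] from above only; [- g] supplies the lower bound. *)
have half (g : dual W) e : 0 < e -> \forall n \near \oo,
    g (x n) <= g (F t lambda (evolution_fun u t)) + e.
  move=> e0; have := lim (J (iVH (evolution_fun u t)) - g).
  have -> : J (iVH (evolution_fun u t)) - (J (iVH (evolution_fun u t)) - g) = g.
    by rewrite opprB addrC subrK.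
  have e20 : 0 < e / 2 by rewrite divr_gt0.
  set l := (g (F t _ _))%:E => hl.
  have /limn_esup_lt h : (limn_esup (fun k => ((J (iVH (evolution_fun (u_ (s k)) t)) -
      (J (iVH (evolution_fun u t)) - g) : dual W) (x k))%:E) <
      (g (F t lambda (evolution_fun u t)) + e / 2)%:E)%E.
    by rewrite (le_lt_trans hl)// lte_fin ltrDl.
  move/cvgrPdist_le : dk0 => /(_ _ e20) dk0.
  apply: filterS2 h dk0 => n; rewrite lte_fin sub0r normrN ler_norml => h /andP[h1 h2].
  have hE :
    (J (iVH (evolution_fun (u_ (s n)) t)) - (J (iVH (evolution_fun u t)) - g) : dual W) (x n)
     = dk n + g (x n).
    rewrite /dk 2![in RHS]linearB.
    set A := J (iVH (evolution_fun (u_ (s n)) t)); set B := J (iVH (evolution_fun u t)).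
    rewrite -[LHS]/(A (x n) - (B (x n) - g (x n))) -[X in _ = X + _]/(A (x n) - B (x n)).
    by rewrite opprD opprK addrA.
  by move: h; rewrite hE; lra.
move=> g; apply/cvgrPdist_le => e e0; apply: filterS2 (half g e e0) (half (- g) e e0) => n h1 h2.
have gN y : (- g : dual W) y = - g y by [].
by rewrite !gN in h2; rewrite ler_norml; apply/andP; split; rewrite /x in h1 h2; lra.
Qed.

End pseudomonotone.

(** * Weak lower semicontinuity of the misfit *)

Lemma frequently_subsequence (P : nat -> Prop) : ~ (\forall n \near \oo, P n) ->
  exists2 s : nat -> nat, {homo s : m n / (m < n)%N} & forall n, ~ P (s n).
Proof.
move=> nP; have [f fP] : {f : nat -> nat & forall N, (N <= f N)%N /\ ~ P (f N)}.
  apply: (@choice _ _ (fun N n => (N <= n)%N /\ ~ P n)) => N.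
  apply: contrapT => h; apply: nP; exists N => // n /= Nn; apply: contrapT => nPn.
  by apply: h; exists n.
pose s := fix s n := if n is n'.+1 then f (s n').+1 else f 0%N.
exists s; last by case=> [|n]; exact: (fP _).2.
apply: homo_ltn; first exact: ltn_trans.
by move=> n; exact: (fP _).1.
Qed.

Lemma sqr_lsc (R : realType) (x : nat -> R) (l e : R) : 0 <= l -> (forall n, 0 <= x n) ->
  (forall b, b < l -> \forall n \near \oo, b < x n) -> 0 < e ->
  \forall n \near \oo, l ^+ 2 - e < x n ^+ 2.
Proof.
(* Then [(l - r) ^+ 2 > l ^+ 2 - e]; if [l < r] the left side of the goal is already negative. *)
move=> l0 x0 hx e0; pose r := e / (2 * l + 1).
have l1 : 0 < 2 * l + 1 by rewrite ltr_wpDl// mulr_ge0.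
have r0 : 0 < r by rewrite divr_gt0.
have rE : r * (2 * l + 1) = e by rewrite /r divfK// gt_eqF.
have : l - r < l by rewrite ltrBlDr ltrDl.
move=> /hx; apply: filterS => n hn; have xn := x0 n.
have [lr|lr] := ltP l r; first by rewrite -rE; nra.
have : (l - r) ^+ 2 <= x n ^+ 2 by rewrite lerXn2r ?nnegrE ?subr_ge0// ltW.
by rewrite -rE; nra.
Qed.

(** The derivative converges weakly as an element of L^2(0,T;W), the other two terms at a.e. time.
    The pairing, a bounded functional on L^2, accommodates both kinds of convergence. *)
Lemma residual_pairing_cvg (R : realType) (T : R) (W : normedModType R)
    (D_ F_ N_ : nat -> L2time T W) (D F N : L2time T W)
    (f_ : nat -> R -> W) (f : R -> W) (K1 K2 : R) :
  weak_cvg D_ D -> (forall n, `|F_ n| <= K1) -> (forall n, `|N_ n| <= K2) ->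
  (forall n, {ae time_measure T, forall t, F_ n t = f_ n t}) ->
  {ae time_measure T, forall t, F t = f t} ->
  {ae time_measure T, forall t, weak_cvg (fun n => f_ n t) (f t)} ->
  {ae time_measure T, forall t, N_ n t @[n --> \oo] --> N t} ->
  forall z : measurableTypeR R -> dual W, simple_function z ->
    pairing z (D_ n - F_ n - N_ n) @[n --> \oo] --> pairing z (D - F - N).
Proof.
move=> Dw FK NK /ae_foralln F_E FE fw Nw z sz; have muT := time_measure_setT T.
have [g gE] := pairing_dual muT sz.
have gl (a b c : L2time T W) : pairing z (a - b - c) = g a - pairing z (b + c).
  by rewrite -gE -addrA -opprD linearB -!gE.
rewrite gl; under eq_fun do rewrite gl.
apply: cvgB; first exact: Dw.
apply: (@pairing_cvg _ _ _ _ muT W z _ _ (K1 + K2) sz).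
  by move=> n; rewrite (le_trans (ler_normD _ _))// lerD.
have sumE : {ae time_measure T, forall t, forall n, (F_ n + N_ n : L2time T W) t = F_ n t + N_ n t}.
  by apply/ae_foralln => n; exact: Lp_addE.
have FN := ae_imp2 (fun t => @conj _ _) fw Nw.
have E1 := ae_imp2 (fun t => @conj _ _) F_E FE.
have E2 := ae_imp2 (fun t => @conj _ _) sumE (Lp_addE F N).
apply: ae_imp3 FN E1 E2 => t [ft Nt] [e1 e2] [e3 e4] h.
rewrite e4 e2 linearD; under eq_fun do rewrite e3 e1 linearD.
apply: cvgD; first exact: ft.
by apply: (cvg_comp _ _ Nt); exact: dual_continuous.
Qed.

Lemma sum_sqr_le (R : realType) (a b c s : R) : a ^+ 2 + b ^+ 2 + c ^+ 2 <= s -> a <= 1 + s.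
Proof.
have := sqr_ge0 (a - 1); have := sqr_ge0 b; have := sqr_ge0 c; nra.
Qed.

Section core.
Context (R : realType) (d : nat) (Omega : set 'rV[R]_d.+1) (T : R)
  (p : R) (p1 : (1 <= p%:E)%E) (m : nat) (X U0 V W Y Z H : normedModType R)
  (j : bounded_op V Z) (iU0H : bounded_op U0 H) (iVH : bounded_op V H)
  (iVL : bounded_op V (LpDomain Omega p1))
  (iLW : bounded_op (LpDomain Omega p1) W) (iHW : bounded_op H W)
  (F : R -> X -> V -> W)
  (ddt : bounded_op (evolution T j) (L2time T W))
  (M : bounded_op (evolution T j) (L2time T Y)) (sigma : R -> R) (hid : seq nat).
Local Notation evol := (evolution T j).
Local Notation net := (@nemytskii_nn R T d Omega _ p1 V W Z j iVL iLW sigma m hid).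
Local Notation mis := (@misfit R T d Omega _ p1 X U0 V W Y Z H j
  iU0H iVH iVL iLW F ddt M sigma m hid).
Hypothesis T0 : 0 < T.
Hypothesis bOmega : bounded_set Omega.
Hypothesis hLinfty : @embeds_in_Linfty R T V Z j d Omega _ p1 iVL.
Hypothesis hC : @embeds_in_C R T V Z j H iVH.
Hypothesis hsigma : locally_lipschitz sigma.
Hypothesis iVL_compact : compact_op iVL.
Hypothesis iLW_inj : injective iLW.
Hypothesis hVW : forall v, iLW (iVL v) = iHW (iVH v).
Hypothesis hFae : forall lambda (u : evol), {ae time_measure T, forall t,
  nemytskii_F F lambda u t = F t lambda (evolution_fun u t)}.
(** The common consequence of (A) and (B) on which the remaining argument rests; the bound [K] on
    the model terms is what (B) requires. *)
Hypothesis hFsub : forall (u_ : nat -> evol) u (lambda_ : nat -> X) lambda (C K : R),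
  weak_cvg u_ u -> weak_cvg lambda_ lambda -> (forall n, `|u_ n| <= C) ->
  (forall n, `|nemytskii_F F (lambda_ n) (u_ n)| <= K) ->
  exists2 s : nat -> nat, {homo s : m n / (m < n)%N} & {ae time_measure T, forall t,
    weak_cvg (fun n => F t (lambda_ (s n)) (evolution_fun (u_ (s n)) t))
      (F t lambda (evolution_fun u t))}.

Lemma misfitE y lambda alpha u0 (u : evol) theta :
  mis y (lambda, alpha, u0, u) theta =
  `|ddt u - nemytskii_F F lambda u - net theta alpha u| ^+ 2 +
  `|initial_value iVH u - iU0H u0| ^+ 2 + `|M u - y| ^+ 2.
Proof. by rewrite /misfit /sqnorm3 /= !subr0. Qed.

Lemma weak_cvgB (E : normedModType R) (x y : nat -> E) l k :
  weak_cvg x l -> weak_cvg y k -> weak_cvg (fun n => x n - y n) (l - k).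
Proof.
move=> xl yk f; rewrite linearB; under eq_fun do rewrite linearB.
by apply: cvgB; [exact: xl|exact: yk].
Qed.

Lemma weak_cvg_cst (E : normedModType R) (x : E) : weak_cvg (fun=> x) x.
Proof. by move=> f; exact: cvg_cst. Qed.

Lemma evolution_iVL_subsequence (u_ : nat -> evol) u (C : R) :
  weak_cvg u_ u -> (forall n, `|u_ n| <= C) ->
  exists2 s : nat -> nat, {homo s : m n / (m < n)%N} & {ae time_measure T, forall t,
    `|iVL (evolution_fun (u_ (s n)) t) - iVL (evolution_fun u t)| @[n --> \oo] --> 0}.
Proof.
move=> uw uC; pose f n : L2time T V := (evolution_val (u_ n)).1.
pose f0 : L2time T V := (evolution_val u).1.
have fC n : `|f n| <= C by exact: le_trans (evolution_norm_fst _) (uC n).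
have hv := @L2_compact_cvg _ _ _ (time_measure T) (time_measure_setT T) _ _ _ iVL iLW f f0 C.
(* Weak limits are known in H, whereas compactness concerns L^p(Omega); the two spaces are compared
   inside W. *)
have fw : {ae time_measure T, forall t, weak_cvg (fun n => iLW (iVL (f n t))) (iLW (iVL (f0 t)))}.
  apply: ae_imp (weak_cvg_evolution T0 hC uw) => t ut.
  rewrite hVW (_ : (fun n => _) = (fun n => iHW (iVH (f n t)))); last first.
    by apply/funext => n; rewrite hVW.
  exact: (weak_cvg_op (g := iHW) ut).
have [||s hs sae] := integral_cvg0_subsequence _ _ (hv iVL_compact iLW_inj fC fw).
- by move=> n; apply: measurable_minr => //; exact: op_dist_measurable.
- by move=> n t; rewrite le_min ler01 normr_ge0.
exists s => //; apply: ae_imp sae => t /cvgrPdist_lt h; apply/cvgrPdist_le => e e0.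
(* Strictly below 1, the truncated distance is the distance itself. *)
have e'0 : 0 < Num.min e 1 by rewrite lt_min e0 ltr01.
apply: filterS (h _ e'0) => n.
rewrite !sub0r !normrN normr_id ger0_norm ?le_min ?ler01//=.
rewrite lt_min !gt_min ltxx/= => /andP[/orP[h1|/ltW//] h2].
by rewrite ltW// (lt_trans h2).
Qed.

(** Two successive extractions, one for the model term and one for the network term. The limit does
    not depend on them, which suffices for an argument by contradiction. *)
Lemma residual_pairing_subsequence (u_ : nat -> evol) u lambda_ lambda
    (alpha_ : nat -> 'cV[R]_m) alpha (theta_ : nat -> nn_params R (m + 1) hid) theta (K : R) :
  weak_cvg u_ u -> weak_cvg lambda_ lambda -> weak_cvg alpha_ alpha ->
  weak_cvg theta_ theta ->
  (forall n, `|ddt (u_ n) - nemytskii_F F (lambda_ n) (u_ n) -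
     net (theta_ n) (alpha_ n) (u_ n)| <= K) ->
  exists2 s : nat -> nat, {homo s : m n / (m < n)%N} &
    forall z : measurableTypeR R -> dual W, simple_function z ->
      pairing z (ddt (u_ (s n)) - nemytskii_F F (lambda_ (s n)) (u_ (s n)) -
        net (theta_ (s n)) (alpha_ (s n)) (u_ (s n)) : L2time T W) @[n --> \oo] -->
      pairing z (ddt u - nemytskii_F F lambda u - net theta alpha u : L2time T W).
Proof.
move=> uw lw aw tw rK.
have [Cu uC] := weak_cvg_bounded uw; have [Ca aC] := weak_cvg_bounded aw.
have [Ct tC] := weak_cvg_bounded tw.
have [Cd dC] := weak_cvg_bounded (weak_cvg_op (g := ddt) uw).
pose C := Num.max (Num.max (Num.max Cu Ca) Ct) (Num.max `|u| (Num.max `|alpha| `|theta|)).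
have {}uC n : `|u_ n| <= C by rewrite !le_max uC.
have {}aC n : `|alpha_ n| <= C by rewrite !le_max aC !orbT.
have {}tC n : `|theta_ n| <= C by rewrite !le_max tC !orbT.
have uC' : `|u| <= C by rewrite !le_max lexx !orbT.
have aC' : `|alpha| <= C by rewrite !le_max lexx !orbT.
have tC' : `|theta| <= C by rewrite !le_max lexx !orbT.
have [[KN NK] _] := nemytskii_nn_cvg iLW bOmega hLinfty hsigma (weak_cvg_nn_params tw)
  (weak_cvg_mx aw) tC tC' aC aC' uC uC'.
(* The growth condition gives no bound here, B being arbitrary in its first
   argument: F(lambda_n, u_n) is bounded in L^2 because the residual is. *)
have FK n : `|nemytskii_F F (lambda_ n) (u_ n)| <= Cd + KN + K.
  have := rK n; set r := ddt (u_ n) - _ - _ => rKn.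
  have -> : nemytskii_F F (lambda_ n) (u_ n) =
      ddt (u_ n) - net (theta_ n) (alpha_ n) (u_ n) - r.
    by rewrite /r opprB addrA subrK opprB addrC subrK.
  rewrite (le_trans (ler_normB _ _))// lerD// (le_trans (ler_normB _ _))// lerD//.
    exact: dC.
have [s1 hs1 Fw] := hFsub uw lw uC FK.
have [s2 hs2 Lw] := evolution_iVL_subsequence (weak_cvg_comp hs1 uw) (fun n => uC (s1 n)).
pose s := s1 \o s2; have hs : {homo s : m n / (m < n)%N} by exact: homo_ltn_comp.
exists s => //; apply: (@residual_pairing_cvg _ _ _ (fun n => ddt (u_ (s n)))
  (fun n => nemytskii_F F (lambda_ (s n)) (u_ (s n)))
  (fun n => net (theta_ (s n)) (alpha_ (s n)) (u_ (s n)))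
  (ddt u) (nemytskii_F F lambda u) (net theta alpha u)
  (fun n t => F t (lambda_ (s n)) (evolution_fun (u_ (s n)) t))
  (fun t => F t lambda (evolution_fun u t)) (Cd + KN + K) KN).
- exact: (weak_cvg_op (g := ddt) (weak_cvg_comp hs uw)).
- by move=> n; exact: FK.
- by move=> n; exact: NK.
- by move=> n; exact: hFae.
- exact: hFae.
- by apply: ae_imp Fw => t; exact: weak_cvg_comp.
have [_] := nemytskii_nn_cvg iLW bOmega hLinfty hsigma
  (weak_cvg_nn_params (weak_cvg_comp hs tw)) (weak_cvg_mx (weak_cvg_comp hs aw))
  (fun n => tC (s n)) tC' (fun n => aC (s n)) aC' (fun n => uC (s n)) uC'.
exact.
Qed.

Lemma initial_residual_lsc (u_ : nat -> evol) u (u0_ : nat -> U0) u0 b :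
  weak_cvg u_ u -> weak_cvg u0_ u0 -> b < `|initial_value iVH u - iU0H u0| ->
  \forall n \near \oo, b < `|initial_value iVH (u_ n) - iU0H (u0_ n)|.
Proof.
move=> uw u0w; have [g gE] := initial_value_op T0 hC; rewrite gE => bl.
have w := weak_cvgB (weak_cvg_op (g := g) uw) (weak_cvg_op (g := iU0H) u0w).
by apply: filterS (weak_cvg_norm_le w bl) => n; rewrite gE.
Qed.

(** If the claim failed, the misfit would be at most [b] along a subsequence. This very bound
    controls the residual and allows [residual_pairing_subsequence]; the three semicontinuous terms
    then exceed [b] in total. *)
Lemma misfit_lsc y (z_ : nat -> X * 'cV[R]_m * U0 * evol) z theta_ theta b :
  weak_cvg z_ z -> weak_cvg theta_ theta -> b < mis y z theta ->
  \forall n \near \oo, b < mis y (z_ n) (theta_ n).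
Proof.
move=> zw tw bl; apply: contrapT => /frequently_subsequence[s hs hb].
have {}zw := weak_cvg_comp hs zw; have {}tw := weak_cvg_comp hs tw.
have uw := weak_cvg_op (g := snd_op _ _) zw.
have w1 := weak_cvg_op (g := fst_op _ _) zw.
have u0w := weak_cvg_op (g := snd_op _ _) w1.
have w2 := weak_cvg_op (g := fst_op _ _) w1.
have aw := weak_cvg_op (g := snd_op _ _) w2.
have lw := weak_cvg_op (g := fst_op _ _) w2.
pose u_ n := (z_ (s n)).2; pose u0_ n := (z_ (s n)).1.2.
pose alpha_ n := (z_ (s n)).1.1.2; pose lambda_ n := (z_ (s n)).1.1.1.
pose rho n := ddt (u_ n) - nemytskii_F F (lambda_ n) (u_ n) - net (theta_ (s n)) (alpha_ n) (u_ n).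
pose u := z.2; pose u0 := z.1.2; pose alpha := z.1.1.2; pose lambda := z.1.1.1.
have mis0 : mis y z theta = `|ddt u - nemytskii_F F lambda u - net theta alpha u| ^+ 2 +
    `|initial_value iVH u - iU0H u0| ^+ 2 + `|M u - y| ^+ 2.
  by rewrite -misfitE /u /u0 /alpha /lambda -!surjective_pairing.
rewrite mis0 in bl.
have misE n : mis y (z_ (s n)) (theta_ (s n)) =
    `|rho n| ^+ 2 + `|initial_value iVH (u_ n) - iU0H (u0_ n)| ^+ 2 + `|M (u_ n) - y| ^+ 2.
  by rewrite -misfitE /u_ /u0_ /alpha_ /lambda_ -!surjective_pairing.
have misb n : mis y (z_ (s n)) (theta_ (s n)) <= b by rewrite leNgt; apply/negP; exact: hb.
have rK n : `|rho n| <= 1 + b.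
  by have := misb n; rewrite misE; exact: sum_sqr_le.
have [s2 hs2 pc] := residual_pairing_subsequence uw lw aw tw rK.
have l1 := L2_norm_lsc (time_measure_setT T) pc.
pose l1v := `|ddt u - nemytskii_F F lambda u - net theta alpha u|.
pose l2v := `|initial_value iVH u - iU0H u0|; pose l3v := `|M u - y|.
(* The gap to [b] is shared equally among the three terms. *)
pose e := (l1v ^+ 2 + l2v ^+ 2 + l3v ^+ 2 - b) / 3.
have e0 : 0 < e by rewrite divr_gt0// subr_gt0.
have h1 := sqr_lsc (normr_ge0 _) (fun n => normr_ge0 (rho (s2 n))) (fun c => @l1 c) e0.
have h2 := sqr_lsc (normr_ge0 _)
  (fun n => normr_ge0 (initial_value iVH (u_ (s2 n)) - iU0H (u0_ (s2 n))))
  (fun c => @initial_residual_lsc _ _ _ _ c (weak_cvg_comp hs2 uw) (weak_cvg_comp hs2 u0w)) e0.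
have h3 := sqr_lsc (normr_ge0 _) (fun n => normr_ge0 (M (u_ (s2 n)) - y))
  (fun c => @weak_cvg_norm_le _ _ _ _ c (weak_cvgB (weak_cvg_op (g := M) (weak_cvg_comp hs2 uw))
    (@weak_cvg_cst _ y))) e0.
have [N1 _ g1] := h1; have [N2 _ g2] := h2; have [N3 _ g3] := h3.
pose n := maxn N1 (maxn N2 N3).
have n1 := g1 n (leq_maxl _ _).
have n2 := g2 n (leq_trans (leq_maxl _ _) (leq_maxr _ _)).
have n3 := g3 n (leq_trans (leq_maxr _ _) (leq_maxr _ _)).
have := misb (s2 n); rewrite misE leNgt => /negP; apply.
have bE : b = (l1v ^+ 2 - e) + (l2v ^+ 2 - e) + (l3v ^+ 2 - e) by rewrite /e; field.
by rewrite bE; apply: ltrD => //; apply: ltrD.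
Qed.

End core.

(** * Existence of minimizers *)

Section direct_method.
Context (R : realType).

(** Says that [l] is at most the limit inferior of [x]; testing with real [b] treats [l = +oo]
    uniformly. *)
Definition lower_limit (x : nat -> \bar R) (l : \bar R) : Prop :=
  forall b : R, (b%:E < l)%E -> \forall n \near \oo, (b%:E < x n)%E.

Lemma weakly_lsc_lower_limit (E : normedModType R) (f : E -> \bar R) x l :
  weakly_lsc f -> weak_cvg x l -> lower_limit (f \o x) (f l).
Proof. by move=> lf xl b bl; apply: limn_einf_gt; exact: lt_le_trans bl (lf _ _ xl). Qed.

Lemma lower_limitD (x y : nat -> \bar R) (l k : \bar R) :
  (forall n, 0 <= x n)%E -> (forall n, 0 <= y n)%E -> (0 <= l)%E -> (0 <= k)%E ->
  lower_limit x l -> lower_limit y k -> lower_limit (fun n => x n + y n)%E (l + k)%E.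
Proof.
move=> x0 y0 l0 k0 xl yk b.
case: l l0 xl => [l| |//] l0 xl; last first.
  move=> _; apply: filterS (xl b (ltry _)) => n; move=> /lt_le_trans; apply.
  by rewrite leeDl.
case: k k0 yk => [k| |//] k0 yk; last first.
  move=> _; apply: filterS (yk b (ltry _)) => n; move=> /lt_le_trans; apply.
  by rewrite leeDr.
rewrite -EFinD lte_fin => blk; pose e := (l + k - b) / 2.
have e0 : 0 < e by rewrite divr_gt0// subr_gt0.
have hl : ((l - e)%:E < l%:E)%E by rewrite lte_fin ltrBlDr ltrDl.
have hk : ((k - e)%:E < k%:E)%E by rewrite lte_fin ltrBlDr ltrDl.
apply: filterS2 (xl _ hl) (yk _ hk) => n h1 h2.
have -> : b = (l - e) + (k - e) by rewrite /e; field.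
by rewrite EFinD; apply: lteD.
Qed.

Lemma lower_limit_sum (I : Type) (r : seq I) (x : I -> nat -> \bar R) (l : I -> \bar R) :
  (forall i n, 0 <= x i n)%E -> (forall i, 0 <= l i)%E ->
  (forall i, lower_limit (x i) (l i)) ->
  lower_limit (fun n => \sum_(i <- r) x i n)%E (\sum_(i <- r) l i)%E.
Proof.
move=> x0 l0 xl; elim: r => [|i r IH].
  rewrite big_nil => b b0; apply/nearW => n.
  by rewrite big_nil.
rewrite big_cons (_ : (fun n => _) = (fun n => x i n + \sum_(j <- r) x j n)%E).
  by apply: lower_limitD => // [n|]; exact: sume_ge0.
by apply/funext => n; rewrite big_cons.
Qed.

(** [conv] is left abstract so that tuples can converge componentwise, a tuple of states being a
    function on ['I_K] and not an element of a normed space here. *)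
Lemma direct_method (A : Type) (a0 : A) (J : A -> \bar R) (conv : (nat -> A) -> A -> Prop) :
  (forall a, 0 <= J a)%E ->
  (forall (c : R) a, (forall n, J (a n) <= c%:E)%E ->
    exists2 s : nat -> nat, {homo s : m n / (m < n)%N} & exists l, conv (a \o s) l) ->
  (forall a l, conv a l -> lower_limit (J \o a) (J l)) ->
  exists a, forall a', (J a <= J a')%E.
Proof.
move=> J0 Jcomp Jlsc; pose i := ereal_inf (range J).
have iJ a : (i <= J a)%E by apply: ereal_inf_lbound; exists a.
have i0 : (0 <= i)%E by apply: le_ereal_inf_tmp => _ [a _ <-].
(* If the objective is identically infinite, every point, such as [a0], is a minimizer. *)
case: (eqVneq i +oo%E) => [ioo|ioo].
  by exists a0 => a'; rewrite (le_trans (leey _))// -ioo.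
have ifin : i \is a fin_num by rewrite ge0_fin_numE// ltey.
have [a aP] : {a : nat -> A & forall n, (J (a n) < i + (n.+1%:R^-1)%:E)%E}.
  apply: (@choice _ _ (fun n a => (J a < i + (n.+1%:R^-1)%:E)%E)) => n.
  have e0 : 0 < n.+1%:R^-1 :> R by rewrite invr_gt0.
  by have [_ [a _ <-] ha] := lb_ereal_inf_adherent e0 ifin; exists a.
have [|s hs [l al]] := Jcomp (fine i + 1) a.
  move=> n; rewrite (le_trans (ltW (aP n)))// EFinD fineK// leeD2l// lee_fin.
  by rewrite invf_le1// ler1n.
exists l => a'; apply: le_trans (iJ a'); rewrite leNgt; apply/negP => il.
(* A real level strictly between the infimum and [J l], which may be infinite. *)
have [b ib bl] : exists2 b : R, fine i < b & (b%:E < J l)%E.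
  move: il; rewrite -[i in X in X -> _]fineK//.
  case: (J l) (J0 l) => [r| |//] _ h; last by exists (fine i + 1); rewrite ?ltry// ltrDl.
  rewrite lte_fin in h; move: (fine i) h => fi h.
  by exists ((fi + r) / 2); [lra|rewrite lte_fin; lra].
have [N1 _ h1] := Jlsc _ _ al b bl.
have [N2 _ h2] : \forall n \near \oo, n.+1%:R^-1 < b - fine i.
  have bi : 0 < b - fine i by rewrite subr_gt0.
  exact: (near_infty_natSinv_lt (PosNum bi)).
pose n := maxn N1 N2.
have := h1 n (leq_maxl _ _); rewrite /= => /lt_trans/(_ (aP (s n))).
rewrite -[i]fineK// -EFinD lte_fin => h3.
have sn : (n <= s n)%N.
  by elim: (n) => // k; move/leq_ltn_trans; apply; exact: hs.
have := h2 (s n) (leq_trans (leq_maxr _ _) sn).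
by rewrite /= ltrBrDl => /(lt_trans h3); rewrite ltxx.
Qed.

End direct_method.

Section weakly_precompact_tuple.
Context (R : realType) (A B : normedModType R) (K : nat) (S : set (A * B)%type).

(** One extraction for each index, pairing its component with the shared [t]; later extractions
    preserve the limits found before. *)
Lemma weakly_precompact_tuple (z : nat -> 'I_K -> A) (t : nat -> B) :
  (0 < K)%N -> weakly_precompact S -> (forall n k, S (z n k, t n)) ->
  exists2 s : nat -> nat, {homo s : m n / (m < n)%N} &
    exists l : ('I_K -> A) * B, weak_cvg (t \o s) l.2 /\
      forall k, weak_cvg (fun n => z (s n) k) (l.1 k).
Proof.
move=> K0 pS zS.
suff [s hs [[tl tw] zw]] : exists2 s : nat -> nat, {homo s : m n / (m < n)%N} &
    (exists l, weak_cvg (t \o s) l) /\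
    forall k, k \in enum 'I_K -> exists l, weak_cvg (fun n => z (s n) k) l.
  have [zl zlP] : {zl : 'I_K -> A & forall k, weak_cvg (fun n => z (s n) k) (zl k)}.
    by apply: (@choice _ _ (fun k l => weak_cvg (fun n => z (s n) k) l)) => k;
      apply: zw; rewrite mem_enum.
  by exists s => //; exists (zl, tl).
elim: (enum 'I_K) => [|k r [s hs [[tl tw] zw]]].
  (* [S] only sees [t] together with some component, so an index is needed to start. *)
  have [s [hs [l lw]]] := pS (fun n => (z n (Ordinal K0), t n)) (fun n => zS n _).
  exists s => //; split => //; exists l.2.
  exact: (weak_cvg_op (g := snd_op A B) lw).
have [s' [hs' [l lw]]] := pS (fun n => (z (s n) k, t (s n))) (fun n => zS _ _).
exists (s \o s'); first exact: homo_ltn_comp.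
split; first by exists tl; exact: (weak_cvg_comp hs' tw).
move=> k'; rewrite inE => /predU1P[->|k'r].
  by exists l.1; exact: (weak_cvg_op (g := fst_op A B) lw).
by have [l' lw'] := zw k' k'r; exists l'; exact: (weak_cvg_comp hs' lw').
Qed.

End weakly_precompact_tuple.

(** Finiteness of [Reg2] at some point, in the second claim, lets the joint sublevel sets carry
    compactness for [Reg1]: were [Reg2] identically infinite, they would all be empty. Similarly
    [0 < K] lets the learning objective control at least one pair of a state tuple and [theta].
    Under (B), the pairing of W with its dual is the evaluation of [J (iVH w)]. *)
Theorem proposition6
  (R : realType)
  (* the domain Omega in R^(d+1), the time horizon, the exponent of L^p *)
  (d : nat) (Omega : set 'rV[R]_d.+1) (hOmega : bounded_lipschitz_domain Omega)
  (T : R) (hT : 0 < T)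
  (p : R) (hp : (1 <= p%:E)%E)
  (m K : nat) (hK : (0 < K)%N)
  (* the Banach spaces *)
  (X U0 V W Y Vt H : completeNormedModType R)
  (hX : reflexive_space X) (hU0 : reflexive_space U0)
  (hV : reflexive_space V /\ separable V) (hW : reflexive_space W /\ separable W)
  (hY : reflexive_space Y /\ separable Y) (hVt : reflexive_space Vt /\ separable Vt)
  (hH : reflexive_space H /\ separable H)
  (* the embeddings *)
  (iU0H : bounded_op U0 H) (hiU0H : injective iU0H)
  (iHW : bounded_op H W) (hiHW : injective iHW)
  (iVH : bounded_op V H) (hiVH : injective iVH)
  (iHVt : bounded_op H Vt) (hiHVt : injective iHVt)
  (iVY : bounded_op V Y) (hiVY : injective iVY)
  (iVL : bounded_op V (LpDomain Omega hp)) (hiVL : injective iVL)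
  (hVLc : compact_op iVL)
  (iLW : bounded_op (LpDomain Omega hp) W) (hiLW : injective iLW)
  (hVW : forall v, iLW (iVL v) = iHW (iVH v))
  (hLVt :
    (exists i : bounded_op (LpDomain Omega hp) Vt, injective i /\
       forall v, i (iVL v) = iHVt (iVH v)) \/
    (exists i : bounded_op Vt (LpDomain Omega hp), injective i /\
       (forall v, i (iHVt (iVH v)) = iVL v) /\
       forall h, iLW (i (iHVt h)) = iHW h))
  (* the function F *)
  (F : R -> X -> V -> W)
  (hFmeas : forall lambda v,
     ae_strongly_measurable (time_measure T) (fun t => F t lambda v))
  (hFcont : forall lambda, {ae time_measure T, forall t, continuous (F t lambda)})
  (B : R -> R -> R) (hB : forall a, {homo B a : b c / b <= c})
  (gamma : L2time T R^o)
  (hFgrowth : {ae time_measure T, forall t, forall lambda v,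
     `|F t lambda v| <= B `|lambda| `|iVH v| * (gamma t + `|v|)})
  (* the embeddings of the evolution space, d/dt and the measurement operator *)
  (hLinfty : @embeds_in_Linfty R T V Vt (op_comp iHVt iVH) d Omega _ hp iVL)
  (hC : @embeds_in_C R T V Vt (op_comp iHVt iVH) H iVH)
  (ddt : bounded_op (evolution T (op_comp iHVt iVH)) (L2time T W))
  (hddt : forall u : evolution T (op_comp iHVt iVH),
     weak_derivative (op_comp iHW iVH) (evolution_val u).1 (ddt u))
  (M : bounded_op (evolution T (op_comp iHVt iVH)) (L2time T Y))
  (* the activation function and the widths of the hidden layers *)
  (sigma : R -> R) (hsigma : locally_lipschitz sigma) (hid : seq nat)
  (* condition (A) or condition (B) *)
  (hAB :
    (exists Fb : R -> X -> H -> W,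
       (forall t lambda v, t \in `]0, T[ -> F t lambda v = Fb t lambda (iVH v)) /\
       {ae time_measure T, forall t,
          weakly_continuous (fun z : X * H => Fb t z.1 z.2)}) \/
    (compact_op iVH /\
     exists J : bounded_op H (dual W), injective J /\
       {ae time_measure T, forall t,
          forall (w_ : nat -> V) (w : V) (lambda_ : nat -> X) (lambda : X),
          weak_cvg (fun k => (iVH (w_ k), lambda_ k) : H * X) (iVH w, lambda) ->
          (0 <= limn_einf (fun k =>
             ((J (iVH (w_ k - w)) : dual W) (F t (lambda_ k) (w_ k)))%:E))%E ->
          forall v : dual W,
          (limn_esup (fun k =>
             ((J (iVH (w_ k)) - v : dual W) (F t (lambda_ k) (w_ k)))%:E) <=
           ((J (iVH w) - v : dual W) (F t lambda w))%:E)%E}))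
  (* the regularizers *)
  (Reg1 : X * 'cV[R]_m * U0 * evolution T (op_comp iHVt iVH) -> \bar R)
  (Reg2 : nn_params R (m + 1) hid -> \bar R)
  (hReg1 : forall z, (0 <= Reg1 z)%E) (hReg2 : forall theta, (0 <= Reg2 theta)%E)
  (hlsc1 : weakly_lsc Reg1) (hlsc2 : weakly_lsc Reg2)
  (hsub : forall c : R, weakly_precompact
     [set q : (X * 'cV[R]_m * U0 * evolution T (op_comp iHVt iVH)) *
              nn_params R (m + 1) hid | (Reg1 q.1 + Reg2 q.2 <= c%:E)%E]) :
  (forall y : 'I_K -> L2time T Y,
     exists z theta, forall z' theta',
       (learning_objective iU0H iVH iVL iLW F ddt M sigma Reg1 Reg2 y z theta <=
        learning_objective iU0H iVH iVL iLW F ddt M sigma Reg1 Reg2 y z' theta')%E)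
  /\
  ((exists theta, (Reg2 theta < +oo)%E) ->
   forall (theta : nn_params R (m + 1) hid) (y : L2time T Y),
     exists z, forall z',
       (identification_objective iU0H iVH iVL iLW F ddt M sigma Reg1 theta y z <=
        identification_objective iU0H iVH iVL iLW F ddt M sigma Reg1 theta y z')%E).
Proof.
have [_ _ _ bOmega _] := hOmega.
have hFae := @nemytskii_F_ae R T X V W Vt H (op_comp iHVt iVH) iVH F B gamma hT hC
  hFmeas hFcont hB hFgrowth.
have hFsub : forall (u_ : nat -> evolution T (op_comp iHVt iVH)) u (lambda_ : nat -> X)
    lambda (C C' : R),
  weak_cvg u_ u -> weak_cvg lambda_ lambda -> (forall n, `|u_ n| <= C) ->
  (forall n, `|nemytskii_F F (lambda_ n) (u_ n)| <= C') ->
  exists2 s : nat -> nat, {homo s : m n / (m < n)%N} & {ae time_measure T, forall t,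
    weak_cvg (fun n => F t (lambda_ (s n)) (evolution_fun (u_ (s n)) t))
      (F t lambda (evolution_fun u t))}.
  move=> u_ u lambda_ lambda C C' uw lw uC FC.
  case: hAB => [[Fb [FE Fw]]|[ci [J [_ pm]]]].
    exists id => //; exact: (weak_cvg_F_of_weakly_continuous hT hC uw lw FE Fw).
  exact: (weak_cvg_F_of_pseudomonotone hT hC hiHW hFae uw lw uC FC ci pm).
have mis_lsc := @misfit_lsc R d Omega T p hp m X U0 V W Y Vt H (op_comp iHVt iVH)
  iU0H iVH iVL iLW iHW F ddt M sigma hid hT bOmega hLinfty hC hsigma hVLc hiLW hVW
  hFae hFsub.
have mis_ge0 y z theta : (0 <= (misfit iU0H iVH iVL iLW F ddt M sigma y z theta)%:E)%E.
  by rewrite lee_fin /misfit /sqnorm3 !addr_ge0// sqr_ge0.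
split.
- move=> y; pose J a := learning_objective iU0H iVH iVL iLW F ddt M sigma Reg1 Reg2 y a.1 a.2.
  pose conv (a : nat -> ('I_K -> X * 'cV[R]_m * U0 * evolution T (op_comp iHVt iVH)) *
      nn_params R (m + 1) hid) l := weak_cvg (fun n => (a n).2) l.2 /\
    forall k, weak_cvg (fun n => (a n).1 k) (l.1 k).
  have sum0 (z : 'I_K -> _) theta k :
      (0 <= (misfit iU0H iVH iVL iLW F ddt M sigma (y k) (z k) theta)%:E + Reg1 (z k))%E.
    by rewrite adde_ge0.
  have [|||[z theta] hz] := @direct_method R _ (fun=> 0, 0) J conv.
  + by move=> a; rewrite adde_ge0// sume_ge0.
  + move=> c a ac; apply: (@weakly_precompact_tuple _ _ _ _ _
      (fun n => (a n).1) (fun n => (a n).2) hK (hsub c)) => n k.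
    (* Dropping the misfits and the other indices leaves [Reg1] of the [k]-th component plus
       [Reg2]. *)
    apply: le_trans (ac n); rewrite leeD2r// (bigD1 k)//=.
    apply: (@le_trans _ _ ((misfit iU0H iVH iVL iLW F ddt M sigma (y k) ((a n).1 k) (a n).2)%:E
      + Reg1 ((a n).1 k))%E); first by rewrite leeDr.
    by rewrite leeDl// sume_ge0.
  + move=> a l [tw zw]; apply: lower_limitD.
    * by move=> n; rewrite sume_ge0.
    * by move=> n.
    * by rewrite sume_ge0.
    * by [].
    * apply: lower_limit_sum => // k; apply: lower_limitD => //.
        by move=> b; rewrite lte_fin => bl; have := mis_lsc _ _ _ _ _ _ (zw k) tw bl;
          apply: filterS => n; rewrite lte_fin.
      exact: weakly_lsc_lower_limit hlsc1 (zw k).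
    * exact: weakly_lsc_lower_limit hlsc2 tw.
  by exists z, theta => z' theta'; exact: (hz (z', theta')).
- move=> [theta0 theta0_fin] theta y.
  apply: (@direct_method R _ 0 _ (fun a l => weak_cvg a l)).
  + by move=> z; rewrite adde_ge0.
  + move=> c z zc; have fin0 : Reg2 theta0 \is a fin_num by rewrite ge0_fin_numE.
    (* [theta0] only serves for compactness, since [Reg2] may be infinite at the prescribed
       [theta]. *)
    have [s [hs [l lw]]] := hsub (c + fine (Reg2 theta0)) (fun n => (z n, theta0))
      (fun n => ltac:(by rewrite /= EFinD fineK// leeD2r// (le_trans _ (zc n))// leeDr)).
    exists s => //; exists l.1; exact: (weak_cvg_op (g := fst_op _ _) lw).
  + move=> z l zw; apply: lower_limitD => //.
      by move=> b; rewrite lte_fin => bl;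
        have := mis_lsc _ _ _ _ _ _ zw (weak_cvg_cst (x := theta)) bl;
        apply: filterS => n; rewrite lte_fin.
    exact: weakly_lsc_lower_limit hlsc1 zw.
Qed.
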